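(* Let $\Gamma$ be a connected Brauer graph with trivial multiplicities and let $B=B(\Gamma)$ be the associated Brauer graph algebra over an algebraically closed field $k$. Then the Euler form $q_B$ is non-negative. Moreover, the following conditions are equivalent: (a) the Euler form $q_B$ is positive; (b) the Cartan matrix $C_B$ of $B$ is non-singular; (c) $\Gamma$ is a tree, or $\Gamma$ is a $1$-cycle graph and the unique cycle has odd length.
   Context: A graph $G=(V,H,z,\iota)$ consists of finite sets $V$ (vertices), $H$ (half-edges), a map $z:H\to V$ and a fixed-point-free involution $\iota$ of $H$; edges are the orbits $\{h,\iota h\}$ (loops and multiple edges allowed). A ribbon graph $(G,\mathrm p)$ is a graph with a permutation $\mathrm p$ of $H$ whose orbits are the sets $z^{-1}(v)$, $v\in V$. A Brauer graph is $\Gamma=(G,\mathrm p,\mathrm M)$ with $\mathrm M:V\to\mathbb{N}$ a multiplicity function; it has trivial multiplicities if $\mathrm M\equiv1$. A connected graph is a $1$-cycle graph if $|E|-|V|+1=1$ (a loop counts as a cycle of length $1$, a pair of parallel edges as a cycle of length $2$). Brauer graph algebra $B(\Gamma)$ for trivial multiplicities (standard definition): if $\Gamma$ is a single vertex, $B=k$; if $\Gamma$ is a single non-loop edge, $B\cong k[x]/(x^2)$. Otherwise $B=kQ_\Gamma/I_\Gamma$, where the vertices of $Q_\Gamma$ are the edges of $\Gamma$; for each vertex $v$ with $|z^{-1}(v)|\geq2$ and each half-edge $h$ at $v$ there is an arrow $a_h$ from the edge of $h$ to the edge of $\mathrm p(h)$. For such $h$ let $C_h$ be the oriented cycle traversing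 successively $a_h,a_{\mathrm p(h)},a_{\mathrm p^2(h)},\dots$ exactly once around $v$. $I_\Gamma$ is generated by: $C_h-C_{\iota h}$ for every edge $\{h,\iota h\}$ both of whose half-edges are incident to vertices with at least two half-edges; the path traversing $C_h$ and then $a_h$, for every $h$ for which $a_h$ is defined; and every path of length two traversing an arrow $a_h$ and then an arrow $a_{h'}$ with $h'\neq\mathrm p(h)$. For a finite dimensional bound quiver algebra $B$ with indecomposable projectives $P_1,\dots,P_n$, the Cartan matrix is $C_B=[\dim_k\mathrm{Hom}_B(P_i,P_j)]_{i,j}$. The Euler form is the quadratic form on $K_0(\mathrm{per}\,B)$ (the Grothendieck group of perfect complexes) given by $q_B(x)=\langle x,x\rangle_B$, $\langle[X],[Y]\rangle_B=\sum_i(-1)^i\dim_k\mathrm{Hom}_{D^b(B)}(X,Y[i])$; in the basis $\{[P_i]\}$ the Gram matrix of $\langle-,-\rangle_B$ is $C_B$. It is non-negative (positive) if $q_B(x)\geq0$ for all $x$ ($q_B(x)>0$ for all $x\neq0$). *)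

(* Defs.v *)
From HB Require Import structures.
From mathcomp Require Import all_boot all_order perm all_algebra generic_quotient.
From mathcomp Require Import ring_quotient finmap boolp classical_sets fsbigop.
From mathcomp.multinomials Require Import monalg.

Set Implicit Arguments.
Unset Strict Implicit.
Unset Printing Implicit Defensive.

Import Order.TTheory GRing.Theory Num.Theory.
Local Open Scope ring_scope.
Local Open Scope quotient_scope.

Record quiver := Quiver {
  qvert : finType;
  qarr : finType;
  qsrc : qarr -> qvert;
  qtgt : qarr -> qvert
}.

Section Paths.
Variable Q : quiver.

Fixpoint is_path (i : qvert Q) (s : seq (qarr Q)) : bool :=
  if s is a :: s' then (qsrc a == i) && is_path (qtgt a) s' else true.

(* Paths are read from left to right, and keep their starting vertex so that
   there is one trivial path per vertex. *)
Record qpath := QPath {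
  pval : qvert Q * seq (qarr Q);
  pvalP : is_path pval.1 pval.2
}.

HB.instance Definition _ := [isSub for pval].
HB.instance Definition _ := [Choice of qpath by <:].

Definition plast (i : qvert Q) (s : seq (qarr Q)) : qvert Q :=
  last i [seq qtgt a | a <- s].

Lemma is_path_cat i s t :
  is_path i (s ++ t) = is_path i s && is_path (plast i s) t.
Proof.
by elim: s i => [|a s IHs] i //=; rewrite IHs andbA.
Qed.

Lemma plast_cat i s t : plast i (s ++ t) = plast (plast i s) t.
Proof. by rewrite /plast map_cat last_cat. Qed.

End Paths.

Section PathAlgebra.
Variables (k : fieldType) (Q : quiver).

Definition pathalg : Type := {malg k[qpath Q]}.

HB.instance Definition _ := GRing.Lmodule.on pathalg.

(* The basis element of the path starting at i and traversing s, and 0 if s is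
   not a path starting at i. *)
Definition ppath (i : qvert Q) (s : seq (qarr Q)) : pathalg :=
  if insub (i, s) is Some p then << (p : qpath Q) >> else 0.

Definition pmul (p q : qpath Q) : pathalg :=
  if plast (val p).1 (val p).2 == (val q).1
  then ppath (val p).1 ((val p).2 ++ (val q).2) else 0.

Definition pa_mul (x y : pathalg) : pathalg :=
  \sum_(p <- msupp x) \sum_(q <- msupp y) (x@_p * y@_q) *: pmul p q.

Definition pa_one : pathalg := \sum_(i : qvert Q) ppath i [::].

Lemma pa_mulEw (d1 d2 : {fset qpath Q}) (x y : pathalg) :
    (msupp x `<=` d1)%fset -> (msupp y `<=` d2)%fset ->
  pa_mul x y = \sum_(p <- d1) \sum_(q <- d2) (x@_p * y@_q) *: pmul p q.
Proof.
move=> le1 le2; rewrite /pa_mul (big_fset_incl _ le1) /=.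
  by apply: eq_bigr => p _; rewrite (big_fset_incl _ le2) //= => q _ qy;
     rewrite (mcoeff_outdom qy) mulr0 scale0r.
by move=> p _ px; rewrite big1_fset // => q _ _; rewrite (mcoeff_outdom px) mul0r scale0r.
Qed.

Lemma pa_mulDl : left_distributive pa_mul +%R.
Proof.
move=> x y z; pose d := (msupp x `|` msupp y)%fset.
rewrite (@pa_mulEw d (msupp z)) ?msuppD_le ?fsubset_refl //.
rewrite (@pa_mulEw d (msupp z) x) ?fsubsetUl ?fsubset_refl //.
rewrite (@pa_mulEw d (msupp z) y) ?fsubsetUr ?fsubset_refl // -big_split /=.
apply: eq_bigr => p _; rewrite -big_split /=; apply: eq_bigr => q _.
by rewrite mcoeffD mulrDl scalerDl.
Qed.

Lemma pa_mulDr : right_distributive pa_mul +%R.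
Proof.
move=> z x y; pose d := (msupp x `|` msupp y)%fset.
rewrite (@pa_mulEw (msupp z) d) ?msuppD_le ?fsubset_refl //.
rewrite (@pa_mulEw (msupp z) d z x) ?fsubsetUl ?fsubset_refl //.
rewrite (@pa_mulEw (msupp z) d z y) ?fsubsetUr ?fsubset_refl // -big_split /=.
apply: eq_bigr => p _; rewrite -big_split /=; apply: eq_bigr => q _.
by rewrite mcoeffD mulrDr scalerDl.
Qed.

Lemma pa_mulZl c x y : pa_mul (c *: x) y = c *: pa_mul x y.
Proof.
rewrite (@pa_mulEw (msupp x) (msupp y)) ?msuppZ_le ?fsubset_refl // /pa_mul scaler_sumr.
apply: eq_bigr => p _; rewrite scaler_sumr; apply: eq_bigr => q _.
by rewrite mcoeffZ scalerA mulrA.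
Qed.

Lemma pa_mulZr c x y : pa_mul x (c *: y) = c *: pa_mul x y.
Proof.
rewrite (@pa_mulEw (msupp x) (msupp y)) ?msuppZ_le ?fsubset_refl // /pa_mul scaler_sumr.
apply: eq_bigr => p _; rewrite scaler_sumr; apply: eq_bigr => q _.
by rewrite mcoeffZ scalerA mulrCA.
Qed.

Lemma pa_mul0l x : pa_mul 0 x = 0.
Proof. by rewrite /pa_mul msupp0 big_seq_fset0. Qed.

Lemma pa_mul0r x : pa_mul x 0 = 0.
Proof. by have := pa_mulZr 0 x 0; rewrite !scale0r. Qed.

Lemma pa_mulUU (p q : qpath Q) : pa_mul << p >> << q >> = pmul p q.
Proof.
rewrite (@pa_mulEw [fset p]%fset [fset q]%fset) ?msuppU_le //.
by rewrite !big_seq_fset1 !mcoeffUU mulr1 scale1r.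
Qed.

Lemma ppath_val (p : qpath Q) : ppath (val p).1 (val p).2 = << p >>.
Proof. by rewrite /ppath -surjective_pairing valK. Qed.

Lemma ppath0 i s : ~~ is_path i s -> ppath i s = 0.
Proof. by move=> nis; rewrite /ppath insubN. Qed.

Lemma pa_mul_ppath i s j t : pa_mul (ppath i s) (ppath j t) =
  if is_path i s && (plast i s == j) then ppath i (s ++ t) else 0.
Proof.
have [ps|ps] := boolP (is_path i s); last by rewrite ppath0 // pa_mul0l.
have [pt|pt] := boolP (is_path j t); last first.
  rewrite (ppath0 pt) pa_mul0r; case: eqP => //= eij.
  by rewrite ppath0 // is_path_cat ps eij.
have -> : ppath i s = << @QPath Q (i, s) ps >>.
  by rewrite -ppath_val.
have -> : ppath j t = << @QPath Q (j, t) pt >>.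
  by rewrite -ppath_val.
by rewrite pa_mulUU /pmul.
Qed.

Lemma pathalgE (x : pathalg) :
  x = \sum_(p <- msupp x) x@_p *: ppath (val p).1 (val p).2.
Proof.
rewrite {1}[x]monalgE; apply: eq_bigr => p _; rewrite ppath_val.
by apply/malgP => q; rewrite mcoeffU mcoeffZ mcoeffU mulr_natr.
Qed.

Lemma pathalg_ext (f g : pathalg -> pathalg) :
    linear f -> linear g ->
    (forall p : qpath Q, f (ppath (val p).1 (val p).2) =
                         g (ppath (val p).1 (val p).2)) ->
  f =1 g.
Proof.
move=> lf lg efg x; rewrite [x]pathalgE.
have lin0 (h : pathalg -> pathalg) : linear h -> h 0 = 0.
  by move=> /(_ (- 1) 0 0); rewrite addr0 scaler0 scaleN1r addNr.
elim: (enum_fset (msupp x)) => [|p r IHr].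
  by rewrite big_nil lin0 // lin0.
by rewrite big_cons lf lg efg IHr.
Qed.

Lemma pa_linl y : linear (pa_mul^~ y).
Proof. by move=> c x x'; rewrite /= pa_mulDl pa_mulZl. Qed.

Lemma pa_linr y : linear (pa_mul y).
Proof. by move=> c x x'; rewrite /= pa_mulDr pa_mulZr. Qed.

Lemma pa_mulA : associative pa_mul.
Proof.
move=> x y z; move: x; apply: pathalg_ext => [c x x'|c x x'|p].
- by rewrite pa_linl.
- by rewrite !pa_linl.
move: y; apply: pathalg_ext => [c y y'|c y y'|q].
- by rewrite pa_linl pa_linr.
- by rewrite pa_linr pa_linl.
move: z; apply: pathalg_ext => [c z z'|c z z'|r].
- by rewrite !pa_linr.
- by rewrite pa_linr.
rewrite !pa_mul_ppath (valP p) (valP q) /=.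
case: ifP => [qr|qr]; case: ifP => [pq|pq]; rewrite ?pa_mul0r ?pa_mul0l //.
- rewrite !pa_mul_ppath is_path_cat plast_cat (valP p) (eqP pq) (valP q) qr.
  by rewrite eqxx catA.
- by rewrite pa_mul_ppath (valP p) pq.
- by rewrite pa_mul_ppath is_path_cat plast_cat (valP p) (eqP pq) (valP q) qr.
Qed.

Lemma pa_mul1l : left_id pa_one pa_mul.
Proof.
apply: pathalg_ext => [||p] //; first exact: pa_linr.
rewrite (big_morph (pa_mul^~ _) (fun x y => pa_mulDl x y _) (pa_mul0l _)).
rewrite (bigD1 (val p).1) //= pa_mul_ppath /= /plast /= eqxx big1 ?addr0 //.
by move=> i ni; rewrite pa_mul_ppath /= /plast /= (negPf ni).
Qed.

Lemma pa_mul1r : right_id pa_one pa_mul.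
Proof.
apply: pathalg_ext => [||p] //; first exact: pa_linl.
rewrite (big_morph (pa_mul _) (pa_mulDr _) (pa_mul0r _)).
rewrite (bigD1 (plast (val p).1 (val p).2)) //=.
rewrite pa_mul_ppath (valP p) eqxx cats0 big1 ?addr0 // => i ni.
by rewrite pa_mul_ppath (valP p) eq_sym (negPf ni).
Qed.

HB.instance Definition _ := GRing.Zmodule_isPzRing.Build pathalg
  pa_mulA pa_mul1l pa_mul1r pa_mulDl pa_mulDr.

Lemma pathalg_scalerAl (c : k) (x y : pathalg) : c *: (x * y) = (c *: x) * y.
Proof. by rewrite [RHS]pa_mulZl. Qed.

Lemma pathalg_scalerAr (c : k) (x y : pathalg) : c *: (x * y) = x * (c *: y).
Proof. by rewrite [RHS]pa_mulZr. Qed.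

End PathAlgebra.

Section BoundQuiver.
Variables (k : fieldType) (Q : quiver) (R : pathalg k Q -> Prop).
Local Notation kQ := (pathalg k Q).

Definition two_sided_ideal (J : kQ -> Prop) : Prop :=
  [/\ J 0, forall x y, J x -> J y -> J (x + y) &
      forall a b x, J x -> J (a * x * b)].

Definition in_ideal (x : kQ) : Prop :=
  forall J, two_sided_ideal J -> (forall y, R y -> J y) -> J x.

Definition bq_ideal (x : kQ) : bool := `[< in_ideal x >].

Lemma bq_ideal_zmod_closed : zmod_closed bq_ideal.
Proof.
split; first by apply/asboolP => J [].
move=> x y /asboolP Ix /asboolP Iy; apply/asboolP => J hJ RJ.
have [_ JD JM] := hJ; apply: JD; first exact: Ix.
by rewrite -[- y]mulr1 -mulN1r; apply: JM; apply: Iy.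
Qed.

HB.instance Definition _ := GRing.isZmodClosed.Build kQ bq_ideal
  bq_ideal_zmod_closed.

Lemma bq_idealM a b x : x \in bq_ideal -> a * x * b \in bq_ideal.
Proof.
move=> /asboolP Ix; apply/asboolP => J hJ RJ.
by have [_ _ JM] := hJ; apply: JM; apply: Ix.
Qed.

Definition bqalg : Type :=
  Quotient.quot (GRing.ZmodClosed.clone kQ bq_ideal _).

HB.instance Definition _ := GRing.Zmodule.on bqalg.
HB.instance Definition _ := EqQuotient.on bqalg.

Definition bq_pi (x : kQ) : bqalg := \pi x.

Definition bq_mul (x y : bqalg) : bqalg := bq_pi (repr x * repr y).

Lemma bq_piD x y : bq_pi (x + y) = bq_pi x + bq_pi y.
Proof. by rewrite /bq_pi piE. Qed.

Lemma bq_reprK (x : bqalg) : bq_pi (repr x) = x.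
Proof. exact: reprK. Qed.

Lemma bq_piP x y : (bq_pi x = bq_pi y) <-> (x - y \in bq_ideal).
Proof.
by rewrite Quotient.idealrBE; split=> [e|/eqP //]; apply/eqP.
Qed.

Lemma bq_piM x y : bq_mul (bq_pi x) (bq_pi y) = bq_pi (x * y).
Proof.
apply/bq_piP; set x' := repr _; set y' := repr _.
have hx : x' - x \in bq_ideal by apply/bq_piP; rewrite bq_reprK.
have hy : y' - y \in bq_ideal by apply/bq_piP; rewrite bq_reprK.
have -> : x' * y' - x * y = 1 * (x' - x) * y' + x * (y' - y) * 1.
  by rewrite mul1r mulr1 mulrBl mulrBr addrA subrK.
by rewrite rpredD // bq_idealM.
Qed.

Lemma bq_mulA : associative bq_mul.
Proof.
move=> x y z; rewrite -(bq_reprK x) -(bq_reprK y) -(bq_reprK z).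
by rewrite !bq_piM mulrA.
Qed.

Lemma bq_mul1l : left_id (bq_pi 1) bq_mul.
Proof. by move=> x; rewrite -(bq_reprK x) bq_piM mul1r. Qed.

Lemma bq_mul1r : right_id (bq_pi 1) bq_mul.
Proof. by move=> x; rewrite -(bq_reprK x) bq_piM mulr1. Qed.

Lemma bq_mulDl : left_distributive bq_mul +%R.
Proof.
move=> x y z; rewrite -(bq_reprK x) -(bq_reprK y) -(bq_reprK z).
by rewrite -bq_piD !bq_piM mulrDl bq_piD.
Qed.

Lemma bq_mulDr : right_distributive bq_mul +%R.
Proof.
move=> x y z; rewrite -(bq_reprK x) -(bq_reprK y) -(bq_reprK z).
by rewrite -bq_piD !bq_piM mulrDr bq_piD.
Qed.

HB.instance Definition _ := GRing.Zmodule_isPzRing.Build bqalg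
  bq_mulA bq_mul1l bq_mul1r bq_mulDl bq_mulDr.

(* MathComp's lalgType requires 1 != 0, which may fail in kQ/(R), so the
   k-algebra structure is given by the structure map k -> kQ/(R). *)
Definition bq_scal (c : k) : bqalg := bq_pi (c *: (1 : kQ)).

Lemma bq_scal_zmod : zmod_morphism bq_scal.
Proof.
move=> c d; rewrite /bq_scal scalerBl; apply: (addIr (bq_pi (d *: (1 : kQ)))).
by rewrite -bq_piD !subrK.
Qed.

Lemma bq_scal_monoid : monoid_morphism bq_scal.
Proof.
split; first by rewrite /bq_scal scale1r.
move=> c d; rewrite /bq_scal [RHS]bq_piM; congr bq_pi.
by rewrite -pathalg_scalerAl mul1r scalerA.
Qed.

HB.instance Definition _ := GRing.isZmodMorphism.Build k bqalg bq_scal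
  bq_scal_zmod.
HB.instance Definition _ := GRing.isMonoidMorphism.Build k bqalg bq_scal
  bq_scal_monoid.

Definition bq_idem (i : qvert Q) : bqalg := bq_pi (ppath k i [::]).

End BoundQuiver.

(* For an idempotent e, the left B-module of all x with x e = x is Be. *)
Section PrincipalModule.
Variables (B : pzRingType) (e : B).

Definition lproj_pred : pred B^o := fun x => x * e == x.

Lemma lproj_submod_closed : submod_closed lproj_pred.
Proof.
split; first by rewrite unfold_in /= mul0r.
move=> a x y; rewrite !unfold_in /= => /eqP xe /eqP ye.
by rewrite mulrDl ye -mulrA xe.
Qed.

HB.instance Definition _ := GRing.isSubmodClosed.Build B B^o lproj_pred
  lproj_submod_closed.

Record lproj := LProj { lproj_val : B^o; lproj_valP : lproj_val \in lproj_pred }.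

HB.instance Definition _ := [isSub for lproj_val].
HB.instance Definition _ := [Choice of lproj by <:].
HB.instance Definition _ := [SubChoice_isSubLmodule of lproj by <:].

End PrincipalModule.

Section Perfect.
(* B is seen as a k-algebra through iota; modules are left modules. *)
Variables (k : fieldType) (B : pzRingType) (iota : {rmorphism k -> B}).

(* For k-subspaces T <= S of the space of maps M -> N, the quotient S / T has
   k-dimension d. *)
Definition has_kdim (M N : lmodType B) (S T : (M -> N) -> Prop) (d : nat) :=
  exists b : 'I_d -> M -> N, (forall i, S (b i)) /\
    forall f, S f -> exists! c : 'rV[k]_d,
      T (fun x => f x - \sum_(i < d) iota (c 0 i) *: b i x).

Definition kdim (M N : lmodType B) (S T : (M -> N) -> Prop) : nat :=
  xget 0%N [set d | has_kdim S T d]%classic.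

Definition hom_dim (M N : lmodType B) : nat :=
  kdim (fun f : M -> N => linear f) (fun f : M -> N => forall x, f x = 0).

(* Direct summands of free modules of finite rank. *)
Definition fgproj (P : lmodType B) : Prop :=
  exists (n : nat) (s : P -> 'rV[B]_n) (r : 'rV[B]_n -> P),
    [/\ linear s, linear r & cancel s r].

(* A bounded (cohomological) complex of finitely generated projective
   B-modules, encoded by its total module X = \bigoplus_n X^n: pdeg n is the
   projection of X onto X^n, and pdif is the differential X^n -> X^(n+1). *)
Record perf := Perf {
  pobj :> lmodType B;
  pobj_fgproj : fgproj pobj;
  pdeg : int -> {linear pobj -> pobj};
  pdif : {linear pobj -> pobj};
  pdegM : forall m n x, pdeg m (pdeg n x) = if m == n then pdeg n x else 0;
  pdeg_sum : exists2 s : seq int, uniq s & forall x, x = \sum_(n <- s) pdeg n x;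
  pdif_deg : forall n x, pdif (pdeg n x) = pdeg (n + 1) (pdif x);
  pdif_pdif : forall x, pdif (pdif x) = 0
}.

Definition chain_map (X Y : perf) (f : X -> Y) : Prop :=
  [/\ linear f, forall n x, f (pdeg X n x) = pdeg Y n (f x) &
      forall x, f (pdif X x) = pdif Y (f x)].

Definition null_homotopic (X Y : perf) (f : X -> Y) : Prop :=
  exists s : X -> Y,
    [/\ linear s, forall n x, s (pdeg X n x) = pdeg Y (n - 1) (s x) &
        forall x, f x = pdif Y (s x) + s (pdif X x)].

Section Shift.
Variables (X : perf) (n : int).

Definition shift_deg (m : int) : {linear X -> X} := pdeg X (m + n).
Definition shift_dif (x : X) : X := (- 1) ^+ `|n|%N *: pdif X x.

Lemma shift_dif_linear : linear shift_dif.
Proof.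
move=> a x y; rewrite /shift_dif linearP scalerDr !scalerA.
by rewrite commr_sign.
Qed.

HB.instance Definition _ := GRing.isLinear.Build B X X *:%R shift_dif
  shift_dif_linear.

Lemma shift_degM m p x :
  shift_deg m (shift_deg p x) = if m == p then shift_deg p x else 0.
Proof. by rewrite /shift_deg pdegM (inj_eq (addIr _)). Qed.

Lemma shift_deg_sum :
  exists2 s : seq int, uniq s & forall x, x = \sum_(m <- s) shift_deg m x.
Proof.
have [s us es] := pdeg_sum X; exists [seq m - n | m <- s].
  by rewrite map_inj_uniq //; apply: addIr.
move=> x; rewrite {1}(es x) big_map; apply: eq_bigr => m _.
by rewrite /shift_deg subrK.
Qed.

Lemma shift_dif_deg m x : shift_dif (shift_deg m x) = shift_deg (m + 1) (shift_dif x).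
Proof. by rewrite /shift_dif /shift_deg pdif_deg linearZ addrAC. Qed.

Lemma shift_dif_dif x : shift_dif (shift_dif x) = 0.
Proof. by rewrite /shift_dif linearZ /= pdif_pdif !scaler0. Qed.

Definition shift : perf :=
  Perf (pobj_fgproj X) shift_degM shift_deg_sum shift_dif_deg
    (shift_dif_dif : forall x, shift_dif (shift_dif x) = 0).

End Shift.

Section Cone.
Variables (X Y : perf) (f : X -> Y) (hf : chain_map f).

Local Notation C := (X * Y)%type.

Definition cone_deg (n : int) (c : C) : C := (pdeg X (n + 1) c.1, pdeg Y n c.2).
Definition cone_dif (c : C) : C := (- pdif X c.1, f c.1 + pdif Y c.2).

Lemma cone_fgproj : fgproj (C : lmodType B).
Proof.
have [n [s [r [ls lr sr]]]] := pobj_fgproj X.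
have [m [t [q [lt lq tq]]]] := pobj_fgproj Y.
exists (n + m)%N, (fun c : C => row_mx (s c.1) (t c.2)).
exists (fun v => (r (lsubmx v), q (rsubmx v))); split.
- by move=> a c d /=; rewrite ls lt scale_row_mx add_row_mx.
- by move=> a v w /=; rewrite !linearP lr lq.
- by move=> [x y] /=; rewrite row_mxKl row_mxKr sr tq.
Qed.

Lemma cone_deg_linear n : linear (cone_deg n).
Proof. by move=> a c d; rewrite /cone_deg /= !linearP. Qed.

HB.instance Definition _ n := GRing.isLinear.Build B C C *:%R (cone_deg n)
  (cone_deg_linear n).

Lemma cone_dif_linear : linear cone_dif.
Proof.
have [lf _ _] := hf; move=> a c d; rewrite /cone_dif /= !linearP lf.
by congr pair; rewrite /= scalerDr addrACA.
Qed.

HB.instance Definition _ := GRing.isLinear.Build B C C *:%R cone_dif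
  cone_dif_linear.

Lemma cone_degM m n c :
  cone_deg m (cone_deg n c) = if m == n then cone_deg n c else 0.
Proof. by rewrite /cone_deg /= !pdegM (inj_eq (addIr _)); case: eqP. Qed.

Lemma pdeg_sum_sub (Z : perf) (s t : seq int) (z : Z) :
    uniq s -> uniq t -> {subset s <= t} ->
    (forall z : Z, z = \sum_(n <- s) pdeg Z n z) ->
  z = \sum_(n <- t) pdeg Z n z.
Proof.
move=> us ut sst es; rewrite (bigID [in s]) /= addrC big1 ?add0r.
  rewrite -big_filter {1}(es z); apply: perm_big; apply: uniq_perm => //.
    exact: filter_uniq.
  by move=> n; rewrite mem_filter; case: (boolP (n \in s)) => // /sst ->.
move=> n nns; rewrite (es z) linear_sum big_seq big1 // => m ms.
by rewrite pdegM; case: eqP => // nm; rewrite nm ms in nns.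
Qed.

Lemma cone_deg_sum :
  exists2 s : seq int, uniq s & forall c, c = \sum_(n <- s) cone_deg n c.
Proof.
have [s us es] := pdeg_sum X; have [t ut et] := pdeg_sum Y.
pose u : seq int := undup ([seq n - 1 | n <- s] ++ t).
exists u; first exact: undup_uniq.
move=> [x y]; rewrite /cone_deg /=.
have -> : \sum_(n <- u) (pdeg X (n + 1) x, pdeg Y n y) =
          (\sum_(n <- u) pdeg X (n + 1) x, \sum_(n <- u) pdeg Y n y) :> C.
  by elim: u => [|n v IHv]; rewrite ?big_nil // !big_cons IHv.
congr pair.
  rewrite -(big_map (fun n : int => n + 1) xpredT (fun n => pdeg X n x)).
  apply: (@pdeg_sum_sub X s _ x) => //.
    by rewrite map_inj_uniq ?undup_uniq //; apply: addIr.
  move=> n ns; apply/mapP; exists (n - 1); rewrite ?subrK //.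
  by rewrite mem_undup mem_cat (map_f (fun m : int => m - 1) ns).
apply: (@pdeg_sum_sub Y t _ y) => //; first exact: undup_uniq.
by move=> n nt; rewrite mem_undup mem_cat nt orbT.
Qed.

Lemma cone_dif_deg n c : cone_dif (cone_deg n c) = cone_deg (n + 1) (cone_dif c).
Proof.
have [_ df _] := hf; rewrite /cone_dif /cone_deg /= pdif_deg df pdif_deg.
by rewrite linearN linearD.
Qed.

Lemma cone_dif_dif c : cone_dif (cone_dif c) = 0.
Proof.
have [lf _ cf] := hf; rewrite /cone_dif /=; congr pair.
  by rewrite linearN pdif_pdif !oppr0.
have fN x : f (- x) = - f x.
  have f0 : f 0 = 0.
    by have := lf (- 1) 0 0; rewrite addr0 scaler0 scaleN1r addNr.
  by have := lf (- 1) x 0; rewrite f0 !addr0 !scaleN1r.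
by rewrite fN cf linearD pdif_pdif addr0 addNr.
Qed.

Definition cone : perf :=
  Perf cone_fgproj cone_degM cone_deg_sum cone_dif_deg
    (cone_dif_dif : forall x, cone_dif (cone_dif x) = 0).

End Cone.

Definition homotopy_equiv (X Y : perf) : Prop :=
  exists (f : X -> Y) (g : Y -> X),
    [/\ chain_map f, chain_map g,
        @null_homotopic X X (fun x => g (f x) - x) &
        @null_homotopic Y Y (fun y => f (g y) - y)].

(* There is a distinguished triangle X -> Y -> Z -> X[1] in D^b(B). *)
Definition triangle (X Y Z : perf) : Prop :=
  exists (f : X -> Y) (hf : chain_map f), homotopy_equiv (cone hf) Z.

(* dim_k Hom_{D^b(B)}(X, Y): as X is a bounded complex of projectives, this Hom
   space consists of the chain maps X -> Y up to homotopy. *)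
Definition dhom_dim (X Y : perf) : nat :=
  kdim (@chain_map X Y) (@null_homotopic X Y).

(* A finitely supported sum, since Hom(X, Y[n]) = 0 for all but finitely many n. *)
Definition euler_char (X Y : perf) : int :=
  \sum_(n \in [set: int]%classic) (- 1) ^+ `|n|%N * (dhom_dim X (shift Y n))%:Z.

(* Elements of the Grothendieck group K_0(per B) are represented by formal sums
   \sum_i n_i [X_i]. *)
Definition K0 := seq (int * perf).

(* \sum_i n_i [X_i] = 0 in K_0(per B), by the universal property of K_0: every
   function on perfect complexes that is additive on triangles kills it. *)
Definition K0_null (x : K0) : Prop :=
  forall (A : zmodType) (phi : perf -> A),
    (forall X Y Z, triangle X Y Z -> phi Y = phi X + phi Z) ->
    \sum_(a <- x) phi a.2 *~ a.1 = 0.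

Definition euler_pairing (x y : K0) : int :=
  \sum_(a <- x) \sum_(b <- y) a.1 * b.1 * euler_char a.2 b.2.

Definition euler_form (x : K0) : int := euler_pairing x x.

Definition euler_nonneg : Prop := forall x : K0, 0 <= euler_form x.

Definition euler_pos : Prop := forall x : K0, ~ K0_null x -> 0 < euler_form x.

End Perfect.

Record bqpres (k : fieldType) := BQPres {
  bq_quiver : quiver;
  bq_rel : pathalg k bq_quiver -> Prop
}.

Section BoundQuiverInvariants.
Variables (k : fieldType) (P : bqpres k).
Local Notation Q := (bq_quiver P).
Local Notation B := (bqalg (@bq_rel k P)).
Local Notation iota := (@bq_scal k Q (@bq_rel k P)).

Definition bq_proj (i : qvert Q) : lmodType B :=
  lproj (bq_idem (@bq_rel k P) i).

Definition cartan : 'M[int]_(#|qvert Q|) :=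
  \matrix_(i, j) (hom_dim iota (bq_proj (enum_val i)) (bq_proj (enum_val j)))%:Z.

Definition cartan_nonsingular : Prop := \det cartan != 0.

Definition euler_form_nonneg : Prop := euler_nonneg iota.
Definition euler_form_pos : Prop := euler_pos iota.

End BoundQuiverInvariants.

Record brauer_graph := BrauerGraph {
  vert : finType;
  half : finType;
  hv : half -> vert;
  hinv : half -> half;
  hinvK : involutive hinv;
  hinv_neq : forall h, hinv h != h;
  hperm : {perm half};
  hperm_porbit : forall h h', (h' \in porbit hperm h) = (hv h' == hv h);
  mult : vert -> nat
}.

Section Graph.
Variable G : brauer_graph.

Definition trivial_mult : Prop := forall v : vert G, mult v = 1%N.

Definition edge_of (h : half G) : {set half G} := [set h; hinv h]%SET.

Definition edges : {set {set half G}} := [set edge_of h | h in [set: half G]]%SET.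

Definition edge := {e : {set half G} | e \in edges}.

Lemma edge_of_in h : edge_of h \in edges.
Proof. by apply: imset_f; rewrite finset.in_setT. Qed.

Definition hedge (h : half G) : edge := exist _ (edge_of h) (edge_of_in h).

Definition valency (v : vert G) : nat := #|[set h | hv h == v]%SET|.

Definition adj : rel (vert G) :=
  [rel v w | [exists h : half G, (hv h == v) && (hv (hinv h) == w)]].

Definition connected_graph : Prop :=
  (0 < #|vert G|)%N /\ forall v w, connect adj v w.

(* A half-edge h stands for its edge, oriented away from hv h. *)
Definition is_cycle (c : seq (half G)) : bool :=
  [&& c != [::], path.cycle (fun h h' => hv (hinv h) == hv h') c,
      uniq [seq hv h | h <- c] & uniq [seq hedge h | h <- c]].

Definition is_tree : Prop := connected_graph /\ forall c, ~~ is_cycle c.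

Definition is_1cycle : Prop :=
  connected_graph /\ #|edges|%:Z - #|vert G|%:Z + 1 = 1.

Definition is_unique_cycle (c : seq (half G)) : Prop :=
  is_cycle c /\
  forall c', is_cycle c' -> [seq hedge h | h <- c'] =i [seq hedge h | h <- c].

Definition unique_cycle_odd : Prop :=
  exists c, is_unique_cycle c /\ odd (size c).

Definition arrow := {h : half G | (2 <= valency (hv h))%N}.

Definition brauer_quiver : quiver :=
  @Quiver edge arrow (fun a => hedge (val a)) (fun a => hedge (hperm G (val a))).

Variable k : fieldType.

(* The arrows a_h, a_{p(h)}, a_{p^2(h)}, ..., once around the vertex of h. *)
Definition around (h : half G) : seq arrow :=
  pmap insub (traject (hperm G) h (valency (hv h))).

Definition bpath (h : half G) (s : seq arrow) : pathalg k brauer_quiver :=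
  @ppath k brauer_quiver (hedge h) s.

Inductive brauer_rel : pathalg k brauer_quiver -> Prop :=
| BrauerComm h of (2 <= valency (hv h))%N & (2 <= valency (hv (hinv h)))%N :
    brauer_rel (bpath h (around h) - bpath (hinv h) (around (hinv h)))
| BrauerOver (a : arrow) :
    brauer_rel (bpath (val a) (rcons (around (val a)) a))
| BrauerZero (a b : arrow)
    of qtgt (a : qarr brauer_quiver) = qsrc (b : qarr brauer_quiver)
    & val b <> hperm G (val a) :
    brauer_rel (bpath (val a) [:: a; b]).

Definition point_pres : bqpres k :=
  @BQPres k (@Quiver unit void (fun _ => tt) (fun _ => tt)) (fun _ => False).

Definition loop_quiver : quiver := @Quiver unit unit id id.
Definition loop_pres : bqpres k :=
  @BQPres k loop_quiver (fun x => x = @ppath k loop_quiver tt [:: tt; tt]).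

Definition is_vertex : bool := (#|vert G| == 1)%N && (#|half G| == 0)%N.

Definition is_nonloop_edge : bool :=
  [&& #|vert G| == 2, #|half G| == 2 &
      [forall h : half G, hv h != hv (hinv h)]]%N.

(* The presentation of B(Gamma) for trivial multiplicities; mult plays no role. *)
Definition brauer_alg : bqpres k :=
  if is_vertex then point_pres
  else if is_nonloop_edge then loop_pres
  else @BQPres k brauer_quiver brauer_rel.

End Graph.

(* Main.v *)
Require Import Defs.
From HB Require Import structures.
From mathcomp Require Import all_boot all_order perm all_algebra.
From mathcomp Require Import finmap boolp classical_sets functions cardinality fsbigop.
From mathcomp.multinomials Require Import monalg.

(** Let N be the unsigned incidence matrix of the graph: its entry at a vertex v
    and an edge E is the number of half-edges of E at v (so 0, 1 or 2).  The
    paths from E to F which survive in the Brauer graph algebra, up to the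
    identification of C_h with C_(iota h), correspond to the pairs of half-edges
    (h, h') of E and F at a common vertex; hence the Cartan matrix is the Gram
    matrix N^T N ([brauer_hom_dim], [gram_form]).  The form x -> |N x|^2 is
    non-negative, it is positive if and only if N is injective, and N is
    injective if and only if its Gram matrix is non-singular.

    Linear independence of the surviving paths is detected by explicit
    functionals on the path algebra which vanish on the ideal: the coefficient
    of a single path around a vertex which is shorter than the full cycle, or
    the sum of the coefficients of C_h and C_(iota h) ([lcoef_kills],
    [nform_mem]).

    To pass from the Cartan matrix to the Euler form on K_0, three facts about a
    finite dimensional algebra B with one-dimensional simple modules are used.
    First, the alternating sum of the dimensions of Hom(X, Y[n]) is the
    alternating sum of the dimensions of the graded pieces of the complex of
    linear maps, so it is additive on cones in both arguments
    ([euler_char_homchi], [homchi_coner], [homchi_conel]).  Secondly, every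
    perfect complex is obtained from indecomposable projective stalks by
    iterated cones: in the lowest nonzero degree a projective B e_i splits off,
    and the complex is the cone of a map from this stalk to the rest
    ([peel_iso], [perf_class]).  Hence the Euler form is the quadratic form of
    the Cartan matrix, evaluated at integral coordinates, and a class with zero
    coordinates vanishes in K_0.  Thirdly, for each character B -> k the
    alternating sum of the Hattori-Stallings traces of the terms of a complex is
    a function with values in k which is additive on triangles
    ([supertrace_triangle]); so if a class with coordinates v vanishes, then v
    is zero in k.  For v in the kernel of the Cartan matrix this suffices, as in
    characteristic p one may divide v by p ([kervec_descent]).

    It remains to see when N is injective, for a connected graph.  A nonzero
    vector of its kernel has a support without leaves, so the support contains a
    cycle ([leafless_cycle]); hence N is injective for a tree.  An even cycle
    gives an alternating kernel vector ([cycle_flow]).  The transpose of N has a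
    nonzero kernel only if the vertices can be given signs which alternate along
    the edges, which an odd cycle prevents ([odd_cycle_no_flow]).  The oriented
    incidence matrix has rank |V| - 1, and its kernel, the space of flows,
    contains a vector supported on each cycle: so there are no cycles if
    |E| = |V| - 1, and exactly one if |E| = |V| ([unicyclic_flow]).

    The algebras of a single vertex and of a single edge which is not a loop have
    presentations of their own; they are local, and both graphs are trees
    ([point_euler], [loop_euler]). *)

Set Implicit Arguments.
Unset Strict Implicit.
Unset Printing Implicit Defensive.
Import Order.TTheory GRing.Theory Num.Theory.
Local Open Scope ring_scope.

(** * Dimensions of subquotients of vector spaces *)

Section Dimension.
Variable (k : fieldType).

(** Linear subspaces are predicates, as the spaces of linear maps between two
    modules are not given by finite dimensional types. *)
Definition subspace (V : lmodType k) (S : V -> Prop) : Prop :=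
  S 0 /\ forall a x y, S x -> S y -> S (a *: x + y).

(** The quotient S / T has dimension d: some family of d vectors of S is a basis
    modulo T.  It is not required that T be contained in S. *)
Definition qdim (V : lmodType k) (S T : V -> Prop) (d : nat) : Prop :=
  exists b : 'I_d -> V, (forall i, S (b i)) /\
    forall f, S f -> exists! c : 'rV[k]_d, T (f - \sum_(i < d) c 0 i *: b i).

(** S is contained in the span of a finite family, which need not lie in S. *)
Definition finspan (V : lmodType k) (S : V -> Prop) : Prop :=
  exists n (b : 'I_n -> V),
    forall f, S f -> exists c : 'rV[k]_n, f = \sum_(i < n) c 0 i *: b i.

Section OneSpace.
Variable V : lmodType k.
Implicit Types S T U : V -> Prop.

Lemma subspaceD S x y : subspace S -> S x -> S y -> S (x + y).
Proof. by case=> _ h Sx Sy; rewrite -[x]scale1r; apply: h. Qed.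

Lemma subspaceZ S a x : subspace S -> S x -> S (a *: x).
Proof. by case=> S0 h Sx; rewrite -[a *: x]addr0; apply: h. Qed.

Lemma subspaceN S x : subspace S -> S x -> S (- x).
Proof. by move=> hS; rewrite -scaleN1r; apply: subspaceZ. Qed.

Lemma subspaceB S x y : subspace S -> S x -> S y -> S (x - y).
Proof. by move=> hS Sx Sy; apply: subspaceD => //; apply: subspaceN. Qed.

Lemma subspace_sum S n (c : 'I_n -> k) (b : 'I_n -> V) :
  subspace S -> (forall i, S (b i)) -> S (\sum_i c i *: b i).
Proof.
move=> hS Sb; elim/big_ind: _; first by case: hS.
  by move=> *; apply: subspaceD.
by move=> i _; apply: subspaceZ.
Qed.

Lemma subspace0 : subspace (fun x : V => x = 0).
Proof. by split=> // a x y -> ->; rewrite scaler0 addr0. Qed.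

Lemma finspan_sub S T : (forall x, T x -> S x) -> finspan S -> finspan T.
Proof. by move=> TS [n [b hb]]; exists n, b => f /TS; apply: hb. Qed.

Lemma finspan_fin (I : finType) (b : I -> V) S :
  (forall f, S f -> exists c : I -> k, f = \sum_i c i *: b i) -> finspan S.
Proof.
move=> h; exists #|I|, (fun i => b (enum_val i)) => f /h [c ->].
exists (\row_i c (enum_val i)); under [RHS]eq_bigr do rewrite mxE.
rewrite [RHS](reindex_onto enum_rank enum_val) /= => [|i _]; last by rewrite enum_valK.
by apply: eq_big => [i|i _]; rewrite enum_rankK ?eqxx.
Qed.

(** A family indexed by any finite type which is free and generating modulo T
    computes the dimension. *)
Lemma qdim_fin (I : finType) (b : I -> V) S T :
    subspace S -> (forall i, S (b i)) ->
    (forall c : I -> k, T (\sum_i c i *: b i) -> forall i, c i = 0) ->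
    (forall f, S f -> exists c : I -> k, T (f - \sum_i c i *: b i)) ->
    subspace T -> qdim S T #|I|.
Proof.
move=> hS Sb free spn hT; exists (fun i => b (enum_val i)); split=> // f Sf.
have sumE (c : I -> k) : \sum_i c i *: b i =
    \sum_(i < #|I|) c (enum_val i) *: b (enum_val i).
  by rewrite (reindex_onto enum_val enum_rank) /= => [|i _];
     rewrite ?enum_rankK //; apply: eq_bigl => i; rewrite enum_valK eqxx.
have [c hc] := spn f Sf; exists (\row_i c (enum_val i)); split.
  by under eq_bigr do rewrite mxE; rewrite -(sumE c).
move=> c' hc'; apply/rowP => i; rewrite mxE -[i]enum_valK; set j := enum_val i.
rewrite enum_rankK.
have /free/(_ j) : T (\sum_i (c i - c' 0 (enum_rank i)) *: b i).
  rewrite sumE; under eq_bigr do rewrite scalerBl enum_valK; rewrite sumrB -sumE.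
  have := subspaceB hT hc' hc; congr T.
  by rewrite opprB [LHS]addrC addrA subrK.
by move/eqP; rewrite subr_eq0 => /eqP.
Qed.

Lemma dependent_rows (m d : nat) (A : 'I_m -> 'rV[k]_d) : (d < m)%N ->
  exists2 u : 'rV[k]_m, u != 0 & forall l, \sum_j u 0 j * A j 0 l = 0.
Proof.
move=> ltdm; pose M := \matrix_(i, j) A i 0 j.
have /rowV0Pn[u /sub_kermxP uM u0] : kermx M != 0.
  by rewrite -mxrank_eq0 mxrank_ker subn_eq0 -ltnNge (leq_ltn_trans (rank_leq_col _)).
exists u => // l; transitivity ((u *m M) 0 l); last by rewrite uM mxE.
by rewrite [RHS]mxE; apply: eq_bigr => j _; rewrite [M _ _]mxE.
Qed.

(** A family of vectors of S which is free modulo T has at most dim (S / T)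
    members. *)
Lemma qdim_le S T d (hT : subspace T) : qdim S T d ->
  forall m (v : 'I_m -> V), (forall i, S (v i)) ->
    (forall c : 'rV[k]_m, T (\sum_i c 0 i *: v i) -> c = 0) -> (m <= d)%N.
Proof.
case=> b [Sb hb] m v Sv indep.
have /all_sig[A hA] i := cid (hb _ (Sv i)).
rewrite leqNgt; apply/negP => /(@dependent_rows _ _ A)[u /eqP u0 uA].
apply/u0/indep.
have -> : \sum_j u 0 j *: v j =
    \sum_j u 0 j *: (v j - \sum_(l < d) A j 0 l *: b l).
  under [RHS]eq_bigr do rewrite scalerBr scaler_sumr.
  rewrite sumrB exchange_big /= [X in _ - X]big1 ?subr0 // => l _.
  under eq_bigr do rewrite scalerA; rewrite -scaler_suml.
  by rewrite uA scale0r.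
by apply: subspace_sum => // j; case: (hA j).
Qed.

Lemma qdim_indep S T d (b : 'I_d -> V) : subspace S -> subspace T ->
    (forall i, S (b i)) ->
    (forall f, S f -> exists! c : 'rV[k]_d, T (f - \sum_(i < d) c 0 i *: b i)) ->
  forall c : 'rV[k]_d, T (\sum_i c 0 i *: b i) -> c = 0.
Proof.
move=> [S0 _] hT Sb hb c Tc.
have [c0 [_ u]] := hb 0 S0.
have h0 : c0 = 0.
  apply: u; rewrite sub0r -sumrN big1 => [|i _]; first exact: (proj1 hT).
  by rewrite mxE scale0r oppr0.
apply: oppr_inj; rewrite oppr0 -h0; apply/esym/u.
by rewrite sub0r -sumrN; under eq_bigr do rewrite mxE scaleNr opprK.
Qed.

Lemma qdim_uniq S T d d' : subspace S -> subspace T ->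
  qdim S T d -> qdim S T d' -> d = d'.
Proof.
move=> hS hT hd hd'; apply/eqP; rewrite eqn_leq; apply/andP; split.
  by have [b [Sb hb]] := hd; apply: (qdim_le hT hd' Sb (qdim_indep hS hT Sb hb)).
by have [b [Sb hb]] := hd'; apply: (qdim_le hT hd Sb (qdim_indep hS hT Sb hb)).
Qed.

(** Additivity of dimensions along T <= U <= S. *)
Lemma qdimD S U T a b : subspace S -> subspace U -> subspace T ->
    (forall x, U x -> S x) -> (forall x, T x -> U x) ->
  qdim S U a -> qdim U T b -> qdim S T (a + b).
Proof.
move=> hS hU hT US TU [v [Sv hv]] [w [Uw hw]].
pose vw (i : 'I_(a + b)) := match fintype.split i with inl i => v i | inr j => w j end.
have sumE (c : 'rV[k]_(a + b)) : \sum_i c 0 i *: vw i =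
    \sum_i lsubmx c 0 i *: v i + \sum_i rsubmx c 0 i *: w i.
  rewrite big_split_ord /=; congr (_ + _); apply: eq_bigr => i _; rewrite mxE /vw.
    by rewrite (unsplitK (inl i)).
  by rewrite (unsplitK (inr i)).
exists vw; split=> [i|f Sf].
  by rewrite /vw; case: (fintype.split i) => j //; apply: US.
have [c1 [hc1 u1]] := hv f Sf; have [c2 [hc2 u2]] := hw _ hc1.
exists (row_mx c1 c2); split=> [|c].
  by rewrite sumE row_mxKl row_mxKr opprD addrA.
rewrite sumE opprD addrA => Tc.
have e1 : c1 = lsubmx c.
  apply: u1; rewrite -[X in U X](subrK (\sum_i rsubmx c 0 i *: w i)).
  by apply: subspaceD => //; [apply: TU | apply: subspace_sum].
have e2 : c2 = rsubmx c by apply: u2; rewrite e1.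
by rewrite e1 e2 hsubmxK.
Qed.

(** A maximal free family modulo T is generating; its length is bounded by the
    length of a family which spans S. *)
Lemma qdim_exists S T : finspan S -> subspace S -> subspace T ->
  (forall x, T x -> S x) -> exists d, qdim S T d.
Proof.
move=> [n [g hg]] hS hT TS.
pose indep m := `[< exists v : 'I_m -> V, (forall i, S (v i)) /\
  forall c : 'rV[k]_m, T (\sum_i c 0 i *: v i) -> c = 0 >].
have bound m : indep m -> (m <= n)%N.
  move=> /asboolP[v [Sv iv]].
  have /all_sig[A hA] i := cid (hg _ (Sv i)).
  rewrite leqNgt; apply/negP => /(@dependent_rows _ _ A)[u /eqP u0 uA].
  apply/u0/iv.
  under eq_bigr do rewrite hA scaler_sumr.
  rewrite exchange_big big1 => [|l _]; first by case: hT.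
  under eq_bigr do rewrite scalerA; rewrite -scaler_suml.
  by rewrite uA scale0r.
have ex0 : exists m, indep m.
  exists 0%N; apply/asboolP; exists (fun _ => 0); split=> [[]//|c _].
  by apply/rowP => -[].
have [d /asboolP[v [Sv iv]] maxd] := ex_maxnP ex0 bound.
exists d, v; split=> // f Sf.
have [[c Tc]|ncomb] := pselect (exists c : 'rV[k]_d, T (f - \sum_i c 0 i *: v i)).
  exists c; split=> // c' Tc'; apply/eqP; rewrite -subr_eq0.
  apply/eqP; apply: iv; under eq_bigr do rewrite !mxE scalerBl.
  rewrite sumrB; have := subspaceB hT Tc' Tc; congr T.
  by rewrite opprB [LHS]addrC addrA subrK.
have /maxd : indep d.+1; last by rewrite ltnn.
apply/asboolP; exists (fun i => oapp v f (unlift ord0 i)).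
split=> [i|c]; first by case: (unlift ord0 i).
rewrite big_ord_recl unlift_none /=; under eq_bigr do rewrite liftK.
move=> /= Tc; have c0 : c 0 ord0 = 0.
  apply/eqP; apply: contra_notT ncomb => c0.
  exists (- (c 0 ord0)^-1 *: \row_j c 0 (lift ord0 j)).
  have := subspaceZ (c 0 ord0)^-1 hT Tc; congr T.
  rewrite scalerDr scalerA mulVf // scale1r scaler_sumr -sumrN; congr (_ + _).
  by apply: eq_bigr => i _; rewrite !mxE scalerA mulNr scaleNr opprK.
move: Tc; rewrite c0 scale0r add0r => Tc.
have /rowP r0 : \row_j c 0 (lift ord0 j) = 0.
  by apply: iv; under eq_bigr do rewrite mxE.
apply/rowP => i; rewrite [RHS]mxE; case: (unliftP ord0 i) => [j|] -> //.
by have := r0 j; rewrite !mxE.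
Qed.

Lemma qdim0 S T : subspace T -> (forall x, S x -> T x) -> qdim S T 0.
Proof.
move=> hT ST; exists (fun _ => 0); split=> [[]//|f /ST Tf].
exists 0; split=> [|c _]; first by rewrite big_ord0 subr0.
by apply/rowP => -[].
Qed.

Lemma qdim_eq0 S T x : qdim S T 0 -> S x -> T x.
Proof. by move=> [b [_ h]] /h [c [+ _]]; rewrite big_ord0 subr0. Qed.

End OneSpace.

Lemma linear_pack (R : pzRingType) (V V' : lmodType R) (D : V -> V') : linear D ->
  exists L : {linear V -> V'}, (L : V -> V') = D.
Proof.
move=> lD; pose L : {linear V -> V'} := HB.pack D (GRing.isLinear.Build _ _ _ _ D lD).
by exists L.
Qed.

(** A linear map which induces a bijection S / T -> S' / T' preserves dimensions. *)
Lemma qdim_transfer (V V' : lmodType k) (D : V -> V') (S T : V -> Prop)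
    (S' T' : V' -> Prop) d :
    linear D -> (forall x, S x -> S' (D x)) ->
    subspace S -> subspace T' ->
    (forall x, S x -> T x <-> T' (D x)) ->
    (forall y, S' y -> exists2 x, S x & T' (y - D x)) ->
  qdim S T d -> qdim S' T' d.
Proof.
move=> lD SS' hS hT' TT' sur [b [Sb hb]].
have [L eL] := linear_pack lD; subst D.
exists (fun i => L (b i)); split=> [i|y S'y]; first exact: SS'.
have [x Sx hx] := sur y S'y.
have key (c : 'rV[k]_d) : T (x - \sum_i c 0 i *: b i) <->
    T' (y - \sum_i c 0 i *: L (b i)).
  rewrite TT'; last by apply: subspaceB => //; apply: subspace_sum.
  rewrite linearB linear_sum; under eq_bigr do rewrite linearZ.
  split=> h; first by have := subspaceD hT' hx h; congr T'; rewrite addrA subrK.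
  by have := subspaceB hT' h hx; congr T'; rewrite opprB [LHS]addrC addrA subrK.
have [c [/key hc u]] := hb x Sx; exists c; split=> // c' /key; exact: u.
Qed.

(** Additivity of dimensions on a short exact sequence 0 -> S1 -> S -> S2 -> 0. *)
Lemma qdim_ses (V1 V V2 : lmodType k) (al : V1 -> V) (be : V -> V2)
    (S1 : V1 -> Prop) (S : V -> Prop) (S2 : V2 -> Prop) a b c :
    linear al -> linear be -> subspace S1 -> subspace S -> subspace S2 ->
    finspan S ->
    (forall x, S1 x -> S (al x)) -> (forall x, S1 x -> al x = 0 -> x = 0) ->
    (forall x, S x -> S2 (be x)) -> (forall z, S2 z -> exists2 x, S x & z = be x) ->
    (forall x, S1 x -> be (al x) = 0) ->
    (forall x, S x -> be x = 0 -> exists2 y, S1 y & x = al y) ->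
    qdim S1 (fun x => x = 0) a -> qdim S (fun x => x = 0) b ->
    qdim S2 (fun x => x = 0) c ->
  b = (c + a)%N.
Proof.
move=> /linear_pack[al' e] /linear_pack[be' e'] h1 h h2; subst al be.
move=> fS alS alI beS beS2 ba0 ker q1 q q2.
pose U x := S x /\ be' x = 0.
have hU : subspace U.
  split=> [|c' x y [Sx x0] [Sy y0]]; first by rewrite /U linear0; case: h.
  by split; [case: h => _; apply|rewrite linearP x0 y0 scaler0 addr0].
have US x : U x -> S x by case.
have ZU x : x = 0 -> U x by move=> ->; case: hU.
have [d hd] := qdim_exists fS h hU US.
have h0 := subspace0.
have dc : d = c.
  apply: (qdim_uniq h2 (h0 _) _ q2).
  apply: (qdim_transfer (D := be') _ beS h (h0 _) _ _ hd); first exact: linearP.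
    by move=> x Sx; split=> [[]|].
  by move=> z /beS2[x Sx ->]; exists x => //; rewrite subrr.
apply: (qdim_uniq h (h0 _) q); rewrite -dc; apply: (qdimD h hU (h0 _) US ZU hd).
apply: (qdim_transfer (D := al') _ _ h1 (h0 _) _ _ q1); first exact: linearP.
- by move=> x S1x; split; [apply: alS|apply: ba0].
- by move=> x S1x; split=> [->|/(alI _ S1x) //]; rewrite linear0.
- by move=> x [Sx /(ker _ Sx)[y S1y ->]]; exists y => //; rewrite subrr.
Qed.

End Dimension.

(** * Restriction of scalars and spaces of linear maps *)

Section Restriction.
Variables (k : fieldType) (B : pzRingType) (iota : {rmorphism k -> B}).

(** A B-module seen as a vector space over k through iota.  The definition
    mentions iota so that it can be recovered from the type. *)
Definition kres (N : lmodType B) : Type := let _ := iota in N.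

Section One.
Variable N : lmodType B.
HB.instance Definition _ := GRing.Zmodule.on (kres N).

Definition kres_scale (c : k) (x : kres N) : kres N := iota c *: (x : N).

Lemma kres_scaleA a b v : kres_scale a (kres_scale b v) = kres_scale (a * b) v.
Proof. by rewrite /kres_scale scalerA rmorphM. Qed.
Lemma kres_scale1 : left_id 1 kres_scale.
Proof. by move=> v; rewrite /kres_scale rmorph1 scale1r. Qed.
Lemma kres_scaleDr : right_distributive kres_scale +%R.
Proof. by move=> a x y; rewrite /kres_scale scalerDr. Qed.
Lemma kres_scaleDl v : {morph kres_scale^~ v : a b / a + b}.
Proof. by move=> a b; rewrite /kres_scale rmorphD scalerDl. Qed.

HB.instance Definition _ := GRing.Zmodule_isLmodule.Build k (kres N)
  kres_scaleA kres_scale1 kres_scaleDr kres_scaleDl.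
End One.

(** Dimensions of spaces of maps are dimensions of subquotients of the vector
    space of all functions from M to N. *)
Lemma has_kdimP (M N : lmodType B) (S T : (M -> N) -> Prop) d :
  has_kdim iota S T d = @qdim k (M -> kres N) S T d.
Proof.
rewrite /has_kdim /qdim; apply/eq_exists => b; congr (_ /\ _).
apply/eq_forall => f; congr (_ -> _); apply/eq_exists => c; congr (unique _ _).
apply/funext => c'; congr (T _).
by apply/funext => x; rewrite fct_sumE.
Qed.
End Restriction.

Section HomSpaces.
Variables (k : fieldType) (B : pzRingType) (iota : {rmorphism k -> B}).
Hypothesis iotaC : forall c b, iota c * b = b * iota c.

(** B is finitely generated as a k-module. *)
Definition finite_over : Prop := exists n (beta : 'I_n -> B),
  forall b, exists c : 'I_n -> k, b = \sum_i iota (c i) * beta i.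

Hypothesis Bfin : finite_over.

Lemma kdim_uniq (M N : lmodType B) (S T : (M -> N) -> Prop) d :
    @subspace k (M -> kres iota N) S -> @subspace k (M -> kres iota N) T ->
  @qdim k (M -> kres iota N) S T d -> kdim iota S T = d.
Proof.
move=> hS hT hd; apply: xget_unique => [|y]; rewrite /= has_kdimP //.
by move=> hy; apply: qdim_uniq hT hy hd.
Qed.

Lemma linear_subspace (M N : lmodType B) :
  @subspace k (M -> kres iota N) (fun f : M -> N => linear f).
Proof.
split=> [a x y|c f g lf lg a x y].
  by have -> z : (0 : M -> kres iota N) z = 0 :> N by []; rewrite scaler0 addr0.
have -> z : (c *: f + g) z = (iota c *: (f z : N) + g z) :> N by [].
by rewrite lf lg !scalerDr !scalerA iotaC addrACA.
Qed.

(** A linear map between summands of free modules is determined by its matrix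
    in B, and B is finite dimensional. *)
Lemma hom_finspan (M N : lmodType B) : fgproj M -> fgproj N ->
  @finspan k (M -> kres iota N) (fun f : M -> N => linear f).
Proof.
move=> [m [s [r [/linear_pack[S eS] /linear_pack[R eR] rs]]]].
move=> [n [t [q [/linear_pack[U eU] /linear_pack[Q eQ] qt]]]]; subst.
have [p [beta hbeta]] := Bfin.
pose b (i : 'I_m * 'I_n * 'I_p) : M -> kres iota N := fun x =>
  (S x 0 i.1.1 * beta i.2) *: Q (delta_mx 0 i.1.2).
apply: (@finspan_fin _ _ _ b) => f /linear_pack[F eF]; subst f.
pose A i j := U (F (R (delta_mx 0 i))) 0 j.
have /all_sig[c hc] (ij : 'I_m * 'I_n) := cid (hbeta (A ij.1 ij.2)).
exists (fun i => c i.1 i.2); apply/funext => x; rewrite fct_sumE.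
rewrite -(pair_bigA _ (fun ij l => (c ij l *: b (ij, l) : M -> kres iota N) x)) /=.
rewrite -[LHS]qt -{1}[x]rs [in LHS](row_sum_delta (S x)) !linear_sum /=.
rewrite [RHS](eq_bigr (fun ij : 'I_m * 'I_n => \sum_l
  (c (ij.1, ij.2) l *: b ((ij.1, ij.2), l) : M -> kres iota N) x)); last by case.
rewrite -(pair_bigA _ (fun i j => \sum_l (c (i, j) l *: b ((i, j), l) : M -> kres iota N) x)) /=.
apply: eq_bigr => i _; rewrite !linearZ /= [in LHS](row_sum_delta (U _)) linear_sum /=.
rewrite scaler_sumr; apply: eq_bigr => j _.
rewrite linearZ /= scalerA [X in _ * X](hc (i, j)) mulr_sumr scaler_suml.
apply: eq_bigr => l _; rewrite /= fctE /GRing.scale /= /kres_scale /b /= scalerA.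
by rewrite !mulrA iotaC.
Qed.

End HomSpaces.

(** * Graded maps between perfect complexes and the Euler characteristic *)

Section GradedHom.
Variables (k : fieldType) (B : pzRingType) (iota : {rmorphism k -> B}).
Hypothesis iotaC : forall c b, iota c * b = b * iota c.
Hypothesis Bfin : finite_over iota.

Lemma signzB1 (R : pzRingType) (n : int) :
  (- 1) ^+ `|(n - 1)%R|%N = - (- 1) ^+ `|n|%N :> R.
Proof.
case: n => [[|n]|n]; first by rewrite expr1 expr0.
  by rewrite -addn1 PoszD addrK !absz_nat addn1 exprS mulN1r opprK.
by rewrite !NegzE -opprD -PoszD !abszN !absz_nat addn1 [in LHS]exprS mulN1r.
Qed.

Lemma signzD1 (R : pzRingType) (n : int) :
  (- 1) ^+ `|(n + 1)%R|%N = - (- 1) ^+ `|n|%N :> R.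
Proof. by rewrite -{2}[n](addrK 1) signzB1 opprK. Qed.

Section TwoComplexes.
Variables X Y : perf B.
Local Notation V := (X -> kres iota Y).

(** A linear map of degree n, which need not commute with the differentials. *)
Definition graded_map (n : int) (f : X -> Y) : Prop :=
  linear f /\ forall m x, f (pdeg X m x) = pdeg Y (m + n) (f x).

Definition null_map (f : X -> Y) : Prop := forall x, f x = 0.

Lemma null_mapE : null_map = (fun f : V => f = 0).
Proof.
by apply/funext => f; apply/propext; split=> [h|-> //]; apply/funext.
Qed.

Lemma graded_subspace n : @subspace k V (graded_map n).
Proof.
have [l0 lD] := linear_subspace iotaC X Y.
split; first by split=> [|m x] //; rewrite [RHS]linear0.
move=> c f g [lf hf] [lg hg]; split; first exact: lD.
move=> m x; change (iota c *: (f (pdeg X m x) : Y) + g (pdeg X m x) =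
  pdeg Y (m + n) (iota c *: (f x : Y) + g x)).
by rewrite hf hg linearP.
Qed.

Lemma graded_finspan n : @finspan k V (graded_map n).
Proof.
apply: finspan_sub (hom_finspan iotaC Bfin (pobj_fgproj X) (pobj_fgproj Y)).
by move=> f [].
Qed.

(** The dimension of the space of maps of degree n. *)
Definition hdim (n : int) : nat := kdim iota (graded_map n) null_map.

Lemma null_subspace : @subspace k V null_map.
Proof. by rewrite null_mapE; apply: subspace0. Qed.

Lemma null_graded n f : null_map f -> graded_map n f.
Proof. by rewrite null_mapE => ->; case: (graded_subspace n). Qed.

Lemma hdimP n : @qdim k V (graded_map n) null_map (hdim n).
Proof.
have [d hd] := qdim_exists (graded_finspan n) (graded_subspace n) null_subspace
  (@null_graded n).
by rewrite /hdim (kdim_uniq (graded_subspace n) null_subspace hd).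
Qed.

Lemma cycle_subspace n : @subspace k V (@chain_map B X (shift Y n)).
Proof.
have [g0 gD] := graded_subspace n; split.
  have [l0 h0] := g0; split=> // x.
  by rewrite [RHS]linear0.
move=> c f g [lf hf df] [lg hg dg].
have [lfg hfg] := gD c f g (conj lf hf) (conj lg hg); split=> // x.
change (iota c *: (f (pdif X x) : Y) + g (pdif X x) =
  pdif (shift Y n) (iota c *: (f x : Y) + g x)).
by rewrite df dg linearP.
Qed.

Lemma cycle_graded n f : @chain_map B X (shift Y n) f -> graded_map n f.
Proof. by case. Qed.

(** The differential of the complex of maps, up to sign: on maps of degree n - 1
    it gives the null-homotopic maps of degree n. *)
Definition bnd (n : int) (s : X -> Y) : X -> Y :=
  fun x => shift_dif n (s x) + s (pdif X x).

Lemma bnd_linear n : linear (bnd n : V -> V).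
Proof.
move=> c f g; apply/funext => x.
change (shift_dif n (iota c *: (f x : Y) + g x) +
  (iota c *: (f (pdif X x) : Y) + g (pdif X x)) =
  iota c *: (shift_dif n (f x) + f (pdif X x)) + (shift_dif n (g x) + g (pdif X x)) :> Y).
by rewrite linearP scalerDr addrACA.
Qed.

Lemma null_homotopicE n f : @null_homotopic B X (shift Y n) f <->
  exists2 s, graded_map (n - 1) s & f = bnd n s.
Proof.
split=> [[s [ls hs fs]]|[s [ls hs] ->]].
  exists s; last exact/funext.
  by split=> // m x; rewrite hs /= /shift_deg -addrA [- 1 + n]addrC.
exists s; split=> // m x.
by rewrite hs /= /shift_deg -addrA [- 1 + n]addrC.
Qed.

Lemma boundary_subspace n : @subspace k V (@null_homotopic B X (shift Y n)).
Proof.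
have [L eL] := linear_pack (bnd_linear n).
have [g0 gD] := graded_subspace (n - 1); split.
  by apply/null_homotopicE; exists 0 => //; rewrite -eL linear0.
move=> c f g /null_homotopicE[s gs ->] /null_homotopicE[t gt ->].
by apply/null_homotopicE; exists (c *: (s : V) + t); [apply: gD|rewrite bnd_linear].
Qed.

Lemma boundary_cycle n f : @null_homotopic B X (shift Y n) f ->
  @chain_map B X (shift Y n) f.
Proof.
move=> /null_homotopicE[s gs ->].
have [lL _] := gs; have [L eL] := linear_pack lL; subst s.
have [_ hs] := gs; split=> [a x y|m x|x].
- by rewrite /bnd !linearP /= scalerDr addrACA.
- rewrite /bnd hs pdif_deg hs /= /shift_deg linearD; congr (_ + _).
    by rewrite /shift_dif pdif_deg linearZ -[m + _ + 1]addrA subrK.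
  by rewrite -addrA [1 + _]addrC subrK.
- rewrite /bnd pdif_pdif linear0 addr0.
  change (shift_dif n (L (pdif X x)) = shift_dif n (shift_dif n (L x) + L (pdif X x))).
  by rewrite linearD /= shift_dif_dif add0r.
Qed.

(** A map of degree n - 1 is killed by the differential exactly when it is a
    chain map to the shift. *)
Lemma bnd_eq0 n s : graded_map (n - 1) s ->
  (bnd n s = (0 : V)) <-> @chain_map B X (shift Y (n - 1)) s.
Proof.
move=> [ls hs]; have bE x : bnd n s x = s (pdif X x) - shift_dif (n - 1) (s x).
  by rewrite /bnd /shift_dif signzB1 scaleNr opprK addrC.
split=> [b0|[_ _ h]].
  split=> // x; apply/eqP; rewrite -subr_eq0; rewrite -bE b0.
  by apply/eqP.
by apply/funext => x; rewrite bE h subrr.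
Qed.

(** The rank of the differential on the space of maps of degree n. *)
Definition rk (n : int) : nat := kdim iota (graded_map n) (@chain_map B X (shift Y n)).

Lemma rkP n : @qdim k V (graded_map n) (@chain_map B X (shift Y n)) (rk n).
Proof.
have [d hd] := qdim_exists (graded_finspan n) (graded_subspace n)
  (cycle_subspace n) (@cycle_graded n).
by rewrite /rk (kdim_uniq (graded_subspace n) (cycle_subspace n) hd).
Qed.

(** Rank-nullity for the differential, in degrees n and n - 1. *)
Lemma dhom_dimP n : (hdim n = rk n + (dhom_dim iota X (shift Y n) + rk (n - 1)))%N.
Proof.
have cfin : @finspan k V (@chain_map B X (shift Y n)).
  by apply: finspan_sub (graded_finspan n) => f; apply: cycle_graded.
have [d hd] := qdim_exists cfin (cycle_subspace n) (boundary_subspace n)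
  (@boundary_cycle n).
have -> : dhom_dim iota X (shift Y n) = d.
  exact: (kdim_uniq (cycle_subspace n) (boundary_subspace n) hd).
have nb : @qdim k V (@null_homotopic B X (shift Y n)) null_map (rk (n - 1)).
  apply: (qdim_transfer (bnd_linear n) _ (graded_subspace (n - 1)) null_subspace _ _
    (rkP (n - 1))).
  - by move=> s gs; apply/null_homotopicE; exists s.
  - by move=> s gs; rewrite null_mapE -bnd_eq0.
  - move=> f /null_homotopicE[s gs ->]; exists s => //; rewrite subrr.
    by rewrite null_mapE.
have nullB f : null_map f -> @null_homotopic B X (shift Y n) f.
  by rewrite null_mapE => ->; case: (boundary_subspace n).
have bs := boundary_subspace n; have cs := cycle_subspace n.
have gs := graded_subspace n; have ns := null_subspace.
apply: (qdim_uniq gs ns (hdimP n)).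
apply: (qdimD gs cs ns (@cycle_graded n) _ (rkP n)).
  by move=> f /nullB/boundary_cycle.
by apply: (qdimD cs bs ns (@boundary_cycle n) nullB hd).
Qed.

End TwoComplexes.

Lemma null_hdimP (X Y : perf B) n :
  @qdim k (X -> kres iota Y) (graded_map n) (fun f => f = 0) (hdim X Y n).
Proof. by rewrite -null_mapE; apply: hdimP. Qed.

(** There are nonzero maps of degree n for finitely many n only. *)
Lemma hdim_support (X Y : perf B) :
  exists A : {fset int}, forall n, n \notin A -> hdim X Y n = 0%N.
Proof.
have [s us es] := pdeg_sum X; have [t ut et] := pdeg_sum Y.
exists (seq_fset tt [seq j - i | i <- s, j <- t]) => n nst.
apply: (qdim_uniq (graded_subspace X Y n) (null_subspace X Y) (hdimP _ _ _)).
apply: qdim0 => [|f [lf hf] x]; first exact: null_subspace.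
have [L eL] := linear_pack lf; subst f.
rewrite (es x) linear_sum big_seq big1 // => i si; rewrite hf (et (L x)) linear_sum.
rewrite big_seq big1 // => j tj; rewrite pdegM; case: eqP => // ij.
case/negP: nst; rewrite seq_fsetE; apply/allpairsP; exists (i, j) => /=.
by split=> //; rewrite -ij addrC addrA addNr add0r.
Qed.

(** The Euler characteristic of the complex of maps from X to Y, computed from
    the dimensions of its terms. *)
Definition homchi (X Y : perf B) : int :=
  \sum_(n \in [set: int]%classic) (- 1) ^+ `|n|%N * (hdim X Y n)%:Z.

Section FiniteSums.
Implicit Types F G : int -> int.
(** Finitely supported functions on the integers. *)
Definition fsupp F := exists A : {fset int}, forall n, n \notin A -> F n = 0.

Lemma fsumD F G : fsupp F -> fsupp G ->
  \sum_(n \in [set: int]%classic) (F n + G n) =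
  \sum_(n \in [set: int]%classic) F n + \sum_(n \in [set: int]%classic) G n.
Proof.
move=> [A hA] [C hC]; have h n : n \notin (A `|` C)%fset -> F n = 0 /\ G n = 0.
  by rewrite in_fsetU negb_or => /andP[/hA ? /hC ?].
rewrite !(fsbigTE (A `|` C)%fset) ?big_split // => n /h[] // -> ->.
by rewrite addr0.
Qed.

Lemma fsumN F : fsupp F ->
  \sum_(n \in [set: int]%classic) - F n = - \sum_(n \in [set: int]%classic) F n.
Proof.
move=> [A hA]; rewrite !(fsbigTE A) ?sumrN // => n /hA -> //; exact: oppr0.
Qed.

Lemma fsum_shift F (m : int) :
  \sum_(n \in [set: int]%classic) F (n + m) = \sum_(n \in [set: int]%classic) F n.
Proof.
rewrite [RHS](reindex_fsbigT (fun n => n + m)) //.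
by exists (fun n => n - m) => n; rewrite ?addrK ?subrK.
Qed.

Lemma fsupp_shift F (m : int) : fsupp F -> fsupp (fun n => F (n + m)).
Proof.
move=> [A hA]; exists [fset n - m | n in A]%fset => n nA; apply: hA.
by apply: contra nA => nA; apply/imfsetP; exists (n + m) => //; rewrite addrK.
Qed.

Lemma fsuppM F G : fsupp G -> fsupp (fun n => F n * G n).
Proof. by move=> [A hA]; exists A => n /hA ->; rewrite mulr0. Qed.

Lemma fsupp_le (F : int -> int) (d : int -> nat) :
  fsupp (fun n => (d n)%:Z) -> (forall n, d n = 0%N -> F n = 0) -> fsupp F.
Proof. by move=> [A hA] h; exists A => n /hA[] /h. Qed.

End FiniteSums.

Lemma hdim_fsupp X Y : fsupp (fun n => (hdim X Y n)%:Z).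
Proof. by have [A hA] := hdim_support X Y; exists A => n /hA ->. Qed.

Lemma euler_char_homchi X Y : euler_char iota X Y = homchi X Y.
Proof.
have h n := dhom_dimP X Y n; have hs := hdim_fsupp X Y.
pose R n : int := (- 1) ^+ `|n|%N * (rk X Y n)%:Z.
pose D n : int := (- 1) ^+ `|n|%N * (dhom_dim iota X (shift Y n))%:Z.
have sR : fsupp R.
  apply: fsuppM; apply: fsupp_le hs _ => n; rewrite h => /eqP.
  by rewrite addn_eq0 => /andP[/eqP ->].
have sD : fsupp D.
  apply: fsuppM; apply: fsupp_le hs _ => n; rewrite h => /eqP.
  by rewrite !addn_eq0 => /and3P[_ /eqP ->].
have sR1 : fsupp (fun n => - R (n - 1)).
  by have [A hA] := fsupp_shift (- 1) sR; exists A => n /hA ->; rewrite oppr0.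
transitivity (\sum_(n \in [set: int]%classic) (R n + (D n + - R (n - 1)))).
  have sDR : fsupp (fun n => D n - R (n - 1)).
    have [A hA] := sD; have [C hC] := sR1; exists (A `|` C)%fset => n.
    by rewrite in_fsetU negb_or => /andP[/hA -> /hC ->]; rewrite addr0.
  rewrite (fsumD sR sDR) (fsumD sD sR1) (fsumN (fsupp_shift (- 1) sR)).
  by rewrite (fsum_shift R) addrCA subrr addr0.
rewrite /homchi; apply: eq_fsbigr => n _; rewrite h !PoszD !mulrDr /R /D.
by rewrite signzB1 mulNr opprK.
Qed.

(** Isomorphism of complexes, as opposed to homotopy equivalence. *)
Definition perf_iso (X Y : perf B) : Prop := exists (f : X -> Y) (g : Y -> X),
  [/\ chain_map f, chain_map g, cancel f g & cancel g f].

Lemma graded_comp (X Y Z : perf B) m n (f : X -> Y) (g : Y -> Z) :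
  graded_map m f -> graded_map n g -> graded_map (m + n) (g \o f).
Proof.
move=> [lf hf] [lg hg]; split=> [a x y|l x] /=; first by rewrite lf lg.
by rewrite hf hg addrA.
Qed.

Lemma chain_graded (X Y : perf B) (f : X -> Y) : chain_map f -> graded_map 0 f.
Proof. by move=> [lf hf _]; split=> // m x; rewrite hf addr0. Qed.

Lemma precomp_linear (W X Y : lmodType B) (f : X -> Y) :
  linear (fun g : Y -> kres iota W => (g \o f : X -> kres iota W)).
Proof. by []. Qed.

Lemma postcomp_linear (W X Y : lmodType B) (f : X -> Y) : linear f ->
  linear (fun g : W -> kres iota X => (f \o g : W -> kres iota Y)).
Proof. by move=> lf c g h; apply/funext => x; rewrite /= lf. Qed.

Lemma homchi_isol X X' Y : perf_iso X X' -> homchi X Y = homchi X' Y.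
Proof.
move=> [f [g [/chain_graded cf /chain_graded cg fg gf]]]; apply: eq_fsbigr => n _.
congr (_ * Posz _).
apply/esym/(qdim_uniq (graded_subspace X' Y n) (@subspace0 _ _) (null_hdimP _ _ _)).
apply: (@qdim_transfer k (X -> kres iota Y) (X' -> kres iota Y) (fun h => h \o g)
  _ _ _ _ _ (@precomp_linear Y _ _ g) _ (graded_subspace X Y n)
  (@subspace0 _ _) _ _ (null_hdimP _ _ _)) => [h gh|h gh|h gh].
- by rewrite -[n]add0r; apply: graded_comp cg gh.
- split=> [->|] //; move/funeqP => h0; apply/funext => x.
  by have := h0 (f x); rewrite /= fg.
- exists (h \o f); first by rewrite -[n]add0r; apply: graded_comp cf gh.
  apply/eqP; rewrite subr_eq0; apply/eqP/funext => x /=; by rewrite gf.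
Qed.

Lemma homchi_isor X Y Y' : perf_iso Y Y' -> homchi X Y = homchi X Y'.
Proof.
move=> [f [g [/chain_graded cf /chain_graded cg fg gf]]]; apply: eq_fsbigr => n _.
congr (_ * Posz _).
apply/esym/(qdim_uniq (graded_subspace X Y' n) (@subspace0 _ _) (null_hdimP _ _ _)).
have [lf _] := cf; have [F eF] := linear_pack lf; subst f.
apply: (@qdim_transfer k (X -> kres iota Y) (X -> kres iota Y') (fun h => F \o h)
  _ _ _ _ _ (@postcomp_linear X _ _ _ lf) _ (graded_subspace X Y n)
  (@subspace0 _ _) _ _ (null_hdimP _ _ _)) => [h gh|h gh|h gh].
- by rewrite -[n]addr0; apply: graded_comp gh cf.
- split=> [->|/funeqP h0]; first by apply/funext => x /=; rewrite linear0.
  by apply/funext => x; rewrite -[LHS]fg; have := h0 x; rewrite /= => ->;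
     rewrite -[RHS]fg linear0.
- exists (g \o h); first by rewrite -[n]addr0; apply: graded_comp gh cg.
  apply/eqP; rewrite subr_eq0; apply/eqP/funext => x /=; by rewrite gf.
Qed.

Section ConeAdditivity.
Variables (X Y W : perf B) (f : X -> Y) (hf : chain_map f).
Local Notation C := (cone hf).

(** A map of degree n from W to the cone is a pair of maps of degrees n + 1 and n
    to X and to Y. *)
Lemma homchi_coner : homchi W Y = homchi W X + homchi W C.
Proof.
have key n : hdim W C n = (hdim W X (n + 1) + hdim W Y n)%N.
  apply: (@qdim_ses k (W -> kres iota Y) (W -> kres iota C) (W -> kres iota X)
    (fun g : W -> kres iota Y => (fun x => (0, g x)) : W -> kres iota C)
    (fun g : W -> kres iota C => (fun x => (g x).1) : W -> kres iota X)
    _ _ _ _ _ _ _ _ (graded_subspace W Y n) (graded_subspace W C n) (graded_subspace W X (n + 1))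
    (graded_finspan W C n) _ _ _ _ _ _ (null_hdimP _ _ _) (null_hdimP _ _ _) (null_hdimP _ _ _)).
  - move=> c g h; apply/funext => x.
    change ((0, iota c *: (g x : Y) + h x) =
      (iota c *: 0 + 0, iota c *: (g x : Y) + h x) :> X * Y).
    by rewrite scaler0 addr0.
  - by [].
  - move=> g [lg hg]; split=> [a x y|m x].
      by rewrite lg; congr pair; rewrite /= scaler0 addr0.
    by rewrite hg /= /cone_deg /= linear0.
  - by move=> g _ /funeqP g0; apply/funext => x; have [] := g0 x.
  - move=> g [lg hg]; split=> [a x y|m x]; first by rewrite lg.
    by rewrite hg /= addrA.
  - move=> h [lh hh]; exists (fun x => (h x, 0)) => //; split=> [a x y|m x].
      by rewrite lh; congr pair; rewrite /= scaler0 addr0.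
    by rewrite hh /= /cone_deg /= linear0 addrA.
  - by [].
  - move=> g [lg hg] /funeqP g0; exists (fun x => (g x).2).
      split=> [a x y|m x]; first by rewrite lg.
      by rewrite hg.
    by apply/funext => x; have g1 : (g x).1 = 0 := g0 x; rewrite [LHS]surjective_pairing g1.
rewrite /homchi -(fsum_shift (fun n => (- 1) ^+ `|n|%N * (hdim W X n)%:Z) 1).
rewrite -fsumD; first last.
- exact/fsuppM/hdim_fsupp.
- apply: (@fsupp_shift (fun n => (- 1) ^+ `|n|%N * (hdim W X n)%:Z) 1).
  exact/fsuppM/hdim_fsupp.
apply: eq_fsbigr => n _; rewrite key PoszD mulrDr addrA -[LHS]add0r; congr (_ + _).
by rewrite signzD1 mulNr addNr.
Qed.

(** A map of degree n from the cone to W is a pair of maps of degrees n - 1 and n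
    from X and from Y. *)
Lemma homchi_conel : homchi Y W = homchi X W + homchi C W.
Proof.
have key n : hdim C W n = (hdim Y W n + hdim X W (n - 1))%N.
  apply: (@qdim_ses k (X -> kres iota W) (C -> kres iota W) (Y -> kres iota W)
    (fun g : X -> kres iota W => (fun c => g c.1) : C -> kres iota W)
    (fun g : C -> kres iota W => (fun y => g (0, y)) : Y -> kres iota W)
    _ _ _ _ _ _ _ _ (graded_subspace X W (n - 1)) (graded_subspace C W n) (graded_subspace Y W n)
    (graded_finspan C W n) _ _ _ _ _ _ (null_hdimP _ _ _) (null_hdimP _ _ _) (null_hdimP _ _ _)).
  - by [].
  - by [].
  - move=> g [lg hg]; split=> [a x y|m x]; first by rewrite /= lg.
    by rewrite /= hg; congr (pdeg _ _ _); rewrite -addrA [1 + _]addrC subrK.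
  - by move=> g _ /funeqP g0; apply/funext => x; have := g0 (x, 0).
  - move=> g [lg hg]; split=> [a x y|m x].
      rewrite -lg; congr g; congr pair; by rewrite /= scaler0 addr0.
    by rewrite -hg /= /cone_deg /= linear0.
  - move=> h [lh hh]; exists (fun c => h c.2) => //; split=> [a x y|m x].
      by rewrite /= lh.
    by rewrite /= hh.
  - move=> g [lg _]; have [L eL] := linear_pack lg; subst g.
    by apply/funext => y; rewrite linear0.
  - move=> g [lg hg] /funeqP g0; have [L eL] := linear_pack lg; subst g.
    exists (fun x => L (x, 0)).
      split=> [a x y|m x].
        by rewrite -lg; congr (L _); congr pair; rewrite /= scaler0 addr0.
      have := hg (m - 1) (x, 0); rewrite /= /cone_deg /= subrK linear0 => ->.
      by congr (pdeg _ _ _); rewrite addrAC addrA.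
    apply/funext => -[x y]; have g1 : L (0, y) = 0 := g0 y.
    rewrite -[RHS]addr0 -[in RHS]g1 -linearD.
    by congr (L _); congr pair; rewrite /= ?addr0 ?add0r.
rewrite /homchi -(fsum_shift (fun n => (- 1) ^+ `|n|%N * (hdim X W n)%:Z) (- 1)).
rewrite -fsumD; first last.
- exact/fsuppM/hdim_fsupp.
- apply: (@fsupp_shift (fun n => (- 1) ^+ `|n|%N * (hdim X W n)%:Z) (- 1)).
  exact/fsuppM/hdim_fsupp.
apply: eq_fsbigr => n _; rewrite key PoszD mulrDr addrCA -[LHS]addr0; congr (_ + _).
by rewrite signzB1 mulNr addNr.
Qed.

End ConeAdditivity.
End GradedHom.

(** * Perfect complexes over a basic algebra *)

Section KernelModule.
Variables (B : pzRingType) (M : lmodType B) (eps : {linear M -> M}).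

(** Membership in the kernel of the endomorphism eps. *)
Definition kerm_pred : pred M := fun x => eps x == 0.

Lemma kerm_submod_closed : submod_closed kerm_pred.
Proof.
split; first by rewrite unfold_in /= linear0.
move=> a x y; rewrite !unfold_in /= => /eqP x0 /eqP y0.
by rewrite linearP x0 y0 scaler0 addr0.
Qed.

HB.instance Definition _ := GRing.isSubmodClosed.Build B M kerm_pred
  kerm_submod_closed.

(** The kernel of eps, as a module. *)
Record kerm := KerM { kerm_val : M; kerm_valP : kerm_val \in kerm_pred }.

HB.instance Definition _ := [isSub for kerm_val].
HB.instance Definition _ := [Choice of kerm by <:].
HB.instance Definition _ := [SubChoice_isSubLmodule of kerm by <:].

Lemma kerm_val0 (y : kerm) : eps (val y) = 0.
Proof. by apply/eqP; have := kerm_valP y. Qed.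

Definition mk_kerm (x : M) (h : eps x = 0) : kerm :=
  KerM (introT eqP h : x \in kerm_pred).

Section Restrict.
Variables (g : {linear M -> M}) (hg : forall x, eps x = 0 -> eps (g x) = 0).
(** The restriction to the kernel of eps of a map which preserves it. *)
Definition kerm_map (y : kerm) : kerm := mk_kerm (hg (kerm_val0 y)).
Lemma kerm_map_linear : linear kerm_map.
Proof. by move=> a x y; apply: val_inj; rewrite /= !linearP. Qed.
HB.instance Definition _ := GRing.isLinear.Build B kerm kerm *:%R kerm_map
  kerm_map_linear.
End Restrict.
End KernelModule.

Section Stalk.
Variables (B : pzRingType) (P : lmodType B) (hP : fgproj P).

(** Multiplication by a boolean. *)
Definition select (b : bool) (x : P) : P := if b then x else 0.
Lemma select_linear b : linear (select b).
Proof. by move=> a x y; case: b; rewrite /select // scaler0 addr0. Qed.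
HB.instance Definition _ b := GRing.isLinear.Build B P P *:%R (select b)
  (select_linear b).

Variable a : int.
Definition stalk_deg (n : int) : {linear P -> P} := select (n == a).
Definition stalk_dif : {linear P -> P} := select false.

Lemma stalk_degM m n x :
  stalk_deg m (stalk_deg n x) = if m == n then stalk_deg n x else 0.
Proof.
rewrite /stalk_deg /= /select; case: (n =P a) => [->|_]; last by rewrite !if_same.
by [].
Qed.

Lemma stalk_deg_sum :
  exists2 s : seq int, uniq s & forall x, x = \sum_(n <- s) stalk_deg n x.
Proof. by exists [:: a] => // x; rewrite big_seq1 /stalk_deg /= eqxx. Qed.

Lemma stalk_dif_deg n x : stalk_dif (stalk_deg n x) = stalk_deg (n + 1) (stalk_dif x).
Proof. by rewrite linear0. Qed.

Lemma stalk_dif_dif x : stalk_dif (stalk_dif x) = 0. Proof. by []. Qed.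

(** The complex with the single term P, in degree a. *)
Definition stalk : perf B := Perf hP stalk_degM stalk_deg_sum stalk_dif_deg stalk_dif_dif.
End Stalk.

Lemma fgproj_free (B : pzRingType) n : fgproj ('rV[B]_n : lmodType B).
Proof. by exists n, id, id; split. Qed.

(** The zero complex, on the module of rows of length 0. *)
Definition zero_perf (B : pzRingType) : perf B := stalk (fgproj_free B 0) 0.

Lemma zero_perfE (B : pzRingType) (x : zero_perf B) : x = 0.
Proof. by apply/rowP => -[]. Qed.

Section LProj.
Variables (B : pzRingType) (e : B).
Hypothesis ee : e * e = e.

Lemma in_lproj (x : B) : (x : B^o) * e = x -> (x : B^o) \in lproj_pred e.
Proof. by move/eqP. Qed.

(** The projection x -> x e of B onto the module B e. *)
Definition mk_lproj (x : B) : lproj e :=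
  LProj (in_lproj (etrans (esym (mulrA x e e)) (congr1 (GRing.mul x) ee))).

Lemma lprojE (y : lproj e) : val y * e = val y.
Proof. by apply/eqP; exact: (lproj_valP y). Qed.

Lemma mk_lproj_val (y : lproj e) : mk_lproj (val y) = y.
Proof. by apply: val_inj; rewrite /= lprojE. Qed.

Lemma fgproj_lproj : fgproj (lproj e : lmodType B).
Proof.
exists 1%N, (fun y => \row_j (val y : B)), (fun v => mk_lproj (v 0 0)).
split=> [a x y|a x y|y].
- by apply/rowP => j; rewrite !mxE.
- by apply: val_inj; rewrite /= !mxE mulrDl -mulrA.
- by rewrite mxE mk_lproj_val.
Qed.
End LProj.

Section Basic.
Variables (k : fieldType) (B : pzRingType) (iota : {rmorphism k -> B}).
Variables (I : finType) (e : I -> B) (chi : I -> {rmorphism B -> k}).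

(** The common kernel J of the characters is nilpotent.  This is expressed by a
    multiplicative filtration F whose first step contains J and whose steps
    vanish from some index on. *)
Definition nilpotent_radical : Prop :=
  exists F : nat -> B -> Prop,
    [/\ forall m, F m 0, forall m x y, F m x -> F m y -> F m (x + y),
        forall m n x y, F m x -> F n y -> F (m + n)%N (x * y),
        forall x, (forall i, chi i x = 0) -> F 1%N x &
        exists N, forall x, F N.+1 x -> x = 0].

(** A finite dimensional algebra over k with idempotents e_i and characters
    chi_i : B -> k dual to them, whose common kernel is nilpotent. *)
Record basic_algebra : Prop := BasicAlgebra {
  basicC : forall c b, iota c * b = b * iota c;
  basic_fin : finite_over iota;
  basic_idem : forall i, e i * e i = e i;
  basic_chi_iota : forall i c, chi i (iota c) = c;
  basic_chi_e : forall i j, chi i (e j) = (i == j)%:R;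
  basic_nil : nilpotent_radical
}.

Hypothesis hB : basic_algebra.

(** The indecomposable projective B e_i, placed in degree a. *)
Definition proj_stalk (i : I) (a : int) : perf B :=
  stalk (fgproj_lproj (basic_idem hB i)) a.

(** An element of the local ring e_i B e_i outside its radical is invertible:
    up to a scalar it differs from e_i by a nilpotent z, and 1 - z is invertible
    by the geometric series. *)
Lemma corner_inverse i b : chi i b != 0 -> exists u, e i * b * e i * u = e i.
Proof.
set la := chi i b => la0.
have [F [_ _ FM F1 [N FN]]] := basic_nil hB.
(* w is e_i b e_i divided by its residue, and z is nilpotent. *)
pose w := e i * b * e i * iota la^-1; pose z := e i - w.
have ee := basic_idem hB i.
have ez : e i * z = z by rewrite mulrBr ee /w !mulrA ee.
have z1 : F 1%N z.
  apply: F1 => j; rewrite rmorphB !rmorphM !(basic_chi_e hB) (basic_chi_iota hB) /=.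
  case: eqP => [->|_]; last by rewrite !mul0r subrr.
  by rewrite mul1r mulr1 divff ?subrr.
have zN : z ^+ N.+1 = 0.
  apply: FN; elim: N => [|n IHn]; first by rewrite expr1.
  by rewrite exprSr -addn1; apply: FM.
have := subrX1 z N.+1; rewrite zN sub0r; set U := \sum_(_ < _) _ => hU.
exists (iota la^-1 * U); rewrite mulrA -/w.
have -> : w = e i * (1 - z) by rewrite mulrBr mulr1 ez /z opprB addrC subrK.
by rewrite -mulrA -[1 - z]opprB mulNr -hU opprK mulr1.
Qed.

Lemma row_gen (M : lmodType B) n (R : {linear 'rV[B]_n -> M}) v :
  R v = \sum_j v 0 j *: R (delta_mx 0 j).
Proof.
by rewrite {1}[v]row_sum_delta linear_sum; apply: eq_bigr => j _; rewrite linearZ.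
Qed.

(** Nakayama's lemma: a nonzero summand p M of a projective module M is not
    contained in the radical of M. *)
Lemma nakayama (M : lmodType B) n (S : {linear M -> 'rV[B]_n})
    (R : {linear 'rV[B]_n -> M}) (p : {linear M -> M}) (x0 : M) :
  cancel S R -> (forall x, p (p x) = p x) -> p x0 = x0 -> x0 != 0 ->
  exists x l i, p x = x /\ chi i (S x 0 l) != 0.
Proof.
move=> SR pp px0; apply: contra_neqP => nex.
have h0 x l i : p x = x -> chi i (S x 0 l) = 0.
  by move=> px; apply/eqP; apply: contra_notT nex => ?; exists x, l, i.
have [F [F0 FD FM F1 [N FN]]] := basic_nil hB.
have hF m x l : p x = x -> F m.+1 (S x 0 l).
  elim: m x l => [|m IHm] x l px; first by apply: F1 => i; apply: h0.
  rewrite -px -[x in p x]SR row_gen !linear_sum summxE.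
  elim/big_ind: _ => // [|j _]; first exact: FD.
  rewrite !linearZ mxE -addn1; apply: FM; first exact: IHm.
  by apply: F1 => i; apply: h0.
rewrite -[x0]SR; have -> : S x0 = 0; last by rewrite linear0.
by apply/rowP => l; rewrite mxE; apply/FN/hF.
Qed.

(** The k-dimension of the module X. *)
Definition tdim (X : lmodType B) (d : nat) : Prop :=
  @qdim k (kres iota X) (fun _ => True) (fun x => x = 0) d.

Lemma tdim_exists (X : lmodType B) : fgproj X -> exists d, tdim X d.
Proof.
move=> [n [s [r [_ /linear_pack[R eR] sr]]]]; subst r.
have [p [beta hbeta]] := basic_fin hB.
apply: qdim_exists => //; last exact: subspace0.
pose b (i : 'I_n * 'I_p) : kres iota X := beta i.2 *: R (delta_mx 0 i.1).
apply: (@finspan_fin _ _ _ b) => x _.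
have /all_sig[c hc] j := cid (hbeta (s x 0 j)).
exists (fun i => c i.1 i.2).
rewrite -(pair_bigA _ (fun j l => c j l *: b (j, l))) /= -[LHS]sr row_gen.
apply: eq_bigr => j _; rewrite {1}hc scaler_suml; apply: eq_bigr => l _.
by rewrite -scalerA.
Qed.

Section Peel.
Variables (X : perf B) (a : int) (i : I) (x : X) (rho : {linear X -> B^o}).
Hypotheses (amin : forall y, pdeg X (a - 1) y = 0)
  (ax : pdeg X a x = x) (ex : e i *: x = x)
  (rho_e : forall y, rho y * e i = rho y) (rho_a : forall y, rho (pdeg X a y) = rho y)
  (rho_x : rho x = e i).

(** The idempotent of X onto the submodule B x, which is isomorphic to B e_i. *)
Definition peel_idem (y : X) : X := (rho y : B) *: x.
Lemma peel_idem_linear : linear peel_idem.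
Proof. by move=> c y z; rewrite /peel_idem linearP scalerDl scalerA. Qed.
HB.instance Definition _ := GRing.isLinear.Build B X X *:%R peel_idem peel_idem_linear.

Local Notation eps := (peel_idem : {linear X -> X}).

Lemma rho_scale b : rho (b *: x) = b * e i.
Proof. by rewrite linearZ /= rho_x. Qed.

Lemma peel_idemK y : eps (eps y) = eps y.
Proof. by rewrite /= /peel_idem rho_scale rho_e. Qed.

Lemma rho_deg n y : rho (pdeg X n y) = if n == a then rho y else 0.
Proof. by rewrite -rho_a pdegM eq_sym; case: eqP => [->|_]; rewrite ?rho_a ?linear0. Qed.

Lemma deg_x n : pdeg X n x = if n == a then x else 0.
Proof. by rewrite -{1}ax pdegM ax. Qed.

Lemma rho_dif y : rho (pdif X y) = 0.
Proof.
rewrite -rho_a; have := pdif_deg (a - 1) y.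
by rewrite subrK amin linear0 => <-; rewrite linear0.
Qed.

Lemma peel_deg n y : eps y = 0 -> eps (pdeg X n y) = 0.
Proof.
by rewrite /= /peel_idem rho_deg => h; case: eqP => // _; rewrite scale0r.
Qed.

Lemma peel_dif0 y : eps (pdif X y) = 0.
Proof. by rewrite /= /peel_idem rho_dif scale0r. Qed.

Lemma peel_dif y : eps y = 0 -> eps (pdif X y) = 0.
Proof. by rewrite peel_dif0. Qed.

Lemma peel_sub y : eps (y - eps y) = 0.
Proof. by rewrite linearB peel_idemK subrr. Qed.

Lemma peel_fgproj : fgproj (kerm eps : lmodType B).
Proof.
have [n [s [r [ls lr sr]]]] := pobj_fgproj X.
exists n, (fun y => s (val y)), (fun v => mk_kerm (peel_sub (r v))).
split=> [c y z|c v w|y].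
- exact: ls.
- by apply: val_inj; rewrite /= -/peel_idem lr linearP scalerBr opprD addrACA.
- by apply: val_inj; rewrite /= sr (kerm_val0 y) subr0.
Qed.

Definition rest_deg n : {linear kerm eps -> kerm eps} := kerm_map (@peel_deg n).
Definition rest_dif : {linear kerm eps -> kerm eps} := kerm_map peel_dif.

Lemma rest_degM m n y : rest_deg m (rest_deg n y) = if m == n then rest_deg n y else 0.
Proof. by apply: val_inj; rewrite /= pdegM; case: eqP. Qed.

Lemma rest_deg_sum :
  exists2 s : seq int, uniq s & forall y, y = \sum_(n <- s) rest_deg n y.
Proof.
have [s us es] := pdeg_sum X; exists s => // y; apply: val_inj.
by rewrite raddf_sum /=; apply: es.
Qed.

Lemma rest_dif_deg n y : rest_dif (rest_deg n y) = rest_deg (n + 1) (rest_dif y).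
Proof. by apply: val_inj; rewrite /= pdif_deg. Qed.

Lemma rest_dif_dif y : rest_dif (rest_dif y) = 0.
Proof. by apply: val_inj; rewrite /= pdif_pdif. Qed.

(** The complement of B x in X, as a complex.  It is stable under the
    differential because nothing maps to the lowest degree a. *)
Definition rest : perf B :=
  Perf peel_fgproj rest_degM rest_deg_sum rest_dif_deg rest_dif_dif.

(** The restriction to B x of the differential of X, as a map to the rest. *)
Definition attach (b : proj_stalk i (a + 1)) : rest :=
  mk_kerm (peel_dif0 ((val b : B) *: x)).

Lemma attach_chain : chain_map attach.
Proof.
split=> [c b b'|n b|b]; apply: val_inj; rewrite /=.
- by rewrite -linearP scalerDl scalerA.
- have := pdif_deg (n - 1) ((val b : B) *: x); rewrite subrK => <-.
  rewrite [pdeg _ _ (_ *: _)]linearZ /= deg_x subr_eq /stalk_deg /= /select.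
  by case: eqP => // _; rewrite scale0r scaler0.
- by rewrite scale0r linear0 pdif_pdif.
Qed.

Lemma peel_iso : perf_iso (cone attach_chain) X.
Proof.
have ee := basic_idem hB i.
pose f (c : cone attach_chain) : X := (val c.1 : B) *: x + val c.2.
pose g (z : X) : cone attach_chain := (mk_lproj ee (rho z), mk_kerm (peel_sub z)).
have fg : cancel f g.
  move=> [b y]; rewrite /f /g /=.
  have ry : rho (val y) = 0.
    by have := congr1 rho (kerm_val0 y); rewrite /= /peel_idem rho_scale linear0 rho_e.
  have rf : rho ((val b : B) *: x + val y) = (val b : B).
    by rewrite linearD rho_scale ry addr0 lprojE.
  congr pair; apply: val_inj; rewrite /=; first by rewrite rf lprojE.
  by rewrite /peel_idem rf addrC addrA addNr add0r.
have gf : cancel g f.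
  by move=> z; rewrite /f /g /= rho_e /peel_idem addrC subrK.
have cf : chain_map f.
  split=> [c u v|n [b y]|[b y]]; rewrite /f /=.
  - by rewrite scalerDl scalerDr scalerA addrACA.
  - rewrite linearD linearZ deg_x /stalk_deg /= /select (inj_eq (addIr 1)).
    by congr (_ + _); case: eqP => // _; rewrite scale0r scaler0.
  - by rewrite /select oppr0 scale0r add0r linearD.
have [lf df cf'] := cf; have [L eL] := linear_pack lf.
exists f, g; split=> //; split=> [c u v|n u|u]; apply: (can_inj fg).
- by rewrite lf !gf.
- by rewrite df !gf.
- by rewrite cf' !gf.
Qed.

Lemma peel_tdim d : e i != 0 -> tdim X d -> exists2 d', (d' < d)%N & tdim rest d'.
Proof.
move=> ei0 hd.
have hT : @subspace k (kres iota X) (fun _ => True) by [].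
have h0 := @subspace0 k (kres iota X).
pose U (y : kres iota X) := eps y = 0.
have hU : subspace U.
  split=> [|c y z y0 z0]; first exact: linear0.
  by rewrite /U [LHS](linearP eps) y0 z0 scaler0 addr0.
have UT y : U y -> True by [].
have ZU (y : kres iota X) : y = 0 -> U y by move=> ->; exact: linear0.
have Tfin : @finspan k (kres iota X) (fun _ => True).
  have [b [_ hb]] := hd; exists d, b => y _.
  have [c [hc _]] := hb y Logic.I.
  by exists c; apply/eqP; rewrite -subr_eq0; apply/eqP.
have [c hc] := qdim_exists Tfin hT hU UT.
have [c' hc'] := qdim_exists (finspan_sub UT Tfin) hU h0 ZU.
have dE := qdim_uniq hT h0 hd (qdimD hT hU h0 UT ZU hc hc').
exists c'; first rewrite dE -[X in (X < _)%N]add0n ltn_add2r lt0n.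
  apply: contraNneq ei0 => c0; rewrite c0 in hc.
  have := qdim_eq0 hc (Logic.I : True) : U x.
  rewrite /U /= /peel_idem rho_x ex => x0.
  by rewrite -rho_x x0 linear0.
apply: (@qdim_transfer k (kres iota X) (kres iota rest)
  (fun y => mk_kerm (peel_sub y)) U _ _ _ _ _ _ hU _ _ _ hc') => //.
- move=> s y z; apply: val_inj; rewrite /=.
  rewrite [peel_idem _](linearP eps (iota s) y z).
  by rewrite opprD addrACA -scalerBr.
- exact: subspace0.
- move=> y Uy; split=> [->|h].
    by apply: val_inj; rewrite /= [peel_idem _](linear0 eps) subr0.
  by have := congr1 val h; rewrite /= [peel_idem _]Uy subr0.
- move=> y _; exists (val y); first exact: kerm_val0.
  by apply: val_inj; rewrite /= [peel_idem _](kerm_val0 y) subr0 subrr.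
Qed.
End Peel.

Lemma min_int (s : seq int) (P : int -> Prop) n : n \in s -> P n ->
  exists2 a, P a & forall m, m \in s -> P m -> a <= m.
Proof.
move=> ns Pn; elim: s n ns Pn => // n s IHs m + Pm.
have [[l ls Pl] _|nex] := pselect (exists2 m, m \in s & P m); last first.
  rewrite in_cons => /orP[/eqP mn|ms]; last by case: nex; exists m.
  exists m => // l; rewrite in_cons -mn => /orP[/eqP-> //|ls Pl].
  by case: nex; exists l.
have [a Pa amin] := IHs l ls Pl.
have [[Pn na]|nn] := pselect (P n /\ n <= a).
  exists n => // j; rewrite in_cons => /orP[/eqP-> //|js Pj].
  exact: le_trans na (amin j js Pj).
exists a => // j; rewrite in_cons => /orP[/eqP-> Pn|]; last exact: amin.
by rewrite leNgt; apply/negP => /ltW na; apply: nn.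
Qed.

(** A nonzero perfect complex is the cone of a map from a projective stalk to a
    complex of smaller dimension. *)
Lemma peel_exists (X : perf B) (z : X) : z != 0 ->
  exists i a (X' : perf B) (f : proj_stalk i (a + 1) -> X') (hf : chain_map f),
    perf_iso (cone hf) X /\
    forall d, tdim X d -> exists2 d', (d' < d)%N & tdim X' d'.
Proof.
move=> z0; have [s us es] := pdeg_sum X.
have [n ns [y y0]] : exists2 n, n \in s & exists y, pdeg X n y != 0.
  apply: contra_neqP z0 => nex; rewrite (es z) big_seq big1 // => n ns.
  by apply/eqP; apply: contra_notT nex => h; exists n => //; exists z.
(* a is the lowest degree in which X is nonzero. *)
have [a [x1 x10] amin] := min_int (P := fun n => exists y, pdeg X n y != 0) ns
  (ex_intro _ y y0).
have amin1 w : pdeg X (a - 1) w = 0.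
  apply/eqP; apply: contraT => w0.
  have a1s : a - 1 \in s.
    apply: contraNT w0 => a1s; rewrite (es w) linear_sum big_seq big1 // => m ms.
    by rewrite pdegM; case: eqP => // am; rewrite am ms in a1s.
  have := amin _ a1s (ex_intro _ w w0).
  by rewrite lerBrDr gerDl ler10.
have [m [S [R [/linear_pack[S' eS] /linear_pack[R' eR] SR]]]] := pobj_fgproj X.
subst S R.
have [w [l [i [aw chiw]]]] : exists w l i, pdeg X a w = w /\ chi i (S' w 0 l) != 0.
  apply: (nakayama SR (x0 := pdeg X a x1)) x10 => [x|]; by rewrite pdegM eqxx.
have [u hu] := corner_inverse chiw.
have ee := basic_idem hB i.
(* The functional e_i u e_i is chosen so that rho maps e_i w to e_i. *)
pose rho0 (y : X) : B^o := S' (pdeg X a y) 0 l * (e i * u * e i).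
have rho0_lin : linear rho0.
  by move=> c p q; rewrite /rho0 !linearP !mxE mulrDl -mulrA.
have [rho erho] := linear_pack rho0_lin.
have rhoE p : rho p = S' (pdeg X a p) 0 l * (e i * u * e i) by rewrite erho.
have ax : pdeg X a (e i *: w) = e i *: w by rewrite linearZ /= aw.
have ex : e i *: (e i *: w) = e i *: w by rewrite scalerA ee.
have rho_e p : rho p * e i = rho p by rewrite rhoE -!mulrA ee.
have rho_a p : rho (pdeg X a p) = rho p by rewrite !rhoE pdegM eqxx.
have rho_x : rho (e i *: w) = e i.
  by rewrite rhoE ax linearZ mxE !mulrA hu ee.
have ei0 : e i != 0.
  apply: contraNneq (oner_neq0 k) => ei0.
  by have := basic_chi_e hB i i; rewrite ei0 rmorph0 eqxx => ->.
exists i, a, (rest amin1 rho_e rho_a rho_x), (attach amin1 rho_e rho_a rho_x).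
exists (attach_chain amin1 ax rho_e rho_a rho_x); split; first exact: peel_iso.
by move=> d; apply: peel_tdim.
Qed.

(** Functions on perfect complexes which are additive on the triangles of the
    form X -> Y -> cone f, up to isomorphism of complexes. *)
Definition cone_additive (A : zmodType) (phi : perf B -> A) : Prop :=
  forall (X Y Z : perf B) (f : X -> Y) (hf : chain_map f),
    perf_iso (cone hf) Z -> phi Y = phi X + phi Z.

Lemma zero_chain (X Y : perf B) : chain_map (fun _ : X => 0 : Y).
Proof. by split=> [c x y|n x|x]; rewrite ?scaler0 ?addr0 ?linear0. Qed.

Section Additive.
Variables (A : zmodType) (phi : perf B -> A).
Hypothesis phiD : cone_additive phi.

(** The zero complex is the cone of a map between zero complexes. *)
Lemma additive_zero (X : perf B) : (forall x : X, x = 0) -> phi X = 0.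
Proof.
move=> X0; apply: (addrI (phi X)); rewrite addr0; apply/esym.
apply: (phiD (hf := zero_chain X X)).
have C0 (c : cone (zero_chain X X)) : c = 0.
  by case: c => x y; rewrite (X0 x) (X0 y).
exists (fun _ => 0), (fun _ => 0); split; try exact: zero_chain.
  by move=> c; rewrite [RHS]C0.
by move=> x; rewrite [RHS]X0.
Qed.

(** The map from a stalk in degree a + 1 to the zero complex has the stalk in
    degree a as its cone. *)
Lemma additive_stalk (P : lmodType B) (hP : fgproj P) (a : int) :
  phi (stalk hP (a + 1)) = - phi (stalk hP a).
Proof.
apply/eqP; rewrite -addr_eq0; apply/eqP.
have := phiD (hf := zero_chain (stalk hP (a + 1)) (zero_perf B)) (Z := stalk hP a).
rewrite (additive_zero (@zero_perfE B)) => <- //.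
exists (fun c => c.1), (fun x => (x, 0)); split=> //.
- split=> // [n [x y]|[x y]] /=; last by rewrite oppr0.
  by rewrite /stalk_deg /= (inj_eq (addIr 1)).
- split=> [c x y|n x|x] /=; rewrite /cone_deg /cone_dif /=.
  + by congr pair; rewrite /= scaler0 addr0.
  + by rewrite linear0 /stalk_deg /= (inj_eq (addIr 1)).
  + by rewrite oppr0 addr0.
- by move=> [x y] /=; rewrite [y]zero_perfE.
Qed.

Lemma additive_stalk_sign (P : lmodType B) (hP : fgproj P) (a : int) :
  phi (stalk hP a) = phi (stalk hP 0) *~ (- 1) ^+ `|a|%N.
Proof.
have [up down] : (forall b, phi (stalk hP b) = phi (stalk hP 0) *~ (- 1) ^+ `|b|%N ->
      phi (stalk hP (b + 1)) = phi (stalk hP 0) *~ (- 1) ^+ `|(b + 1)%R|%N) /\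
    (forall b, phi (stalk hP (b + 1)) = phi (stalk hP 0) *~ (- 1) ^+ `|(b + 1)%R|%N ->
      phi (stalk hP b) = phi (stalk hP 0) *~ (- 1) ^+ `|b|%N).
  split=> b; rewrite additive_stalk signzD1 mulrNz; first by move=> ->.
  exact: oppr_inj.
elim: a => [|n IHn|n IHn]; first by rewrite mulr1z.
  by rewrite -addn1 PoszD; apply: up.
by apply: down; rewrite -[n.+1]addn1 PoszD opprD subrK.
Qed.
End Additive.

(** In K_0(per B), every perfect complex is an integral combination of the
    indecomposable projectives, with coefficients independent of phi. *)
Lemma perf_class (X : perf B) : exists mu : I -> int,
  forall (A : zmodType) (phi : perf B -> A), cone_additive phi ->
    phi X = \sum_i phi (proj_stalk i 0) *~ mu i.
Proof.
have [d hd] := tdim_exists (pobj_fgproj X).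
have [n] := ubnP d; elim: n => // n IHn in d X hd *; rewrite ltnS => dn.
have [[z z0]|nex] := pselect (exists z : X, z != 0); last first.
  exists (fun _ => 0) => A phi phiD; rewrite big1 //.
  apply: (additive_zero phiD) => x; apply/eqP; apply: contra_notT nex => ?.
  by exists x.
have [i [a [X' [f [hf [iso lt]]]]]] := peel_exists z0.
have [d' ltd hd'] := lt d hd.
have [mu hmu] := IHn d' X' hd' (leq_trans ltd dn).
exists (fun j => mu j + (if j == i then (- 1) ^+ `|a|%N else 0)) => A phi phiD.
transitivity (phi X' - phi (proj_stalk i (a + 1))).
  by rewrite (phiD _ _ _ _ _ iso) addrAC subrr add0r.
rewrite (hmu _ _ phiD).
rewrite additive_stalk // opprK (additive_stalk_sign phiD).
under [RHS]eq_bigr do rewrite mulrzDr; rewrite big_split /=; congr (_ + _).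
rewrite (bigD1 i) //= eqxx big1 ?addr0 // => j /negPf ->; exact: mulr0z.
Qed.
End Basic.

(** * Traces of endomorphisms of projective modules *)

Section Trace.
Variables (B : pzRingType) (K : fieldType) (chi : {rmorphism B -> K}).

(** The image under chi of the trace of the matrix over B which represents f in
    the presentation (s, r) of M as a summand of a free module. *)
Definition ftr (M : lmodType B) n (s : M -> 'rV[B]_n) (r : 'rV[B]_n -> M)
  (f : M -> M) : K := \sum_j chi (s (f (r (delta_mx 0 j))) 0 j).

Lemma ftr_comp (M N : lmodType B) m n (s : M -> 'rV[B]_m) (r : 'rV[B]_m -> M)
    (t : N -> 'rV[B]_n) (q : 'rV[B]_n -> N) (f : M -> N) (g : N -> M) :
  linear s -> linear r -> linear t -> linear q -> cancel t q -> linear f -> linear g ->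
  ftr s r (g \o f) = \sum_j \sum_l chi (t (f (r (delta_mx 0 j))) 0 l) *
                                   chi (s (g (q (delta_mx 0 l))) 0 j).
Proof.
move=> /linear_pack[S eS] _ /linear_pack[T eT] /linear_pack[Q eQ] tq.
move=> _ /linear_pack[G eG]; subst s t q g.
apply: eq_bigr => j _; rewrite /= -[X in G X]tq row_gen !linear_sum summxE rmorph_sum.
by apply: eq_bigr => l _; rewrite !linearZ mxE rmorphM.
Qed.

Lemma ftrC (M N : lmodType B) m n (s : M -> 'rV[B]_m) (r : 'rV[B]_m -> M)
    (t : N -> 'rV[B]_n) (q : 'rV[B]_n -> N) (f : M -> N) (g : N -> M) :
  linear s -> linear r -> linear t -> linear q -> cancel s r -> cancel t q ->
  linear f -> linear g -> ftr s r (g \o f) = ftr t q (f \o g).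
Proof.
move=> ls lr lt lq sr tq lf lg.
rewrite (ftr_comp ls lr lt lq tq lf lg) (ftr_comp lt lq ls lr sr lg lf) exchange_big.
by apply: eq_bigr => l _; apply: eq_bigr => j _; rewrite mulrC.
Qed.

(** The Hattori-Stallings trace, followed by chi.  It is computed in a chosen
    presentation of M as a summand of a free module; by [ptrace_frame] the choice
    does not matter. *)
Definition ptrace (M : lmodType B) (hM : fgproj M) (f : M -> M) : K :=
  let n := projT1 (cid hM) in let h := projT2 (cid hM) in
  let s := projT1 (cid h) in let r := projT1 (cid (projT2 (cid h))) in ftr s r f.

Lemma ptraceP (M : lmodType B) (hM : fgproj M) :
  exists n (s : M -> 'rV[B]_n) (r : 'rV[B]_n -> M),
    [/\ linear s, linear r, cancel s r & forall f, ptrace hM f = ftr s r f].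
Proof.
pose h := projT2 (cid hM); pose h' := projT2 (cid h).
have [ls lr sr] := projT2 (cid h').
by exists (projT1 (cid hM)), (projT1 (cid h)), (projT1 (cid h')).
Qed.

Lemma ptrace_frame (M : lmodType B) (hM : fgproj M) n (s : M -> 'rV[B]_n)
    (r : 'rV[B]_n -> M) (f : M -> M) :
  linear s -> linear r -> cancel s r -> linear f -> ptrace hM f = ftr s r f.
Proof.
move=> ls lr sr lf; have [m [t [q [lt lq tq ->]]]] := ptraceP hM.
by rewrite -[LHS](ftrC (g := f) (f := id) ls lr lt lq sr tq).
Qed.

Lemma ptraceC (M N : lmodType B) (hM : fgproj M) (hN : fgproj N)
    (f : M -> N) (g : N -> M) : linear f -> linear g ->
  ptrace hM (fun x => g (f x)) = ptrace hN (fun y => f (g y)).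
Proof.
move=> lf lg; have [m [s [r [ls lr sr ->]]]] := ptraceP hM.
have [n [t [q [lt lq tq ->]]]] := ptraceP hN.
exact: (ftrC ls lr lt lq sr tq lf lg).
Qed.

Lemma ptraceD (M : lmodType B) (hM : fgproj M) (f g : M -> M) :
  ptrace hM (fun x => f x + g x) = ptrace hM f + ptrace hM g.
Proof.
have [m [s [r [/linear_pack[S eS] lr sr h]]]] := ptraceP hM; subst s.
rewrite !h /ftr -big_split /=; apply: eq_bigr => j _.
by rewrite linearD mxE rmorphD.
Qed.

Lemma ptraceN (M : lmodType B) (hM : fgproj M) (f : M -> M) :
  ptrace hM (fun x => - f x) = - ptrace hM f.
Proof.
have [m [s [r [/linear_pack[S eS] lr sr h]]]] := ptraceP hM; subst s.
rewrite !h /ftr -sumrN; apply: eq_bigr => j _.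
by rewrite linearN mxE rmorphN.
Qed.

(** The endomorphism of X which acts by (-1)^n on the term of degree n. *)
Definition signmap (X : perf B) (x : X) : X :=
  \sum_(n <- s2val (cid2 (pdeg_sum X))) (- 1) ^+ `|n|%N *: pdeg X n x.

Lemma signmap_linear (X : perf B) : linear (@signmap X).
Proof.
move=> a x y; rewrite /signmap scaler_sumr -big_split /=; apply: eq_bigr => n _.
by rewrite linearP scalerDr !scalerA commr_sign.
Qed.

Lemma signmap_deg (X : perf B) n (x : X) :
  signmap (pdeg X n x) = (- 1) ^+ `|n|%N *: pdeg X n x.
Proof.
rewrite /signmap; case: cid2 => s us es /=.
have [ns|nns] := boolP (n \in s); last first.
  have -> : pdeg X n x = 0.
    rewrite (es x) linear_sum big_seq big1 // => m ms.
    by rewrite pdegM; case: eqP => // nm; rewrite nm ms in nns.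
  by rewrite scaler0 big1 // => m _; rewrite linear0 scaler0.
rewrite (bigD1_seq n) //= pdegM eqxx big1 ?addr0 // => m /negPf mn.
by rewrite pdegM mn scaler0.
Qed.

Lemma signmap_graded (X Y : perf B) n (f : X -> Y) x : linear f ->
    (forall m x, f (pdeg X m x) = pdeg Y (m + n) (f x)) ->
  f (signmap x) = (- 1) ^+ `|n|%N *: signmap (f x).
Proof.
move=> /linear_pack[F eF] hf; subst f.
have [s us es] := pdeg_sum X.
have [S eS] := linear_pack (@signmap_linear X).
have [T eT] := linear_pack (@signmap_linear Y).
rewrite -eS -eT {1 2}(es x) !linear_sum scaler_sumr; apply: eq_bigr => m _.
rewrite eS eT signmap_deg linearZ /= hf signmap_deg scalerA; congr (_ *: _).
have sD (a b : int) : (- 1) ^+ `|(a + b)%R|%N = (- 1) ^+ `|a|%N * (- 1) ^+ `|b|%N :> B.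
  elim: b => [|b IHb|b IHb]; first by rewrite addr0 mulr1.
    by rewrite -addn1 PoszD addrA !signzD1 IHb mulrN.
  by rewrite -addn1 PoszD opprD addrA !signzB1 IHb mulrN.
rewrite addrC sD mulrA.
have -> : (- 1) ^+ `|n|%N * (- 1) ^+ `|n|%N = 1 :> B; last by rewrite mul1r.
by rewrite -expr2 sqrr_sign.
Qed.

(** The alternating sum over n of the traces of the identity of X^n. *)
Definition supertrace (X : perf B) : K := ptrace (pobj_fgproj X) (@signmap X).

(** The sign endomorphism anticommutes with maps of degree 1 or -1. *)
Lemma signmap_anti (X : perf B) (f : X -> X) x : graded_map (- 1) f \/ graded_map 1 f ->
  f (signmap x) = - signmap (f x).
Proof. by case=> -[lf hf]; rewrite (signmap_graded _ lf hf) expr1 scaleN1r. Qed.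

(** The trace of sigma (d s + s d) vanishes, as sigma anticommutes with the
    differential d and traces are cyclic. *)
Lemma supertrace_homotopy (X : perf B) (f : X -> X) :
  @null_homotopic B X X f -> ptrace (pobj_fgproj X) (fun x => signmap (f x)) = 0.
Proof.
move=> [s [ls hs fE]].
have [S eS] := linear_pack (@signmap_linear X).
have -> : (fun x => signmap (f x)) =
    (fun x => signmap (pdif X (s x)) + signmap (s (pdif X x))).
  by apply/funext => x; rewrite fE -eS linearD.
rewrite ptraceD.
have ld : linear (pdif X) by move=> a x y; rewrite linearP.
have lss : linear (fun x => signmap (s x)).
  by move=> a x y; rewrite ls signmap_linear.
rewrite [X in _ + X](ptraceC _ (pobj_fgproj X) ld lss).
have -> : (fun y => pdif X (signmap (s y))) = (fun y => - signmap (pdif X (s y))).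
  apply/funext => y; apply: (@signmap_anti X (pdif X)); right.
  by split=> // m x; rewrite pdif_deg.
by rewrite ptraceN subrr.
Qed.

Lemma supertrace_heq (X Y : perf B) : homotopy_equiv X Y -> supertrace X = supertrace Y.
Proof.
move=> [f [g [[lf df _] [lg dg _] /supertrace_homotopy h1 /supertrace_homotopy h2]]].
have key (Z : perf B) (u : Z -> Z) :
    ptrace (pobj_fgproj Z) (fun x => signmap (u x - x)) = 0 ->
    supertrace Z = ptrace (pobj_fgproj Z) (fun x => signmap (u x)).
  have [S eS] := linear_pack (@signmap_linear Z).
  have -> : (fun x => signmap (u x - x)) = (fun x => signmap (u x) + - signmap x).
    by apply/funext => x; rewrite -eS linearB.
  by rewrite ptraceD ptraceN => /eqP; rewrite subr_eq0 => /eqP.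
rewrite (key _ _ h1) (key _ _ h2).
have lsg : linear (fun y => signmap (g y)) by move=> a x y; rewrite lg signmap_linear.
rewrite (ptraceC _ (pobj_fgproj Y) lf lsg); congr ptrace; apply/funext => y.
rewrite (@signmap_graded _ _ 0 f _ lf) ?expr0 ?scale1r // => m x.
by rewrite df addr0.
Qed.

(** The identity of the cone is the sum of the projections to its two summands;
    cyclicity reduces their contributions to X, with a shift of degree, and Y. *)
Lemma supertrace_cone (X Y : perf B) (f : X -> Y) (hf : chain_map f) :
  supertrace Y = supertrace X + supertrace (cone hf).
Proof.
pose C := cone hf; have [S eS] := linear_pack (@signmap_linear C).
pose i1 (x : X) : C := (x, 0); pose i2 (y : Y) : C := (0, y).
pose p1 (c : C) : X := c.1; pose p2 (c : C) : Y := c.2.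
have li1 : linear i1 by move=> a x y; rewrite /i1; congr pair; rewrite /= scaler0 addr0.
have li2 : linear i2 by move=> a x y; rewrite /i2; congr pair; rewrite /= scaler0 addr0.
have lp1 : linear p1 by []. have lp2 : linear p2 by [].
have l1 : linear (fun x => signmap (i1 x)) by move=> a x y; rewrite li1 signmap_linear.
have l2 : linear (fun x => signmap (i2 x)) by move=> a x y; rewrite li2 signmap_linear.
have -> : supertrace C = - supertrace X + supertrace Y; last by rewrite addrA subrr add0r.
rewrite /supertrace.
have -> : @signmap C = fun c => signmap (i1 (p1 c)) + signmap (i2 (p2 c)).
  apply/funext => -[x y]; rewrite -eS -linearD; congr (S _).
  by rewrite /i1 /i2 /p1 /p2 /=; congr pair; rewrite /= ?addr0 ?add0r.
rewrite ptraceD (ptraceC _ (pobj_fgproj X) lp1 l1) (ptraceC _ (pobj_fgproj Y) lp2 l2).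
congr (_ + _).
  rewrite -ptraceN; congr ptrace; apply/funext => x.
  by rewrite (@signmap_graded C X 1 p1 _ lp1) // expr1 scaleN1r.
congr ptrace; apply/funext => y.
rewrite (@signmap_graded C Y 0 p2 _ lp2) ?expr0 ?scale1r // => m c.
by rewrite addr0.
Qed.

Lemma supertrace_triangle (X Y Z : perf B) :
  triangle X Y Z -> supertrace Y = supertrace X + supertrace Z.
Proof. by move=> [f [hf /supertrace_heq <-]]; apply: supertrace_cone. Qed.

Lemma supertrace_lproj (e : B) (ee : e * e = e) :
  supertrace (stalk (fgproj_lproj ee) 0) = chi e.
Proof.
rewrite /supertrace.
rewrite (@ptrace_frame _ _ 1 (fun y : lproj e => \row_j (val y : B))
  (fun v : 'rV[B]_1 => mk_lproj ee (v 0 0))).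
- rewrite /ftr big_ord1 /= mxE.
  set y := mk_lproj _ _; have := @signmap_deg (stalk (fgproj_lproj ee) 0) 0 y.
  by rewrite expr0 scale1r /= /stalk_deg /= => ->; rewrite /= mxE !eqxx mul1r.
- by move=> a x y; apply/rowP => j; rewrite !mxE.
- by move=> a x y; apply: val_inj; rewrite /= !mxE mulrDl -mulrA.
- by move=> y; rewrite mxE mk_lproj_val.
- exact: (@signmap_linear (stalk (fgproj_lproj ee) 0)).
Qed.
End Trace.

(** * The Euler form in terms of the Cartan matrix *)

(** Exchange of two summations, for an index type of arbitrary universe level such
    as the type of perfect complexes. *)
Lemma sum_exchange (T : Type) (x : seq T) (J : finType) (V : nmodType) (F : T -> J -> V) :
  \sum_(i <- x) \sum_j F i j = \sum_j \sum_(i <- x) F i j.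
Proof.
elim: x => [|a x IHx]; first by rewrite !big_nil big1 // => j _; rewrite big_nil.
by rewrite big_cons IHx -big_split; apply: eq_bigr => j _; rewrite big_cons.
Qed.

Section EulerForm.
Variables (k : fieldType) (B : pzRingType) (iota : {rmorphism k -> B}).
Variables (I : finType) (e : I -> B) (chi : I -> {rmorphism B -> k}).
Hypothesis hB : basic_algebra iota e chi.
Let iotaC := basicC hB.
Let Bfin := basic_fin hB.

(** The entries of the Cartan matrix. *)
Definition cform (i j : I) : int := (hom_dim iota (lproj (e i)) (lproj (e j)))%:Z.

Lemma homchi_stalk i j : homchi iota (proj_stalk hB i 0) (proj_stalk hB j 0) = cform i j.
Proof.
rewrite /homchi (fsbigTE [fset 0%R]%fset).
  rewrite big_seq_fset1 expr0 mul1r /cform /hdim /hom_dim; congr (Posz (kdim _ _ _)).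
  apply/funext => f; apply/propext; split=> [[]//|lf]; split=> // m x.
  have [F eF] := linear_pack lf; subst f.
  by rewrite addr0 /= /stalk_deg /= /select; case: eqP => // _; rewrite linear0.
move=> n; rewrite in_fset1 => /negPf n0.
have gs := graded_subspace iotaC (proj_stalk hB i 0) (proj_stalk hB j 0) n.
have ns := null_subspace iota (proj_stalk hB i 0) (proj_stalk hB j 0).
suff -> : hdim iota (proj_stalk hB i 0) (proj_stalk hB j 0) n = 0%N by rewrite mulr0.
apply: (qdim_uniq gs ns (hdimP iotaC Bfin _ _ _)); apply: qdim0 => // f [lf hf] x.
by have := hf 0 x; rewrite add0r /= /stalk_deg /= n0.
Qed.

Lemma homchi_addr W : cone_additive (fun X => homchi iota W X).
Proof.
move=> X Y Z f hf iso; rewrite (homchi_coner iotaC Bfin W hf).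
by rewrite (homchi_isor iotaC Bfin W iso).
Qed.

Lemma homchi_addl W : cone_additive (fun X => homchi iota X W).
Proof.
move=> X Y Z f hf iso; rewrite (homchi_conel iotaC Bfin W hf).
by rewrite (homchi_isol iotaC Bfin W iso).
Qed.

(** The coordinates of the class of X on the indecomposable projectives. *)
Definition mu (X : perf B) : I -> int := projT1 (cid (perf_class hB X)).

Lemma muP (X : perf B) (A : zmodType) (phi : perf B -> A) : cone_additive phi ->
  phi X = \sum_i phi (proj_stalk hB i 0) *~ mu X i.
Proof. exact: (projT2 (cid (perf_class hB X))). Qed.

(** The coordinates of a formal sum of complexes. *)
Definition K0mu (x : K0 B) (i : I) : int := \sum_(a <- x) a.1 * mu a.2 i.

(** The quadratic form of the Cartan matrix. *)
Definition qform (v : I -> int) : int := \sum_i v i * \sum_j v j * cform i j.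

Lemma euler_charE X Y :
  euler_char iota X Y = \sum_i mu X i * \sum_j mu Y j * cform i j.
Proof.
rewrite (euler_char_homchi iotaC Bfin) (muP X (homchi_addl Y)).
apply: eq_bigr => i _; rewrite -mulrzr intz mulrC; congr (_ * _).
rewrite (muP Y (homchi_addr _)); apply: eq_bigr => j _.
by rewrite -mulrzr intz mulrC homchi_stalk.
Qed.

Lemma euler_formE (x : seq (int * perf B)) : euler_form iota x = qform (K0mu x).
Proof.
rewrite /euler_form /euler_pairing /qform.
under eq_bigr do under eq_bigr do rewrite euler_charE.
rewrite [RHS](eq_bigr (fun i => \sum_(a <- x) a.1 * mu a.2 i *
   \sum_(b <- x) \sum_j b.1 * mu b.2 j * cform i j)); last first.
  move=> i _; rewrite /K0mu mulr_suml; apply: eq_bigr => a _; congr (_ * _).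
  by rewrite sum_exchange; apply: eq_bigr => j _; rewrite mulr_suml.
rewrite -sum_exchange; apply: eq_bigr => a _.
under [RHS]eq_bigr do rewrite mulr_sumr.
rewrite -sum_exchange; apply: eq_bigr => b _; rewrite mulr_sumr; apply: eq_bigr => i _.
rewrite -mulrA [b.1 * _]mulrCA -!mulrA; congr (_ * (_ * _)).
by rewrite mulr_sumr; apply: eq_bigr => j _; rewrite !mulrA.
Qed.

Lemma triangle_additive (A : zmodType) (phi : perf B -> A) :
  (forall X Y Z, triangle X Y Z -> phi Y = phi X + phi Z) -> cone_additive phi.
Proof.
move=> h X Y Z f hf [g [g' [cg cg' gK g'K]]]; apply: h; exists f, hf, g, g'.
have null (W : perf B) (u : W -> W) : (forall x, u x = x) ->
    @null_homotopic B W W (fun x => u x - x).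
  move=> ux; exists (fun _ => 0); split=> [a x y|n x|x].
  - by rewrite scaler0 addr0.
  - by rewrite linear0.
  - by rewrite ux subrr linear0 addr0.
by split=> //; apply: null.
Qed.

Lemma K0mu_null x : (forall i, K0mu x i = 0) -> K0_null x.
Proof.
move=> x0 A phi /triangle_additive phiD.
under eq_bigr do rewrite (muP _ phiD).
rewrite (eq_bigr (fun a => \sum_i phi (proj_stalk hB i 0) *~ (a.1 * mu a.2 i))); last first.
  by move=> a _; rewrite mulrz_suml; apply: eq_bigr => i _; rewrite mulrC mulrzA.
rewrite sum_exchange big1 // => i _; rewrite -mulrz_sumr.
by have := x0 i; rewrite /K0mu => ->; rewrite mulr0z.
Qed.

(** The class with coordinates v on the basis of the indecomposable projectives. *)
Definition K0proj (v : I -> int) : K0 B := [seq (v i, proj_stalk hB i 0) | i : I].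

Lemma euler_form_proj v : euler_form iota (K0proj v) = qform v.
Proof.
rewrite /euler_form /euler_pairing /K0proj /qform big_image /=; apply: eq_bigr => i _.
rewrite big_image mulr_sumr; apply: eq_bigr => j _ /=.
by rewrite (euler_char_homchi iotaC Bfin) homchi_stalk mulrA.
Qed.

(** The i-th coordinate is detected by the supertrace of the i-th character. *)
Lemma K0proj_null v : K0_null (K0proj v) -> forall i, (v i)%:~R = 0 :> k.
Proof.
move=> h i.
have := h k (supertrace (chi i)) (@supertrace_triangle _ _ (chi i)).
rewrite /K0proj big_image /= (bigD1 i) //= supertrace_lproj (basic_chi_e hB) eqxx.
rewrite big1 ?addr0 // => j ji.
by rewrite supertrace_lproj (basic_chi_e hB) eq_sym (negPf ji) mul0rz.
Qed.

(** The vectors of the left kernel of the Cartan matrix. *)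
Definition kervec (v : I -> int) : Prop := forall j, \sum_i v i * cform i j = 0.

Lemma kervec_qform v : kervec v -> qform v = 0.
Proof.
move=> kv; rewrite /qform; under eq_bigr do rewrite mulr_sumr.
rewrite exchange_big big1 // => j _.
under eq_bigr do rewrite mulrCA; by rewrite -mulr_sumr kv mulr0.
Qed.

(** If the kernel vectors of the Cartan matrix vanish in k, then they vanish in
    the integers: in characteristic p their entries may be divided by p. *)
Lemma kervec_descent :
  (forall v, kervec v -> forall i, (v i)%:~R = 0 :> k) ->
  forall v, kervec v -> forall i, v i = 0.
Proof.
move=> h v; have [n] := ubnP (\sum_i `|v i|%N); elim: n v => // n IHn v.
rewrite ltnS => vn kv i0; apply/eqP; apply: contraT => vi0.
have abs0 i : (`|v i|%N)%:R = 0 :> k.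
  have /eqP := h v kv i; rewrite {1}[v i]intEsign rmorphM /= mulf_eq0.
  by rewrite rmorph_sign signr_eq0 /= -pmulrn => /eqP.
(* A nonzero integer vanishes in k, so the characteristic is positive. *)
have [p pk] : exists p, p \in [pchar k].
  by apply: (@natf0_pchar k `|v i0|%N); rewrite ?lt0n ?absz_eq0 // abs0.
have p_pr := pcharf_prime pk.
have pv i : exists w, v i = p%:Z * w.
  have : (p %| `|v i|)%N by rewrite (dvdn_pcharf pk) abs0.
  by move=> /dvdnP[m hm]; exists (sgz (v i) * m%:Z); rewrite [LHS]intEsg hm PoszM mulrA mulrC.
have /all_sig[w hw] i := cid (pv i).
have p0 : p%:Z != 0 by rewrite eqz_nat -lt0n prime_gt0.
suff : w i0 = 0 by move=> w0; move: vi0; rewrite hw w0 mulr0 eqxx.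
apply: IHn => [|j]; last first.
  apply: (mulfI p0); rewrite mulr0 mulr_sumr -[RHS](kv j).
  by apply: eq_bigr => i _; rewrite hw mulrA.
apply: leq_trans vn; rewrite (bigD1 i0) //= [X in (_ < X)%N](bigD1 i0) //=.
rewrite -addSn leq_add //.
  rewrite hw abszM absz_nat ltn_Pmull ?prime_gt1 // lt0n absz_eq0.
  by apply: contraNneq vi0 => w0; rewrite hw w0 mulr0.
apply: leq_sum => i _; rewrite hw abszM absz_nat leq_pmull //; exact: prime_gt0.
Qed.

Theorem euler_form_criterion :
    (forall v, 0 <= qform v) -> (forall v, qform v = 0 -> kervec v) ->
  euler_nonneg iota /\
  (euler_pos iota <-> forall v, kervec v -> forall i, v i = 0).
Proof.
move=> q0 qker; split=> [x|]; first by rewrite euler_formE.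
split=> [pos|inj x nx].
  apply: kervec_descent => v kv; apply: K0proj_null.
  have [//|nn] := pselect (K0_null (K0proj v)).
  by have := pos _ nn; rewrite euler_form_proj kervec_qform ?ltxx.
rewrite lt_neqAle euler_formE q0 andbT eq_sym; apply: contra_notN nx => /eqP.
by move=> /qker/inj; apply: K0mu_null.
Qed.
End EulerForm.

(** * Algebras presented by quivers with relations *)

Section PathFunctionals.
Variables (k : fieldType) (Q : quiver).
Local Notation kQ := (pathalg k Q).

Lemma pa_ind (P : kQ -> Prop) : P 0 -> (forall x y, P x -> P y -> P (x + y)) ->
  (forall c i s, is_path i s -> P (c *: ppath k i s)) -> forall x, P x.
Proof.
move=> P0 PD Pp x; rewrite [x]pathalgE; elim/big_ind: _ => // p _.
by apply: Pp; apply: (valP p).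
Qed.

(** The coefficient of a path w in x, and 0 if w is not a path. *)
Definition pcoef (w : qvert Q * seq (qarr Q)) (x : kQ) : k :=
  if insub w is Some p then x@_(p : qpath Q) else 0.

Lemma pcoef_linear w : linear (pcoef w : kQ -> k^o).
Proof.
move=> c x y; rewrite /pcoef; case: insub => [p|]; last by rewrite scaler0 addr0.
by rewrite mcoeffD mcoeffZ.
Qed.

Lemma functional_rules (phi : kQ -> k) : linear (phi : kQ -> k^o) ->
  [/\ phi 0 = 0, forall x y, phi (x + y) = phi x + phi y &
      forall c x, phi (c *: x) = c * phi x].
Proof.
move=> lphi; have phi0 : phi 0 = 0.
  by have := lphi (- 1) 0 0; rewrite scaleN1r oppr0 addr0 scaleN1r addNr.
split=> // [x y|c x]; first by have := lphi 1 x y; rewrite !scale1r.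
by have := lphi c x 0; rewrite phi0 !addr0.
Qed.

Lemma functional_sum (phi : kQ -> k) (J : finType) (F : J -> kQ) :
  linear (phi : kQ -> k^o) -> phi (\sum_j F j) = \sum_j phi (F j).
Proof.
by move=> /functional_rules[phi0 phiD _]; apply: (big_morph phi phiD phi0).
Qed.

Lemma pcoef_path w i s : pcoef w (ppath k i s) = (is_path i s && (w == (i, s)))%:R.
Proof.
rewrite /pcoef /ppath.
case: (insubP (qpath Q) w) => [p _ pw|nw]; last first.
  by case: eqP => [wE|]; rewrite ?andbF //; move: nw; rewrite wE => /negPf /= ->.
case: insubP => [q _ qis|/negPf /= ->]; last by rewrite mcoeff0.
have -> : is_path i s by have := valP q; rewrite qis.
by rewrite mcoeffU -pw -qis (inj_eq val_inj) eq_sym.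
Qed.

(** The sum of the coefficients of x at the paths of a list. *)
Definition lcoef (W : seq (qvert Q * seq (qarr Q))) (x : kQ) : k :=
  \sum_(w <- W) pcoef w x.

Lemma lcoef_linear W : linear (lcoef W : kQ -> k^o).
Proof.
move=> c x y; rewrite /lcoef scaler_sumr -big_split /=; apply: eq_bigr => w _.
exact: pcoef_linear.
Qed.

Lemma lcoef_path W i s : uniq W ->
  lcoef W (ppath k i s) = (is_path i s && ((i, s) \in W))%:R.
Proof.
move=> uW; rewrite /lcoef; under eq_bigr do rewrite pcoef_path.
have [_|_] /= := boolP (is_path i s); last by rewrite big1.
have [iW|iW] := boolP ((i, s) \in W).
  by rewrite (bigD1_seq (i, s)) //= eqxx big1 ?addr0 // => w /negPf ->.
by rewrite big_seq big1 // => w wW; case: eqP => // wE; rewrite wE (negPf iW) in wW.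
Qed.

Lemma mulpE (i : qvert Q) s j t : ppath k i s * ppath k j t =
  if is_path i s && (plast i s == j) then ppath k i (s ++ t) else 0.
Proof. exact: pa_mul_ppath. Qed.

(** The coefficient of the trivial path at i; it is a morphism of algebras. *)
Definition triv_coef (i : qvert Q) : kQ -> k := @pcoef (i, [::]).

Lemma triv_coefM i x y : triv_coef i (x * y) = triv_coef i x * triv_coef i y.
Proof.
have [phi0 phiD phiZ] := functional_rules (@pcoef_linear (i, [::])).
rewrite /triv_coef; elim/pa_ind: x => [|x x' IHx IHx'|c i' s ps].
- by rewrite mul0r phi0 mul0r.
- by rewrite mulrDl [in RHS]phiD [in LHS]phiD [RHS]mulrDl; exact: (congr2 +%R IHx IHx').
rewrite -pathalg_scalerAl [in RHS]phiZ [in LHS]phiZ -[RHS]mulrA.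
congr (_ * _).
elim/pa_ind: y => [|y y' IHy IHy'|d j t pt].
- by rewrite mulr0 phi0 mulr0.
- by rewrite mulrDr [in RHS]phiD [in LHS]phiD [RHS]mulrDr; exact: (congr2 +%R IHy IHy').
rewrite -pathalg_scalerAr [in RHS]phiZ [in LHS]phiZ [RHS]mulrCA.
congr (_ * _).
rewrite mulpE ps /= !pcoef_path ps pt /=.
case: (plast i' s =P j) => [ij|ij]; last first.
  rewrite phi0; case: eqP => [[ii ss]|_]; last by rewrite mul0r.
  case: eqP => [[jj tt]|_]; last by rewrite mulr0.
  by case: ij; rewrite -ss -ii -jj.
rewrite pcoef_path is_path_cat ps ij pt /= -natrM mulnb; congr (_%:R); congr nat_of_bool.
rewrite -ij !xpair_eqE; case: s {ps ij} => [|a s] /=; last by rewrite !andbF.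
by rewrite /plast /=; case: (i =P i') => // <-; rewrite eqxx.
Qed.

Lemma triv_coef_one i : triv_coef i 1 = 1.
Proof.
rewrite /triv_coef [1]/(pa_one k Q) /pa_one.
rewrite (functional_sum _ (@pcoef_linear (i, [::]))) (bigD1 i) //=.
rewrite pcoef_path eqxx /= big1 ?addr0 // => j ji.
by rewrite pcoef_path xpair_eqE eq_sym (negPf ji).
Qed.
End PathFunctionals.

Section Presented.
Variables (k : fieldType) (Q : quiver) (R : pathalg k Q -> Prop).
Local Notation kQ := (pathalg k Q).
Local Notation B := (bqalg R).
Local Notation iota := (@bq_scal k Q R).
Local Notation pi := (@bq_pi k Q R).

(** All paths of sufficiently large length lie in the ideal of relations. *)
Definition long_paths_vanish : Prop :=
  exists N, forall i s, is_path i s -> (N <= size s)%N -> ppath k i s \in bq_ideal R.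

Hypothesis Radm : forall y i, R y -> triv_coef i y = 0.
Hypothesis Rlong : long_paths_vanish.

Lemma bq_pi0 : pi 0 = 0.
Proof. by apply: (addrI (pi 0)); rewrite -bq_piD !addr0. Qed.

Lemma bq_pi_eq0 x : pi x = 0 <-> x \in bq_ideal R.
Proof. by rewrite -bq_pi0 bq_piP subr0. Qed.

Lemma bq_pi_mul x y : pi x * pi y = pi (x * y).
Proof. exact: bq_piM. Qed.

Lemma bq_piZ c x : pi (c *: x) = iota c * pi x.
Proof. by rewrite /bq_scal bq_pi_mul -pathalg_scalerAl mul1r. Qed.

Lemma bq_pi_sum (J : finType) (F : J -> kQ) : pi (\sum_j F j) = \sum_j pi (F j).
Proof. exact: (big_morph pi (@bq_piD _ _ _) bq_pi0). Qed.

(** A functional vanishes on the ideal generated by R as soon as it vanishes on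
    the relations multiplied by paths on both sides. *)
Lemma ideal_vanish (phi : kQ -> k) : linear (phi : kQ -> k^o) ->
    (forall y i s j t, R y -> is_path i s -> is_path j t ->
       phi (ppath k i s * y * ppath k j t) = 0) ->
  forall x, x \in bq_ideal R -> phi x = 0.
Proof.
move=> /functional_rules[phi0 phiD phiZ] h x.
have D0 u v : phi u = 0 -> phi v = 0 -> phi (u + v) = 0.
  by move=> u0 v0; rewrite phiD u0 v0 addr0.
have Z0 c u : phi u = 0 -> phi (c *: u) = 0 by move=> u0; rewrite phiZ u0 mulr0.
move=> /asboolP/(_ (fun x => forall a b, phi (a * x * b) = 0)) H.
rewrite -[x]mul1r -[1 * x]mulr1; apply: H.
  split=> [a b|y z hy hz a b|a b y hy a' b'].
  - by rewrite mulr0 mul0r phi0.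
  - by rewrite mulrDr mulrDl; apply: (D0 _ _ (hy a b) (hz a b)).
  - rewrite (mulrA a' _ b) (mulrA a' a y) -(mulrA _ b b').
    exact: hy.
move=> y Ry a b.
elim/pa_ind: a => [|a a' ha ha'|c i s ps]; first by rewrite !mul0r phi0.
  by rewrite !mulrDl; apply: (D0 _ _ ha ha').
rewrite -!pathalg_scalerAl; apply: (Z0 c).
elim/pa_ind: b => [|b b' hb hb'|d j t pt]; first by rewrite mulr0 phi0.
  by rewrite mulrDr; apply: (D0 _ _ hb hb').
rewrite -pathalg_scalerAr; apply: (Z0 d); exact: h.
Qed.

Lemma triv_coef_ideal i x : x \in bq_ideal R -> triv_coef i x = 0.
Proof.
apply: ideal_vanish => [|y j s l t Ry _ _]; first exact: pcoef_linear.
by rewrite !triv_coefM (Radm _ Ry) mulr0 mul0r.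
Qed.

Section Character.
Variable i : qvert Q.
(** The character of B which reads the coefficient of the trivial path at i. *)
Definition bq_chi (b : B) : k := triv_coef i (repr b).

Lemma bq_chiE x : bq_chi (pi x) = triv_coef i x.
Proof.
have lc := @pcoef_linear k Q (i, [::]); have [_ phiD phiZ] := functional_rules lc.
rewrite /bq_chi; apply/eqP; rewrite -subr_eq0 -mulN1r /triv_coef -phiZ -phiD scaleN1r.
apply/eqP.
by apply: triv_coef_ideal; apply/bq_piP; rewrite bq_reprK.
Qed.

Lemma bq_chi_zmod : zmod_morphism bq_chi.
Proof.
have lc := @pcoef_linear k Q (i, [::]); have [_ phiD phiZ] := functional_rules lc.
move=> x y; rewrite -(bq_reprK x) -(bq_reprK y).
have -> : pi (repr x) - pi (repr y) = pi (repr x + (- 1) *: repr y).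
  by rewrite scaleN1r; apply: (addIr (pi (repr y))); rewrite -bq_piD !subrK.
by rewrite !bq_chiE /triv_coef phiD phiZ mulN1r.
Qed.

Lemma bq_chi_monoid : monoid_morphism bq_chi.
Proof.
split=> [|x y]; first by rewrite [1]/(pi 1) bq_chiE triv_coef_one.
by rewrite -(bq_reprK x) -(bq_reprK y) bq_pi_mul !bq_chiE triv_coefM.
Qed.

HB.instance Definition _ := GRing.isZmodMorphism.Build B k bq_chi bq_chi_zmod.
HB.instance Definition _ := GRing.isMonoidMorphism.Build B k bq_chi bq_chi_monoid.
Definition bq_char : {rmorphism B -> k} := bq_chi.
End Character.

(** The span of the classes of the paths of length at least m. *)
Inductive filt (m : nat) : B -> Prop :=
| Filt0 : filt m 0
| FiltD x y of filt m x & filt m y : filt m (x + y)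
| FiltP c i s of (m <= size s)%N & is_path i s : filt m (pi (c *: ppath k i s)).

Lemma filtM m n x y : filt m x -> filt n y -> filt (m + n) (x * y).
Proof.
elim=> [|x1 x2 _ IH1 _ IH2|c i s ms ps] hy; first by rewrite mul0r; constructor.
  by rewrite mulrDl; constructor; [apply: IH1|apply: IH2].
elim: hy => [|y1 y2 _ IH1 _ IH2|d j t nt pt]; first by rewrite mulr0; constructor.
  by rewrite mulrDr; constructor.
rewrite bq_pi_mul -pathalg_scalerAl -pathalg_scalerAr mulpE ps /=.
case: eqP => [ij|_]; last by rewrite !scaler0 bq_pi0; constructor.
rewrite scalerA; constructor; first by rewrite size_cat leq_add.
by rewrite is_path_cat ps ij pt.
Qed.

Lemma filt1 b : (forall i, bq_char i b = 0) -> filt 1 b.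
Proof.
rewrite -(bq_reprK b); move: (repr b) => x h.
have {}h i : triv_coef i x = 0 by rewrite -bq_chiE; apply: h.
rewrite {1}[x]pathalgE.
apply: (big_ind (fun y => filt 1 (pi y))) => [|y z hy hz|p _].
- by rewrite bq_pi0; constructor.
- by rewrite bq_piD; apply: FiltD.
have [s0|s1] := posnP (size (val p).2); last by apply: FiltP => //; apply: (valP p).
have -> : x@_p = 0; last by rewrite scale0r bq_pi0; constructor.
have := h (val p).1; rewrite /triv_coef /pcoef.
have -> : ((val p).1, [::]) = val p.
  by rewrite [RHS]surjective_pairing; move/size0nil: s0 => ->.
by rewrite valK.
Qed.

Lemma bq_scalC c b : iota c * b = b * iota c.
Proof.
by rewrite -(bq_reprK b) /bq_scal !bq_pi_mul -pathalg_scalerAl -pathalg_scalerAr mul1r mulr1.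
Qed.

Lemma bq_scal_mulCA c (x y : B) : iota c * (x * y) = x * (iota c * y).
Proof. by rewrite (mulrA (iota c)) bq_scalC -(mulrA x). Qed.

Lemma bq_finite : finite_over iota.
Proof.
have [N hN] := Rlong.
pose J : finType := (qvert Q * {bseq N of qarr Q})%type.
pose beta (j : J) : B := pi (ppath k j.1 j.2).
suff h b : exists c : J -> k, b = \sum_j iota (c j) * beta j.
  exists #|J|, (fun j => beta (enum_val j)) => b; have [c ->] := h b.
  exists (fun j => c (enum_val j)).
  by rewrite (big_enum_val (fun j => iota (c j) * beta j)).
rewrite -(bq_reprK b); elim/pa_ind: (repr b) => [|x y [c hc] [d hd]|c i s ps].
- exists (fun _ => 0); rewrite bq_pi0 big1 // => j _; by rewrite rmorph0 mul0r.
- exists (fun j => c j + d j); rewrite bq_piD hc hd -big_split /=.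
  by apply: eq_bigr => j _; rewrite rmorphD mulrDl.
have [lt|gt] := leqP (size s) N; last first.
  have s0 : pi (ppath k i s) = 0 by apply/bq_pi_eq0/hN => //; apply: ltnW.
  have -> : pi (c *: ppath k i s) = 0 by rewrite bq_piZ s0; exact: mulr0.
  by exists (fun _ => 0); rewrite big1 // => j _; rewrite rmorph0 mul0r.
exists (fun j => if j == (i, Bseq lt) then c else 0).
rewrite (bigD1 (i, Bseq lt)) //= eqxx big1 ?addr0 ?bq_piZ // => j /negPf ->.
by rewrite rmorph0 mul0r.
Qed.

Lemma presented_basic : basic_algebra iota (@bq_idem k Q R) bq_char.
Proof.
split.
- exact: bq_scalC.
- exact: bq_finite.
- by move=> i; rewrite /bq_idem bq_pi_mul mulpE /= /plast /= eqxx.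
- move=> i c; rewrite /= /bq_scal bq_chiE /triv_coef.
  have [_ _ phiZ] := functional_rules (@pcoef_linear k Q (i, [::])).
  by rewrite phiZ [X in _ * X](triv_coef_one k i) mulr1.
- move=> i j; rewrite /= /bq_idem bq_chiE /triv_coef pcoef_path /=.
  by rewrite xpair_eqE eqxx andbT.
- exists filt; split.
  + by constructor.
  + by move=> m x y hx hy; constructor.
  + exact: filtM.
  + exact: filt1.
  have [N hN] := Rlong; exists N => x.
  elim=> [//|y z _ -> _ ->|c i s ms ps]; first by rewrite addr0.
  by rewrite bq_piZ (_ : pi (ppath k i s) = 0) ?mulr0 //; apply/bq_pi_eq0/hN => //; apply: ltnW.
Qed.

(** Normal forms for the paths from i to j: each path is zero or equal to some
    w t modulo the ideal, and the functionals phi t, which vanish on the ideal,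
    are dual to the paths w t. *)
Lemma hom_dim_paths (i j : qvert Q) (T : finType) (w : T -> seq (qarr Q))
    (phi : T -> kQ -> k) :
    (forall t, is_path i (w t)) -> (forall t, plast i (w t) = j) ->
    (forall t, linear (phi t : kQ -> k^o)) ->
    (forall t x, x \in bq_ideal R -> phi t x = 0) ->
    (forall t u, phi t (ppath k i (w u)) = (t == u)%:R) ->
    (forall s, is_path i s -> plast i s = j -> ppath k i s \in bq_ideal R \/
       exists t, ppath k i s - ppath k i (w t) \in bq_ideal R) ->
  hom_dim iota (lproj (bq_idem R i)) (lproj (bq_idem R j)) = #|T|.
Proof.
move=> wp wl lphi phiI phiw norm.
have ee := basic_idem presented_basic.
pose M := lproj (bq_idem R i); pose N := lproj (bq_idem R j).
pose beta t : B := pi (ppath k i (w t)).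
have ebeta t : bq_idem R i * beta t = beta t.
  by rewrite /bq_idem bq_pi_mul mulpE /= /plast /= eqxx.
have betae t : beta t * bq_idem R j = beta t.
  by rewrite /bq_idem bq_pi_mul mulpE wp wl eqxx cats0.
have hS := linear_subspace bq_scalC M N.
have hT : @subspace k (M -> kres iota N) (fun f => forall x, f x = 0).
  by split=> [x|c f g hf hg x] //; rewrite !fctE hf hg scaler0 addr0.
pose b t : M -> kres iota N := fun x => mk_lproj (ee j) ((val x : B) * beta t).
have b_val t x : val (b t x : N) = (val x : B) * beta t :> B.
  by rewrite /b /= -mulrA betae.
pose x0 : M := mk_lproj (ee i) (bq_idem R i).
have x0E : val x0 = bq_idem R i :> B by rewrite /= ee.
have sum_val (c : T -> k) x : val ((\sum_t c t *: b t) x : N) =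
    (val x : B) * pi (\sum_t c t *: ppath k i (w t)) :> B.
  rewrite fct_sumE bq_pi_sum mulr_sumr.
  have valD : {morph (fun z : N => val z : B) : z z' / z + z' >-> z + z'} by [].
  have val0 : (val (0 : N) : B) = 0 by [].
  transitivity (\sum_t (val ((c t *: b t) x : N) : B)).
    exact: (big_morph _ valD val0).
  apply: eq_bigr => t _.
  change (iota (c t) * (val (b t x : N) : B) = (val x : B) * pi (c t *: ppath k i (w t))).
  exact: etrans (congr1 ( *%R (iota (c t))) (b_val t x))
    (etrans (bq_scal_mulCA _ _ _) (congr1 ( *%R (val x : B)) (esym (bq_piZ _ _)))).
apply: (kdim_uniq hS hT).
apply: (@qdim_fin k (M -> kres iota N) T b _ _ hS) => //.
- move=> t a x y; apply: val_inj; change ((a * (val x : B) + (val y : B)) * beta t * bq_idem R j =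
    a * ((val x : B) * beta t * bq_idem R j) + (val y : B) * beta t * bq_idem R j).
  by rewrite !mulrDl !mulrA.
- move=> c h u.
  have E : ppath k i [::] * (\sum_t c t *: ppath k i (w t)) =
      \sum_t c t *: ppath k i (w t).
    rewrite mulr_sumr; apply: eq_bigr => t _.
    by rewrite -pathalg_scalerAr mulpE /= {1}/plast /= eqxx.
  have h1 : (val x0 : B) * pi (\sum_t c t *: ppath k i (w t)) = 0 :=
    etrans (esym (sum_val c x0)) (congr1 (fun z : N => val z : B) (h x0)).
  have h2 : pi (ppath k i [::] * (\sum_t c t *: ppath k i (w t))) = 0 :=
    etrans (esym (bq_pi_mul _ _)) (etrans (congr1 ( *%R^~ _) (esym x0E)) h1).
  move: h2; rewrite E => /bq_pi_eq0/(phiI u).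
  have [phi0 phiD phiZ] := functional_rules (lphi u).
  have term t : phi u (c t *: ppath k i (w t)) = c t * (u == t)%:R :=
    etrans (phiZ _ _) (congr1 ( *%R (c t)) (phiw u t)).
  rewrite (functional_sum _ (lphi u)) (eq_bigr _ (fun t _ => term t)) (bigD1 u) //=.
  by rewrite eqxx mulr1 big1 ?addr0 // => t tu; rewrite eq_sym (negPf tu) mulr0.
- move=> f lf.
  have [x hx] : exists x, val (f x0 : N) = pi (ppath k i [::] * x * ppath k j [::]) :> B.
    have yj : (val (f x0 : N) : B) * bq_idem R j = val (f x0 : N) := lprojE _.
    have yi : bq_idem R i * (val (f x0 : N) : B) = val (f x0 : N).
      have [F eF] := linear_pack lf; subst f.
      have e0 : (bq_idem R i : B) *: x0 = x0 by apply: val_inj; rewrite /= -[_ *: _]/(_ * _) !ee.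
      exact: esym (congr1 (fun z : N => val z : B)
        (etrans (esym (congr1 F e0)) (linearZZ F (bq_idem R i : B) x0))).
    exists (repr (val (f x0 : N) : B)); set r := repr _.
    rewrite -(bq_pi_mul (ppath k i [::] * r) (ppath k j [::])).
    rewrite -(bq_pi_mul (ppath k i [::]) r) bq_reprK.
    exact: etrans (esym yj) (congr1 ( *%R^~ _) (esym yi)).
  have [c hc] : exists c : T -> k, pi (ppath k i [::] * x * ppath k j [::]) =
      pi (\sum_t c t *: ppath k i (w t)).
    elim/pa_ind: x {hx} => [|x y [c hc] [d hd]|c l s ps].
    + exists (fun _ => 0); rewrite mulr0 mul0r big1 // => t _; exact: scale0r.
    + exists (fun t => c t + d t); rewrite mulrDr mulrDl.
      apply: etrans (bq_piD _ _ _) (etrans (congr2 +%R hc hd) _).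
      apply: etrans (esym (bq_piD _ _ _)) (congr1 pi _).
      by rewrite -big_split; apply: eq_bigr => t _; rewrite scalerDl.
    have -> : ppath k i [::] * (c *: ppath k l s) * ppath k j [::] =
        c *: (if (i == l) && (plast l s == j) then ppath k l s else 0).
      rewrite -pathalg_scalerAr -pathalg_scalerAl mulpE /= {1}/plast /=; congr (_ *: _).
      case: eqP => [il|_] /=; last exact: mul0r.
      by subst l; rewrite mulpE ps /= cats0.
    have zero : exists c' : T -> k, pi 0 = pi (\sum_t c' t *: ppath k i (w t)).
      by exists (fun _ => 0); rewrite big1 // => t _; rewrite scale0r.
    case: ifP => [/andP[/eqP il /eqP sj]|_]; last by rewrite scaler0.
    subst l; have [/bq_pi_eq0 s0|[t /bq_piP st]] := norm s ps sj.
      have -> : pi (c *: ppath k i s) = pi 0.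
        apply: etrans (bq_piZ _ _) (etrans (congr1 ( *%R (iota c)) s0) _).
        exact: etrans (mulr0 _) (esym bq_pi0).
      exact: zero.
    exists (fun u => if u == t then c else 0).
    rewrite (bigD1 t) //= eqxx big1 ?addr0 => [|u /negPf ->]; last exact: scale0r.
    exact: etrans (bq_piZ _ _) (etrans (congr1 ( *%R (iota c)) st) (esym (bq_piZ _ _))).
  exists c => y; apply: val_inj.
  change ((val (f y : N) : B) - (val ((\sum_t c t *: b t) y : N) : B) = 0).
  apply/eqP; rewrite subr_eq0; apply/eqP.
  apply: etrans (esym (sum_val c y)).
  apply: etrans (congr1 ( *%R (val y : B)) (etrans hx hc)).
  have [F eF] := linear_pack lf; subst f.
  have e0 : (val y : B) *: x0 = y.
    apply: val_inj; change ((val y : B) * (bq_idem R i * bq_idem R i) = (val y : B)).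
    exact: etrans (congr1 ( *%R (val y : B)) (ee i)) (lprojE y).
  have e1 : F y = (val y : B) *: F x0 := etrans (esym (congr1 F e0)) (linearZZ F _ x0).
  have e2 := congr1 (fun z : N => val z : B) e1.
  exact: e2.
Qed.
End Presented.

(** * Non-singularity of the Cartan matrix *)

Section PresentedEuler.
Variables (k : fieldType) (P : bqpres k).
Local Notation Q := (bq_quiver P).
Local Notation R := (@bq_rel k P).
Hypothesis Radm : forall y i, R y -> triv_coef i y = 0.
Hypothesis Rlong : long_paths_vanish R.
Variable c : qvert Q -> qvert Q -> int.
Hypothesis cE : forall i j,
  (hom_dim (@bq_scal k Q R) (bq_proj i) (bq_proj j))%:Z = c i j.

(** The vectors of the left kernel of the matrix c. *)
Definition left_kernel (v : qvert Q -> int) : Prop := forall j, \sum_i v i * c i j = 0.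

Lemma cartan_nonsingularP :
  cartan_nonsingular P <-> forall v, left_kernel v -> forall i, v i = 0.
Proof.
rewrite /cartan_nonsingular; split=> [nz v kv i|inj].
  apply/eqP; apply: contraNT nz => vi; apply/det0P; exists (\row_j v (enum_val j)).
    apply: contraNneq vi => /rowP/(_ (enum_rank i)); rewrite !mxE enum_rankK => ->.
    by [].
  apply/rowP => j; rewrite !mxE -[RHS](kv (enum_val j)).
  rewrite (big_enum_val (fun i => v i * c i (enum_val j))) /=.
  by apply: eq_bigr => l _; rewrite !mxE cE.
apply/det0P => -[u /eqP u0 uC]; apply: u0; apply/rowP => j; rewrite mxE -[j]enum_valK.
apply: (inj (fun i => u 0 (enum_rank i))) => l.
have /rowP/(_ (enum_rank l)) := uC; rewrite !mxE => ul; rewrite -[RHS]ul.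
rewrite (big_enum_val (fun i => u 0 (enum_rank i) * c i l)) /=.
by apply: eq_bigr => i _; rewrite !mxE cE enum_rankK enum_valK.
Qed.

(** For a Cartan matrix whose quadratic form is non-negative and vanishes only on
    its kernel, positivity of the Euler form is non-singularity of the matrix. *)
Theorem presented_euler :
    (forall v, 0 <= \sum_i v i * \sum_j v j * c i j) ->
    (forall v, \sum_i v i * \sum_j v j * c i j = 0 -> left_kernel v) ->
  euler_form_nonneg P /\ (euler_form_pos P <-> cartan_nonsingular P) /\
  (cartan_nonsingular P <-> forall v, left_kernel v -> forall i, v i = 0).
Proof.
have cf i j : cform (@bq_scal k Q R) (@bq_idem k Q R) i j = c i j by apply: cE.
have qf v : qform (@bq_scal k Q R) (@bq_idem k Q R) v = \sum_i v i * \sum_j v j * c i j.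
  by apply: eq_bigr => i _; congr (_ * _); apply: eq_bigr => j _; rewrite cf.
have kf v : kervec (@bq_scal k Q R) (@bq_idem k Q R) v <-> left_kernel v.
  by split=> h j; rewrite -[RHS](h j); apply: eq_bigr => i _; rewrite cf.
move=> q0 qk.
have [||nn pos] := euler_form_criterion (presented_basic Radm Rlong).
- by move=> v; rewrite qf.
- by move=> v; rewrite qf => /qk/kf.
split=> //; split; last exact: cartan_nonsingularP.
apply: iff_trans pos (iff_trans _ (iff_sym cartan_nonsingularP)).
by split=> h v /kf; apply: h.
Qed.
End PresentedEuler.

(** * Paths around the vertices of a Brauer graph *)

Section OrbitPaths.
Variable G : brauer_graph.
Local Notation p := (hperm G).
Local Notation val_of h := (valency (hv (h : Defs.half G))).
Local Notation Q := (brauer_quiver G).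
Implicit Types (h g : Defs.half G) (a b : arrow G).

Lemma hv_perm h : hv (p h) = hv h.
Proof. by apply/eqP; rewrite -hperm_porbit (mem_porbit p 1). Qed.

Lemma hv_iter m h : hv (iter m p h) = hv h.
Proof. by elim: m => //= m IHm; rewrite hv_perm. Qed.

Lemma valencyE h : val_of h = #|porbit p h|.
Proof. by apply: eq_card => g; rewrite inE hperm_porbit. Qed.

Lemma valency_gt0 h : (0 < val_of h)%N.
Proof. by rewrite valencyE lt0n card_porbit_neq0. Qed.

Lemma iter_valency h : iter (val_of h) p h = h.
Proof. by rewrite valencyE iter_porbit. Qed.

(** The half-edges at a vertex form one orbit of the rotation. *)
Lemma same_vertex h g : hv h = hv g ->
  exists2 m, (m < val_of h)%N & g = iter m p h.
Proof.
move=> hg; have : g \in porbit p h by rewrite hperm_porbit hg.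
by rewrite porbit_traject -valencyE => /trajectP.
Qed.

Lemma iter_inj h m n : (m < val_of h)%N -> (n < val_of h)%N ->
  iter m p h = iter n p h -> m = n.
Proof.
move=> lm ln emn; have := uniq_traject_porbit p h; rewrite -valencyE => u.
apply/eqP; rewrite -(nth_uniq h _ _ u) ?size_traject //.
by rewrite !nth_traject // emn.
Qed.

Lemma val_of_iter m h : val_of (iter m p h) = val_of h.
Proof. by rewrite hv_iter. Qed.

(** The m consecutive arrows around a vertex which start with a_h.  The list is
    empty if the vertex of h has valency 1. *)
Definition orb h m : seq (arrow G) := pmap insub (traject p h m).

Lemma around_orb h : around h = orb h (val_of h). Proof. by []. Qed.

Lemma val_orb h m : (2 <= val_of h)%N -> map val (orb h m) = traject p h m.
Proof.
move=> h2; rewrite /orb (pmap_filter (insubK _)); apply/all_filterP/allP => g.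
by case/trajectP => i _ ->; rewrite isSome_insub /= val_of_iter.
Qed.

Lemma size_orb h m : (2 <= val_of h)%N -> size (orb h m) = m.
Proof. by move=> h2; rewrite -(size_map val) val_orb ?size_traject. Qed.

Lemma orbE h m (s : seq (arrow G)) : (2 <= val_of h)%N ->
  map val s = traject p h m -> s = orb h m.
Proof. by move=> h2 hs; apply: (inj_map val_inj); rewrite hs val_orb. Qed.

Lemma orb_cons h m (h2 : (2 <= val_of h)%N) :
  orb h m.+1 = exist _ h h2 :: orb (p h) m.
Proof.
by apply/esym/orbE => //=; rewrite val_orb // hv_perm.
Qed.

Lemma orbD h m n : (2 <= val_of h)%N -> orb h (m + n) = orb h m ++ orb (iter m p h) n.
Proof.
move=> h2; apply/esym/orbE => //.
by rewrite map_cat !val_orb ?val_of_iter // trajectD.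
Qed.

Lemma orb_inj h g m n : (2 <= val_of h)%N -> (2 <= val_of g)%N -> (0 < m)%N ->
  orb h m = orb g n -> h = g /\ m = n.
Proof.
move=> h2 g2 m0 e; have mn : m = n by rewrite -(size_orb m h2) e size_orb.
subst n; split=> //; have := congr1 (map val) e; rewrite !val_orb //.
by case: m m0 {e} => // m _ [].
Qed.

Lemma orb_path h m : (2 <= val_of h)%N -> @is_path Q (hedge h) (orb h m).
Proof.
elim: m h => [|m IHm] h h2 //; rewrite orb_cons /= eqxx.
by apply: IHm; rewrite hv_perm.
Qed.

Lemma orb_last h m : (2 <= val_of h)%N ->
  @plast Q (hedge h) (orb h m) = hedge (iter m p h).
Proof.
rewrite /plast; elim: m h => [|m IHm] h h2 //.
by rewrite orb_cons /= IHm ?hv_perm // -iterS iterSr.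
Qed.

Lemma hedge_eq h g : (hedge h == hedge g) = (h == g) || (h == hinv g).
Proof.
rewrite -val_eqE /=; apply/eqP/idP => [/setP/(_ h)|].
  by rewrite !inE eqxx /= => /esym.
case/orP => /eqP -> //; apply/setP => x; rewrite !inE hinvK; exact: orbC.
Qed.

(** A path which does not turn around a single vertex contains two successive
    arrows whose product is a relation. *)
Lemma path_orb_or (E : edge G) a (s : seq (arrow G)) : @is_path Q E (a :: s) ->
  a :: s = orb (val a) (size s).+1 \/
  exists s1 b c s2, a :: s = s1 ++ [:: b; c] ++ s2 /\ val c <> p (val b).
Proof.
elim: s E a => [|b s IHs] E a.
  by move=> _; left; apply: orbE => //; apply: (valP a).
move=> /= /andP[_ pbs]; case: (IHs _ b pbs) => [bs|[s1 [c [d [s2 [-> cd]]]]]]; last first.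
  by right; exists (a :: s1), c, d, s2.
have [ab|nab] := eqVneq (val b) (p (val a)); last first.
  by right; exists [::], a, b, s; split=> //; apply/eqP.
left; rewrite [RHS](orb_cons _ (valP a)) -ab -bs; congr (_ :: _); exact: val_inj.
Qed.

Lemma orb_consecutive h m s1 b c s2 : (2 <= val_of h)%N ->
  s1 ++ [:: b; c] ++ s2 = orb h m -> val c = p (val b).
Proof.
move=> h2 e; have et := congr1 (map val) e; rewrite val_orb // !map_cat /= in et.
have sz : (size s1 + (size s2).+2 = m)%N.
  by rewrite -(size_orb m h2) -e !size_cat.
have lt1 : ((size s1).+1 < m)%N by rewrite -sz !addnS !ltnS leq_addr.
have := nth_traject p lt1 h; rewrite -et nth_cat size_map ltnNge leqnSn /=.
rewrite subSnn /= => ->; congr (p _).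
have := nth_traject p (ltnW lt1) h; rewrite -et nth_cat size_map ltnn subnn /=.
by move->.
Qed.

(** A path around a vertex contains a full cycle C_h only if it is long enough,
    and a full cycle contains no other full cycle. *)
Lemma orb_contains_around h g m s t : (2 <= val_of h)%N -> (2 <= val_of g)%N ->
  s ++ around h ++ t = orb g m ->
  (val_of g + (size s + size t) = m)%N /\ (m = val_of g -> [/\ s = [::], t = [::] & h = g]).
Proof.
move=> h2 g2 e; have et := congr1 (map val) e.
rewrite val_orb // !map_cat around_orb val_orb // in et.
have hin : h \in traject p g m.
  rewrite -et !mem_cat; apply/orP; right; apply/orP; left.
  by apply/trajectP; exists 0%N; rewrite ?valency_gt0.
have vv : val_of h = val_of g by have /trajectP[i _ ->] := hin; rewrite val_of_iter.
have sz : (val_of g + (size s + size t) = m)%N.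
  by rewrite -(size_orb m g2) -e !size_cat around_orb size_orb // vv addnCA.
split=> // mg; move/eqP: sz; rewrite mg -[X in _ == X]addn0 eqn_add2l addn_eq0.
move=> /andP[/eqP/size0nil s0 /eqP/size0nil t0]; split=> //.
move: et; rewrite s0 t0 cats0 mg vv /=; have := valency_gt0 g.
by case: (val_of g) => // n _ [].
Qed.

Lemma size_around h : (2 <= val_of h)%N -> size (around h) = val_of h.
Proof. exact: size_orb. Qed.

End OrbitPaths.

(** * The ideal of a Brauer graph algebra *)

Section PathProducts.
Variables (k : fieldType) (Q : quiver) (R : pathalg k Q -> Prop).

Lemma mulp3 (i : qvert Q) s l m j t : ppath k i s * ppath k l m * ppath k j t =
  if [&& is_path i s, plast i s == l, is_path l m & plast l m == j]
  then ppath k i (s ++ m ++ t) else 0.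
Proof.
rewrite mulpE; case: (boolP (is_path i s)) => [ps|_] /=; last exact: mul0r.
case: eqP => [il|_] /=; last exact: mul0r.
by rewrite mulpE is_path_cat ps il plast_cat il /= catA; case: is_path.
Qed.

(** A functional which takes the same values at a x b and a y b kills
    a (x - y) b. *)
Lemma functional_diff (phi : pathalg k Q -> k) a x y b :
  linear (phi : pathalg k Q -> k^o) -> phi (a * x * b) = phi (a * y * b) ->
  phi (a * (x - y) * b) = 0.
Proof.
move=> /functional_rules[_ phiD phiZ] e.
have -> : a * (x - y) * b = a * x * b + (- 1) *: (a * y * b).
  by rewrite scaleN1r mulrBr mulrBl.
apply: etrans (phiD _ _) (etrans (congr2 +%R e (phiZ _ _)) _).
by rewrite mulN1r subrr.
Qed.

Lemma rel_ideal y : R y -> y \in bq_ideal R.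
Proof. by move=> Ry; apply/asboolP => J _ RJ; apply: RJ. Qed.

Lemma factor_ideal (i : qvert Q) s m t : is_path i (s ++ m ++ t) ->
  ppath k (plast i s) m \in bq_ideal R -> ppath k i (s ++ m ++ t) \in bq_ideal R.
Proof.
move=> pt hm; have := pt; rewrite !is_path_cat => /and3P[ps pm ptt].
have := bq_idealM (ppath k i s) (ppath k (plast (plast i s) m) t) hm.
by rewrite mulp3 ps pm !eqxx.
Qed.
End PathProducts.

Section Brauer.
Variables (k : fieldType) (G : brauer_graph).
Local Notation p := (hperm G).
Local Notation val_of h := (valency (hv (h : Defs.half G))).
Local Notation Q := (brauer_quiver G).
Local Notation R := (@brauer_rel G k).

Implicit Types (h g : Defs.half G) (E F : edge G).

Lemma hedge_inv h : hedge (hinv h) = hedge h.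
Proof. by apply/eqP; rewrite hedge_eq eqxx orbT. Qed.

Lemma edge_rep E : exists h, E = hedge h.
Proof.
have /imsetP[h _ hE] := valP E; exists h; exact: val_inj.
Qed.

Lemma around_last h : (2 <= val_of h)%N -> @plast Q (hedge h) (around h) = hedge h.
Proof. by move=> h2; rewrite around_orb orb_last // iter_valency. Qed.

Lemma around_path h : (2 <= val_of h)%N -> @is_path Q (hedge h) (around h).
Proof. exact: orb_path. Qed.

Lemma brauer_triv y (E : qvert Q) : R y -> triv_coef E y = 0.
Proof.
have [phi0 phiD phiZ] := functional_rules (@pcoef_linear k Q (E, [::])).
rewrite /triv_coef; case=> [h h2 h2'|a|a b _ _].
- rewrite -scaleN1r phiD phiZ !pcoef_path !xpair_eqE.
  have nz g : (2 <= val_of g)%N -> ([::] == around g) = false.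
    by move=> g2; apply/negbTE; rewrite eq_sym -size_eq0 size_around // -lt0n valency_gt0.
  by rewrite !nz // !andbF mulr0 addr0.
- by rewrite pcoef_path xpair_eqE; case: (around _) => [|c s]; rewrite !andbF.
- by rewrite pcoef_path xpair_eqE !andbF.
Qed.

Lemma nonconsecutive_ideal (E : qvert Q) s (a b : arrow G) t :
  @is_path Q E (s ++ [:: a; b] ++ t) -> val b <> p (val a) ->
  ppath k E (s ++ [:: a; b] ++ t) \in bq_ideal R.
Proof.
move=> pt ab; apply: factor_ideal => //; apply: rel_ideal.
move: pt; rewrite is_path_cat /= => /and4P[_ /eqP sa /eqP ba _].
by rewrite -sa; apply: BrauerZero => //; rewrite -ba.
Qed.

(** A path around a vertex which is longer than the full cycle starts with C_h
    followed by a_h. *)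
Lemma long_orb_ideal h m : (2 <= val_of h)%N -> (val_of h < m)%N ->
  @ppath k Q (hedge h) (orb h m) \in bq_ideal R.
Proof.
move=> h2 lm; pose a : arrow G := exist _ h h2.
have -> : orb h m = [::] ++ rcons (around h) a ++ orb (p h) (m - (val_of h).+1).
  rewrite -{1}(subnKC lm) addSn -addnS orbD // iter_valency orb_cons // cat_rcons.
  by rewrite around_orb; congr (_ ++ exist _ _ _ :: _); apply: bool_irrelevance.
apply: factor_ideal; last exact/rel_ideal/(BrauerOver k a).
rewrite cat0s cat_rcons is_path_cat around_path //= -[plast _ _]/(@plast Q (hedge h) (around h)).
rewrite around_last // eqxx /=; apply: orb_path; by rewrite hv_perm.
Qed.

Lemma brauer_long : long_paths_vanish R.
Proof.
(* A path longer than all valencies is not around one vertex, or winds too often. *)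
pose N := (\max_(h : Defs.half G) val_of h).+1.
exists N => E [|a s] // ps.
case: (path_orb_or ps) => [->|[s1 [b [c [s2 [e bc]]]]]]; last first.
  by move=> _; move: ps; rewrite e => ps; apply: nonconsecutive_ideal.
rewrite size_orb ?(valP a) // => Ns.
have -> : E = hedge (val a) by have /andP[/eqP <- _] := ps.
apply: long_orb_ideal; first exact: (valP a).
exact: leq_ltn_trans (leq_bigmax (F := fun h => val_of h) (val a)) Ns.
Qed.

(** Let W be a list of paths which go at most once around a vertex, and suppose
    that W contains s C_(iota h) t whenever it contains s C_h t: then the sum of
    the coefficients along W vanishes on the ideal. *)
Lemma lcoef_kills (W : seq (qvert Q * seq (arrow G))) : uniq W ->
    (forall (E : qvert Q) s, (E, s) \in W -> s = [::] \/ exists h m,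
       [/\ (2 <= val_of h)%N, (m <= val_of h)%N & s = orb h m]) ->
    (forall (E : qvert Q) s h t, (2 <= val_of h)%N -> (2 <= val_of (hinv h))%N ->
       @plast Q E s = hedge h ->
       (E, s ++ around h ++ t) \in W -> (E, s ++ around (hinv h) ++ t) \in W) ->
  forall x, x \in bq_ideal R -> @lcoef k Q W x = 0.
Proof.
move=> uW orbW commW; apply: ideal_vanish; first exact: lcoef_linear.
have [phi0 phiD phiZ] := functional_rules (@lcoef_linear k Q W).
move=> y E s F t Ry ps pt.
have side h g m s1 t1 : (2 <= val_of h)%N -> (2 <= val_of g)%N -> (m <= val_of g)%N ->
    s1 ++ around h ++ t1 = orb g m -> m = val_of g.
  move=> h2 g2 mg /(orb_contains_around h2 g2)[me _].
  by apply/eqP; rewrite eqn_leq mg -me leq_addr.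
case: Ry => [h h2 h2'|a|a b ab bp].
- apply: functional_diff; first exact: lcoef_linear.
  apply: etrans (congr1 _ (mulp3 _ _ _ _ _ _ _)) (etrans _ (congr1 _ (esym (mulp3 _ _ _ _ _ _ _)))).
  rewrite hedge_inv.
  have pl' : @plast Q (hedge h) (around (hinv h)) = hedge h.
    by rewrite -(hedge_inv h) around_last.
  have ph' : @is_path Q (hedge h) (around (hinv h)).
    by rewrite -(hedge_inv h) around_path.
  rewrite pl' ph' around_last // around_path // ps /=.
  case: eqP => [sh|_] //=; case: eqP => [hF|_] //.
  rewrite !lcoef_path // !is_path_cat ps sh ph' around_path //.
  rewrite pl' around_last // hF pt /=; congr (nat_of_bool _)%:R.
  apply/idP/idP; first by apply: commW.
  by move=> inW; rewrite -[h]hinvK; apply: commW => //; rewrite ?hinvK ?hedge_inv.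
- rewrite mulp3; case: ifP => _ //; rewrite lcoef_path //.
  case: (boolP (_ \in W)) => [inW|_]; last by rewrite andbF.
  case: (orbW _ _ inW) => [/(congr1 size)|[g [m [g2 mg]]]].
    by rewrite !size_cat size_rcons addSn addnS.
  rewrite cat_rcons => e; have mE := side _ _ _ _ _ (valP a) g2 mg e.
  by have [_ /(_ mE)[]] := orb_contains_around (valP a) g2 e.
- rewrite mulp3; case: ifP => _ //; rewrite lcoef_path //.
  case: (boolP (_ \in W)) => [inW|_]; last by rewrite andbF.
  case: (orbW _ _ inW) => [/(congr1 size)|[g [m [g2 mg]]]].
    by rewrite !size_cat addnS.
  by move=> /(orb_consecutive g2).
Qed.
End Brauer.

(** * Normal forms of paths and the entries of the Cartan matrix *)

Section NormalForms.
Variables (k : fieldType) (G : brauer_graph).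
Local Notation p := (hperm G).
Local Notation val_of h := (valency (hv (h : Defs.half G))).
Local Notation Q := (brauer_quiver G).
Local Notation R := (@brauer_rel G k).
Hypothesis big_side : forall h : Defs.half G, (2 <= val_of h)%N || (2 <= val_of (hinv h))%N.

Implicit Types (h g : Defs.half G) (E F : edge G).

(** A chosen half-edge of the edge E. *)
Definition rep E : Defs.half G := sval (cid (edge_rep E)).

Lemma repE E : hedge (rep E) = E.
Proof. by rewrite /rep; case: cid. Qed.

(** A half-edge of E at a vertex of valency at least 2, for which C_h is
    defined. *)
Definition soc E : Defs.half G :=
  if (2 <= val_of (rep E))%N then rep E else hinv (rep E).

Lemma soc_big E : (2 <= val_of (soc E))%N.
Proof. by rewrite /soc; case: ifP => // n2; have := big_side (rep E); rewrite n2. Qed.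

Lemma soc_edge E : hedge (soc E) = E.
Proof. by rewrite /soc; case: ifP; rewrite ?hedge_inv repE. Qed.

(** The pairs of half-edges of E and F at a common vertex. *)
Definition corner E F : pred (Defs.half G * Defs.half G) :=
  fun x => [&& hedge x.1 == E, hedge x.2 == F & hv x.1 == hv x.2].

(** The number of rotation steps from h to g around their common vertex. *)
Definition dist h g : nat := index g (traject p h (val_of h)).

Lemma distP h g : hv h = hv g -> (dist h g < val_of h)%N /\ iter (dist h g) p h = g.
Proof.
move=> hg; have gt : g \in traject p h (val_of h).
  by have [m lm ->] := same_vertex hg; apply/trajectP; exists m.
have lt : (dist h g < val_of h)%N by rewrite -[X in (_ < X)%N](size_traject p h) index_mem.
by split=> //; rewrite -(nth_traject p lt) nth_index.
Qed.

Lemma dist_gt0 h g : hv h = hv g -> h != g -> (0 < dist h g)%N.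
Proof.
by move=> /distP[_ e]; apply: contraNT; rewrite -leqNgt leqn0 => /eqP d0; rewrite -e d0.
Qed.

Lemma dist_big h g : hv h = hv g -> h != g -> (2 <= val_of h)%N.
Proof.
by move=> hg ne; have [lt _] := distP hg; apply: leq_ltn_trans lt; apply: dist_gt0.
Qed.

(** The path from E to F attached to a pair (h, g): for h <> g the path from h
    to g around their vertex, and for the two pairs (h, h) with h in E the
    trivial path at E and the socle element C_h. *)
Definition nform E (x : Defs.half G * Defs.half G) : seq (arrow G) :=
  if x.1 != x.2 then orb x.1 (dist x.1 x.2)
  else if x.1 == rep E then [::] else orb (soc E) (val_of (soc E)).

(** The full cycles C_h and C_(iota h) at E, as far as they are defined. *)
Definition socle_list E : seq (qvert Q * seq (arrow G)) :=
  [seq (E, around g) | g <- [:: rep E; hinv (rep E)] & (2 <= val_of g)%N].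

(** The list of paths whose coefficients add up to the functional dual to a
    normal form. *)
Definition nlist E (x : Defs.half G * Defs.half G) : seq (qvert Q * seq (arrow G)) :=
  if (x.1 == x.2) && (x.1 != rep E) then socle_list E else [:: (E, nform E x)].

Section Pair.
Variables E F : edge G.
Local Notation T := {x | corner E F x}.

Lemma nlist_socle s : (E, s) \in socle_list E ->
  exists2 g, (2 <= val_of g)%N /\ hedge g = E & s = around g.
Proof.
case/mapP => g; rewrite mem_filter !inE => /andP[g2 gE] [->]; exists g => //; split=> //.
by case/orP: gE => /eqP ->; rewrite ?hedge_inv repE.
Qed.

Lemma socle_nlist g : (2 <= val_of g)%N -> hedge g = E ->
  (E, around g) \in socle_list E.
Proof.
move=> g2 gE; apply/mapP; exists g => //; rewrite mem_filter g2 /= !inE.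
by rewrite -hedge_eq gE repE eqxx.
Qed.

Lemma corner_diag (x : T) : (val x).1 = (val x).2 -> F = E.
Proof. by case: x => [[h g] /= /and3P[/eqP hE /eqP gF _]] /= hg; rewrite -gF -hg hE. Qed.

Lemma nform_path (x : T) : @is_path Q E (nform E (val x)).
Proof.
case: x => [[h g] /= /and3P[/eqP hE _ /eqP hg]]; rewrite /nform /=.
case: eqP => /= [_|/eqP ne].
  by case: ifP => // _; rewrite -{1}(soc_edge E) orb_path // soc_big.
by rewrite -hE orb_path // (dist_big hg ne).
Qed.

Lemma nform_last (x : T) : @plast Q E (nform E (val x)) = F.
Proof.
have := @corner_diag x; case: x => [[h g] /= /and3P[/eqP hE /eqP gF /eqP hg]] /= diag.
rewrite /nform /=; case: eqP => /= [e|/eqP ne].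
  rewrite (diag e); case: ifP => // _; rewrite -{1}(soc_edge E) orb_last ?soc_big //.
  by rewrite iter_valency soc_edge.
by rewrite -hE orb_last ?(dist_big hg ne) // (proj2 (distP hg)).
Qed.

(** The functionals are dual to the normal forms. *)
Lemma nform_mem (x y : T) : ((E, nform E (val y)) \in nlist E (val x)) = (x == y).
Proof.
apply/idP/eqP => [|<-]; last first.
  rewrite /nlist; case: ifP => [e|_]; last by rewrite inE.
  have /andP[xd /negPf xr] := e; rewrite /nform xd xr /=.
  by apply: socle_nlist; [exact: soc_big|exact: soc_edge].
have diagE (z : T) : (val z).1 = (val z).2 -> (val z).1 != rep E -> (val z).1 = hinv (rep E).
  case: z => [[h g] /= /and3P[/eqP hE _ _]] _ /negPf hr.
  by have := hedge_eq h (rep E); rewrite hE repE eqxx hr => /esym/eqP.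
have diag_eq (z w : T) : (val z).1 = (val z).2 -> (val w).1 = (val w).2 ->
    ((val z).1 == rep E) = ((val w).1 == rep E) -> z = w.
  move=> dz dw; case: (boolP ((val z).1 == rep E)) => [/eqP zr|zr].
    move/esym/eqP => wr; apply: val_inj.
    by rewrite [LHS]surjective_pairing [RHS]surjective_pairing -dz -dw zr wr.
  move/esym/negbT => wr; apply: val_inj.
  rewrite [LHS]surjective_pairing [RHS]surjective_pairing -dz -dw.
  by rewrite (diagE z) // (diagE w).
(* Normal forms of the three kinds have lengths 0, less than the valency, and
   equal to the valency. *)
have off (z : T) : (val z).1 != (val z).2 ->
    [/\ (2 <= val_of (val z).1)%N, (0 < dist (val z).1 (val z).2)%N,
        (dist (val z).1 (val z).2 < val_of (val z).1)%N &
        nform E (val z) = orb (val z).1 (dist (val z).1 (val z).2)].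
  case: z => [[h g] /= /and3P[_ _ /eqP hg]] ne; rewrite /nform /= ne.
  by split=> //; [apply: dist_big hg ne|apply: dist_gt0|case: (distP hg)].
have not_around (z : T) g : (val z).1 != (val z).2 -> (2 <= val_of g)%N ->
    nform E (val z) <> around g.
  move=> /off[z2 d0 dlt ->] g2 e; have [hg dn] := orb_inj z2 g2 d0 e.
  by rewrite dn hg ltnn in dlt.
have around_nil g : (2 <= val_of g)%N -> around g <> [::].
  by move=> g2 /(congr1 size); rewrite size_around //= => e; rewrite e in g2.
rewrite /nlist; have [xd|xd] /= := eqVneq (val x).1 (val x).2.
  have [xr|xr] /= := eqVneq (val x).1 (rep E).
    rewrite inE => /eqP[]; rewrite {2}/nform xd eqxx -xd xr eqxx /=.
    have [yd|yd] := eqVneq (val y).1 (val y).2.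
      rewrite /nform yd eqxx /= -yd; case: ifP => yr ny.
        by apply: diag_eq; rewrite // xr eqxx yr.
      by case: (around_nil _ (soc_big E)).
    have [y2 d0 _ ->] := off y yd => /(congr1 size); rewrite size_orb //=.
    by move=> d; rewrite d in d0.
  move=> /nlist_socle[g [g2 _]] yg.
  have [yd|yd] := eqVneq (val y).1 (val y).2; last by case: (not_around y g).
  apply: diag_eq => //; rewrite (negPf xr); case: eqP => // yr.
  by move: yg; rewrite /nform yd eqxx -yd yr eqxx => /esym/around_nil; case.
rewrite inE => /eqP[]; have [x2 d0 dlt xf] := off x xd.
have [yd|yd] := eqVneq (val y).1 (val y).2.
  rewrite {1}/nform yd eqxx -yd /=; case: ifP => _ e.
    have := congr1 size e; rewrite xf size_orb //= => d; by rewrite -d in d0.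
  by case: (not_around x (soc E)); rewrite ?soc_big.
have [y2 d0' dlt' ->] := off y yd; rewrite xf => e.
have [e1 e2] := orb_inj y2 x2 d0' e; apply: val_inj.
rewrite [LHS]surjective_pairing [RHS]surjective_pairing -e1; congr pair.
case: x y {xd yd off not_around diagE diag_eq x2 xf d0 dlt d0' dlt' y2} e e1 e2 =>
  [[h g] /= /and3P[_ _ /eqP hg]] [[h' g'] /= /and3P[_ _ /eqP hg']] /=.
have {}hg : hv h = hv g := hg; have {}hg' : hv h' = hv g' := hg'.
move=> _ hh dd; have [_ e1] := distP hg; have [_ e2] := distP hg'.
by rewrite -e1 -e2 dd hh.
Qed.

Lemma nlist_uniq x : uniq (nlist E x).
Proof.
rewrite /nlist; case: ifP => // _; rewrite map_inj_in_uniq; last first.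
  move=> g h; rewrite !mem_filter => /andP[g2 _] /andP[h2 _] [e].
  by have [] := orb_inj g2 h2 (valency_gt0 g) e.
by apply: filter_uniq; rewrite /= inE eq_sym hinv_neq.
Qed.

Lemma nlist_kills (x : T) y : y \in bq_ideal R -> @lcoef k Q (nlist E (val x)) y = 0.
Proof.
apply: lcoef_kills (nlist_uniq _) _ _ _.
  move=> E' s; rewrite /nlist; case: ifP => [_|].
    case/mapP => g; rewrite mem_filter => /andP[g2 _] [_ ->]; right.
    by exists g, (val_of g).
  case: x => [[h g] /= /and3P[_ _ /eqP hg]]; rewrite /nform /=.
  have [hge|ne] /= := eqVneq h g.
    by move=> /negbFE ->; rewrite inE => /eqP[_ ->]; left.
  move=> _; rewrite inE => /eqP[_ ->]; right; exists h, (dist h g).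
  by rewrite (dist_big hg ne) (ltnW (proj1 (distP hg))).
move=> E' s h t h2 h2' sh.
have inv_in g s' t' : (2 <= val_of g)%N -> s' ++ around h ++ t' = around g ->
    [/\ s' = [::], t' = [::] & h = g].
  by move=> g2 e; have [_ /(_ erefl)] := orb_contains_around h2 g2 e.
rewrite /nlist; case: ifP => [_|].
  case/mapP => g; rewrite mem_filter !inE => /andP[g2 gE] [EE' e].
  have [s0 t0 hg] := inv_in g s t g2 e; subst s t g E'; rewrite cats0 /=.
  apply: socle_nlist => //; rewrite hedge_inv.
  by case/orP: gE => /eqP ->; rewrite ?hedge_inv repE.
case: x => [[f g] /= /and3P[_ _ /eqP fg]]; rewrite /nform /=.
have [fge|ne] /= := eqVneq f g.
  move=> /negbFE ->; rewrite inE => /eqP[_ /(congr1 size)].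
  rewrite !size_cat size_around // => /eqP; rewrite !addn_eq0 andbCA.
  by move=> /andP[/eqP h0]; rewrite h0 in h2.
move=> _; rewrite inE => /eqP[_ e]; have f2 := dist_big fg ne.
have [dE _] := orb_contains_around h2 f2 e; have [lt _] := distP fg.
by rewrite -dE ltnNge leq_addr in lt.
Qed.

(** Every path from E to F lies in the ideal or is congruent to a normal form. *)
Lemma nform_complete s : @is_path Q E s -> @plast Q E s = F ->
  @ppath k Q E s \in bq_ideal R \/
  exists x : T, @ppath k Q E s - @ppath k Q E (nform E (val x)) \in bq_ideal R.
Proof.
have sub0 y : y - y \in bq_ideal R by rewrite subrr; apply: rpred0.
case: s => [|a s] ps.
  rewrite /plast /= => EF; right.
  have cx : corner E F (rep E, rep E) by rewrite /corner /= repE -EF !eqxx.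
  by exists (exist (fun x => corner E F x) _ cx); rewrite /nform /= !eqxx.
case: (path_orb_or ps) => [ae|[s1 [b [c [s2 [e bc]]]]]]; last first.
  by move=> _; left; move: ps; rewrite e => ps; apply: nonconsecutive_ideal.
have aE : E = hedge (val a) by have /andP[/eqP <- _] := ps.
have a2 := valP a; set h := val a in ae aE; move: ae; set m := (size s).+1 => ae.
rewrite ae [in plast _ _]aE orb_last // => lF.
have [mgt|mle] := ltnP (val_of h) m; first by left; rewrite aE; apply: long_orb_ideal.
right; move: mle; rewrite leq_eqVlt => /orP[/eqP mE|mlt].
  have FE : F = E by rewrite -lF mE iter_valency aE.
  have cx : corner E F (hinv (rep E), hinv (rep E)).
    by rewrite /corner /= !hedge_inv repE FE !eqxx.
  exists (exist (fun x => corner E F x) _ cx); rewrite /nform /= eqxx (negPf (hinv_neq _)) /=.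
  have [hs|hs] := eqVneq h (soc E); first by rewrite mE -hs.
  have hsi : h = hinv (soc E).
    by have := hedge_eq h (soc E); rewrite -aE soc_edge eqxx (negPf hs) => /esym/eqP.
  have hh : hinv h = soc E by rewrite hsi hinvK.
  have h2 : (2 <= val_of (hinv h))%N by rewrite hh soc_big.
  have := BrauerComm k a2 h2; rewrite /bpath -/h hh soc_edge -aE mE.
  exact: (@rel_ideal k Q R).
have ne : h != iter m p h.
  apply/eqP => /(@iter_inj _ h 0 m (valency_gt0 h) mlt) /eqP; by [].
have hvE : hv h = hv (iter m p h) by rewrite hv_iter.
have cx : corner E F (h, iter m p h) by rewrite /corner /= -aE lF hvE !eqxx.
exists (exist (fun x => corner E F x) _ cx); rewrite /nform /= ne.
have -> : dist h (iter m p h) = m; last exact: sub0.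
by have [lt e] := distP hvE; apply: (iter_inj lt mlt e).
Qed.

Lemma brauer_hom_dim :
  hom_dim (@bq_scal k Q R) (lproj (bq_idem R (E : qvert Q))) (lproj (bq_idem R (F : qvert Q)))
    = #|[pred x | corner E F x]|.
Proof.
rewrite -card_sig.
apply: (@hom_dim_paths k Q R (@brauer_triv k G) (brauer_long k G) E F
  {x | corner E F x} (fun x => nform E (val x)) (fun x => @lcoef k Q (nlist E (val x)))).
- exact: nform_path.
- exact: nform_last.
- by move=> x; apply: lcoef_linear.
- exact: nlist_kills.
- move=> x y; rewrite lcoef_path ?nlist_uniq // nform_path /=.
  by rewrite nform_mem.
- exact: nform_complete.
Qed.
End Pair.
End NormalForms.

(** * The Cartan matrix as a Gram matrix *)

Section GramMatrix.
Variable G : brauer_graph.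

(** The value at the vertex x of the unsigned incidence matrix applied to v. *)
Definition incid (v : edge G -> int) (x : vert G) : int :=
  \sum_(h : Defs.half G | hv h == x) v (hedge h).

(** The number of pairs of half-edges of E and F at a common vertex. *)
Definition gram (E F : edge G) : int := #|[pred x | corner E F x]|%:Z.

Lemma gramE E F : gram E F =
  \sum_(h : Defs.half G | hedge h == E) \sum_(g : Defs.half G | hedge g == F) (hv h == hv g)%:R.
Proof.
rewrite /gram -sum1_card pair_big_dep /= big_mkcond [RHS]big_mkcond.
rewrite (big_morph Posz PoszD (erefl 0)).
apply: eq_bigr => -[h g] _ /=; rewrite inE /corner /=.
by case: (_ == E); case: (_ == F); case: (_ == _).
Qed.

Lemma gram_row v F : \sum_E v E * gram E F =
  \sum_(g : Defs.half G | hedge g == F) incid v (hv g).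
Proof.
transitivity (\sum_E \sum_(h : Defs.half G | hedge h == E)
    \sum_(g : Defs.half G | hedge g == F) v (hedge h) * (hv h == hv g)%:R).
  apply: eq_bigr => E _; rewrite gramE mulr_sumr; apply: eq_bigr => h /eqP <-.
  by rewrite mulr_sumr.
transitivity (\sum_(h : Defs.half G)
    \sum_(g : Defs.half G | hedge g == F) v (hedge h) * (hv h == hv g)%:R).
  by rewrite [RHS](partition_big (@hedge G) xpredT).
rewrite exchange_big /=; apply: eq_bigr => g _; rewrite /incid [RHS]big_mkcond.
apply: eq_bigr => h _; by case: eqP; rewrite ?mulr1 ?mulr0.
Qed.

Lemma incid_gram v w : \sum_F w F * \sum_E v E * gram E F = \sum_x incid v x * incid w x.
Proof.
transitivity (\sum_F \sum_(g : Defs.half G | hedge g == F) w (hedge g) * incid v (hv g)).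
  apply: eq_bigr => F _; rewrite gram_row mulr_sumr.
  by apply: eq_bigr => g /eqP <-.
transitivity (\sum_(g : Defs.half G) w (hedge g) * incid v (hv g)).
  by rewrite [RHS](partition_big (@hedge G) xpredT).
rewrite (partition_big (@hv G) xpredT) //=.
apply: eq_bigr => x _; rewrite /incid mulr_sumr; apply: eq_bigr => g /eqP <-.
by rewrite mulrC.
Qed.

Lemma gramC E F : gram E F = gram F E.
Proof.
rewrite !gramE exchange_big; apply: eq_bigr => h _; apply: eq_bigr => g _.
by rewrite eq_sym.
Qed.

(** The matrix of these numbers is the Gram matrix of the unsigned incidence
    matrix. *)
Lemma gram_form v : \sum_E v E * \sum_F v F * gram E F = \sum_x incid v x ^+ 2.
Proof.
under [RHS]eq_bigr do rewrite expr2.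
have e E : \sum_F v F * gram E F = \sum_F v F * gram F E.
  by apply: eq_bigr => F _; rewrite (gramC E F).
have e2 E : v E * (\sum_F v F * gram E F) = v E * \sum_F v F * gram F E.
  exact: (congr1 (fun z => v E * z) (e E)).
transitivity (\sum_F v F * \sum_E v E * gram E F).
 apply: eq_bigr => E _. exact: e2.
exact: incid_gram.
Qed.

Lemma gram_form_ge0 v : 0 <= \sum_E v E * \sum_F v F * gram E F.
Proof. by rewrite gram_form; apply: sumr_ge0 => x _; apply: sqr_ge0. Qed.

Lemma gram_form_eq0 v : \sum_E v E * \sum_F v F * gram E F = 0 ->
  forall x, incid v x = 0.
Proof.
rewrite gram_form => /eqP; rewrite psumr_eq0 => [/allP h x|x _]; last exact: sqr_ge0.
by apply/eqP; have := h x (mem_index_enum x); rewrite sqrf_eq0.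
Qed.

Lemma gram_kernel v : (forall F, \sum_E v E * gram E F = 0) <-> forall x, incid v x = 0.
Proof.
split=> [h|h F]; last by rewrite gram_row big1 // => g _; rewrite h.
apply: gram_form_eq0; under eq_bigr do rewrite mulr_sumr.
rewrite exchange_big big1 // => F _.
by under eq_bigr do rewrite mulrCA; rewrite -mulr_sumr h mulr0.
Qed.

(** The unsigned incidence matrix is injective over the integers. *)
Definition incid_injective : Prop :=
  forall v : edge G -> int, (forall x, incid v x = 0) -> forall E, v E = 0.
End GramMatrix.

Section SmallSide.
Variable G : brauer_graph.
Local Notation val_of h := (valency (hv (h : Defs.half G))).

(** In a connected graph, an edge both of whose ends have valency 1 is the whole
    graph. *)
Lemma big_side_or : connected_graph G -> ~~ is_nonloop_edge G ->
  forall h : Defs.half G, (2 <= val_of h)%N || (2 <= val_of (hinv h))%N.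
Proof.
move=> [_ conn] + h; apply: contraNT; rewrite negb_or -!ltnNge !ltnS => /andP[h1 h1'].
have one g : (val_of g <= 1)%N -> forall g', hv g' = hv g -> g' = g.
  move=> g1 g' e; move: g1; rewrite /valency => /card_le1_eqP.
  by apply; rewrite inE ?e.
have nl : hv h != hv (hinv h).
  by apply/eqP => e; have /eqP := one h h1 (hinv h) (esym e); rewrite (negPf (hinv_neq h)).
have ends g : (hv g == hv h) || (hv g == hv (hinv h)) = (g == h) || (g == hinv h).
  apply/idP/idP => [/orP[] /eqP e|/orP[] /eqP ->]; rewrite ?eqxx ?orbT //.
    by rewrite (one h h1 g e) eqxx.
  by rewrite (one _ h1' g e) eqxx orbT.
have clo : closed (@adj G) [pred x | (x == hv h) || (x == hv (hinv h))].
  move=> x y /existsP[g /andP[/eqP <- /eqP <-]]; rewrite !inE !ends.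
  by rewrite !(inv_eq (@hinvK G)) hinvK orbC.
have all_x x : (x == hv h) || (x == hv (hinv h)).
  by have := closed_connect clo (conn (hv h) x); rewrite !inE eqxx => <-.
rewrite /is_nonloop_edge; apply/and3P; split.
- have -> : #|vert G| = #|[set hv h; hv (hinv h)]%SET|; last by rewrite cards2 nl.
  by rewrite -cardsT; apply: eq_card => x; rewrite !inE all_x.
- have -> : #|Defs.half G| = #|[set h; hinv h]%SET|.
    by rewrite -cardsT; apply: eq_card => g; rewrite !inE -ends all_x.
  by rewrite cards2 [_ == hinv h]eq_sym hinv_neq.
apply/forallP => g; have := all_x (hv g); rewrite ends => /orP[] /eqP -> //.
by rewrite hinvK eq_sym.
Qed.
End SmallSide.

Section EulerBrauer.
Variables (k : fieldType) (G : brauer_graph).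

Lemma brauer_presented (P : bqpres k) : P = @BQPres k (brauer_quiver G) (@brauer_rel G k) ->
    (forall h : Defs.half G, (2 <= valency (hv h))%N || (2 <= valency (hv (hinv h)))%N) ->
  euler_form_nonneg P /\ (euler_form_pos P <-> cartan_nonsingular P) /\
  (cartan_nonsingular P <-> incid_injective G).
Proof.
move=> -> big.
have cE (E F : edge G) : (hom_dim (@bq_scal k _ (@brauer_rel G k))
    (lproj (bq_idem (@brauer_rel G k) (E : qvert (brauer_quiver G))))
    (lproj (bq_idem (@brauer_rel G k) (F : qvert (brauer_quiver G)))))%:Z = gram E F.
  by rewrite (brauer_hom_dim _ big).
have [|v|] := @presented_euler k (@BQPres k (brauer_quiver G) (@brauer_rel G k))
  (@brauer_triv k G) (brauer_long k G) (@gram G) cE.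
- exact: gram_form_ge0.
- by move=> /gram_form_eq0 h; apply/gram_kernel.
move=> nn [pos sing]; split=> //; split=> //; apply: iff_trans sing _.
by split=> h v /gram_kernel; apply: h.
Qed.
End EulerBrauer.

Section SmallCases.
Variable k : fieldType.

(** Presentations with a single vertex, of algebras of dimension c > 0. *)
Lemma one_vertex_euler (P : bqpres k) (c : int) (i0 : qvert (bq_quiver P)) : 0 < c ->
    (forall i, i = i0) ->
    (forall y i, @bq_rel k P y -> triv_coef i y = 0) -> long_paths_vanish (@bq_rel k P) ->
    (hom_dim (@bq_scal k _ (@bq_rel k P)) (bq_proj i0) (bq_proj i0))%:Z = c ->
  euler_form_nonneg P /\ (euler_form_pos P <-> cartan_nonsingular P) /\ cartan_nonsingular P.
Proof.
move=> c0 all0 Radm Rlong cE.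
have sum1 (F : qvert (bq_quiver P) -> int) : \sum_i F i = F i0.
  by rewrite (bigD1 i0) //= big1 ?addr0 // => i; rewrite (all0 i) eqxx.
have [||//|nn [pos sing]] := @presented_euler k P Radm Rlong (fun _ _ => c).
- by move=> i j; rewrite (all0 i) (all0 j).
- move=> v; rewrite !sum1 mulrA; apply: mulr_ge0; last exact: ltW.
  by rewrite -expr2 sqr_ge0.
- move=> v; rewrite !sum1 mulrA => /eqP; rewrite mulf_eq0 (gt_eqF c0) orbF mulf_eq0 orbb.
  by move=> /eqP v0 j; rewrite sum1 v0 mul0r.
split=> //; split=> //; apply/sing => v kv i; rewrite (all0 i).
have /eqP := kv i0; rewrite sum1 mulf_eq0 (gt_eqF c0) orbF => /eqP; exact.
Qed.

Lemma point_euler : euler_form_nonneg (point_pres k) /\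
  (euler_form_pos (point_pres k) <-> cartan_nonsingular (point_pres k)) /\
  cartan_nonsingular (point_pres k).
Proof.
pose Q : quiver := bq_quiver (point_pres k); pose R := @bq_rel k (point_pres k).
have adm (y : pathalg k Q) (i : qvert Q) : R y -> triv_coef i y = 0 by [].
have lng : long_paths_vanish R by exists 1%N => i [|[]].
apply: (@one_vertex_euler (point_pres k) 1 tt) => //; first by case.
have -> // : hom_dim (@bq_scal k _ (@bq_rel k (point_pres k)))
  (bq_proj (P := point_pres k) tt) (bq_proj (P := point_pres k) tt) = #|{: unit}|.
  apply: (@hom_dim_paths k Q R adm lng tt tt unit (fun _ => [::])
    (fun _ => @triv_coef k Q tt)) => //.
  - by move=> _; exact: pcoef_linear.
  - move=> _ x; apply: ideal_vanish => //; exact: pcoef_linear.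
  - by move=> [] []; rewrite /triv_coef pcoef_path.
  - by case=> [|[]] // _ _; right; exists tt; rewrite subrr rpred0.
by rewrite card_unit.
Qed.

Lemma loop_euler : euler_form_nonneg (loop_pres k) /\
  (euler_form_pos (loop_pres k) <-> cartan_nonsingular (loop_pres k)) /\
  cartan_nonsingular (loop_pres k).
Proof.
pose Q : quiver := loop_quiver; pose R := @bq_rel k (loop_pres k).
have adm (y : pathalg k Q) (i : qvert Q) : R y -> triv_coef i y = 0.
  by move=> ->; rewrite /triv_coef pcoef_path xpair_eqE andbF.
have lvanish (i : qvert Q) (s : seq (qarr Q)) : (2 <= size s)%N -> @ppath k Q i s \in bq_ideal R.
  case: i s => -[|[] [|[] s]] // _.
  have ps : @is_path Q tt s by elim: s => [|[] s].
  by apply: (@factor_ideal k Q R tt [::] [:: tt; tt] s) => //; apply: rel_ideal.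
have lng : long_paths_vanish R by exists 2%N => i s _; apply: lvanish.
apply: (@one_vertex_euler (loop_pres k) 2 tt) => //; first by case.
pose w (b : bool) : seq (qarr Q) := if b then [:: tt] else [::].
have -> // : hom_dim (@bq_scal k _ (@bq_rel k (loop_pres k)))
  (bq_proj (P := loop_pres k) tt) (bq_proj (P := loop_pres k) tt) = #|{: bool}|.
  apply: (@hom_dim_paths k Q R adm lng tt tt bool w (fun b => @pcoef k Q (tt, w b))) => //.
  - by case.
  - by case.
  - by move=> b; exact: pcoef_linear.
  - move=> b x; apply: ideal_vanish => [|y i s j t -> _ _]; first exact: pcoef_linear.
    rewrite mulp3; case: ifP => _; rewrite ?pcoef_path.
      case: eqP => [[_ /(congr1 size)]|_]; last by rewrite andbF.
      by rewrite !size_cat !addnS; case: b.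
    by case: (functional_rules (@pcoef_linear k Q (tt, w b))).
  - by move=> [] []; rewrite pcoef_path.
  - case=> [|[] [|a s]] _ _.
    + by right; exists false; rewrite subrr rpred0.
    + by right; exists true; rewrite subrr rpred0.
    + by left; apply: lvanish.
by rewrite card_bool.
Qed.
End SmallCases.

(** * Cycles and incidence matrices of graphs *)

Lemma sum_enum_val (T : finType) (F : T -> rat) :
  \sum_t F t = \sum_(i < #|{: T}|) F (enum_val i).
Proof.
rewrite [LHS](reindex_onto enum_val enum_rank) /= => [|t _]; last exact: enum_rankK.
by apply: eq_bigl => i; rewrite enum_valK eqxx.
Qed.

Section Graphs.
Variable G : brauer_graph.
Local Notation half := (Defs.half G).
Implicit Types (h g : half) (E : edge G) (x : half -> rat) (tau : rat).

(** For tau = 1, the flows on the graph, which change sign when an edge is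
    reversed; for tau = -1, the kernel vectors of the unsigned incidence matrix. *)
Definition flow tau x : Prop :=
  (forall h, x (hinv h) = - tau * x h) /\ forall v, \sum_(h | hv h == v) x h = 0.

Section CycleFlow.
Variable tau : rat.
Hypothesis tau2 : tau * tau = 1.

(** The weights tau^0, tau^1, ... placed on the successive edges of the walk c,
    extended to the reversed half-edges by the rule of flows. *)
Fixpoint cwt (c : seq half) h : rat :=
  if c is g :: c' then (h == g)%:R - tau * (h == hinv g)%:R + tau * cwt c' h else 0.

Lemma cwt_inv c h : cwt c (hinv h) = - tau * cwt c h.
Proof.
elim: c => [|g c IHc] /=; first by rewrite mulr0.
rewrite IHc (inv_eq (@hinvK G)) (inj_eq (inv_inj (@hinvK G))).
rewrite mulrDr mulrCA; congr (_ + _).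
by rewrite mulrBr !mulNr opprK mulrA tau2 mul1r addrC.
Qed.

(** The half-edge g starts at the end of h. *)
Definition step h g := hv (hinv h) == hv g.

Lemma sum_at (v : vert G) g : \sum_(h | hv h == v) (h == g)%:R = (hv g == v)%:R :> rat.
Proof.
have [gv|gv] := boolP (hv g == v).
  by rewrite (bigD1 g) //= eqxx big1 ?addr0 // => h /andP[_ /negPf ->].
by rewrite big1 // => h hh; case: eqP => // e; rewrite -e hh in gv.
Qed.

(** The contributions of a walk telescope to those of its two ends. *)
Lemma cwt_path c g v : path step g c ->
  \sum_(h | hv h == v) cwt (g :: c) h =
    (hv g == v)%:R - tau ^+ (size c).+1 * (hv (hinv (last g c)) == v)%:R.
Proof.
elim: c g => [|g' c IHc] g.
  move=> _; under eq_bigr do rewrite /= mulr0 addr0.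
  by rewrite sumrB -mulr_sumr !sum_at expr1.
move=> /= /andP[/eqP gg' pc]; rewrite big_split sumrB /= -!mulr_sumr !sum_at.
have := IHc g' pc; rewrite /= => ->; rewrite gg' mulrBr addrA subrK.
by rewrite [in RHS]exprS mulrA.
Qed.

(** A cycle gives a flow, and an even cycle gives a vector of the kernel of the
    unsigned incidence matrix, with alternating signs. *)
Lemma cycle_flow c : is_cycle c -> tau ^+ size c = 1 -> flow tau (cwt c).
Proof.
case: c => [|g c] // /and4P[_ cyc _ _] taun; split=> [h|v]; first exact: cwt_inv.
move: cyc; rewrite /= rcons_path => /andP[pc /eqP lg].
by have := cwt_path v pc; rewrite -[(size c).+1]/(size (g :: c)) taun mul1r lg subrr.
Qed.

Lemma cwt_support c h : uniq [seq hedge g | g <- c] ->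
  (cwt c h != 0) = (hedge h \in [seq hedge g | g <- c]).
Proof.
have tau0 : tau != 0 by apply: contra_eq_neq tau2 => ->; rewrite mul0r eq_sym oner_neq0.
elim: c => [|g c IHc] /=; first by rewrite ?eqxx.
move=> /andP[gc uc]; rewrite in_cons hedge_eq.
have := IHc uc; case: (h =P g) => [-> |hg] /=.
  rewrite (negPf gc) => /negbFE/eqP ->; rewrite [g == hinv g]eq_sym (negPf (hinv_neq g)).
  by rewrite mulr0 subr0 addr0 oner_neq0.
case: (h =P hinv g) => [-> |hig] /=.
  rewrite hedge_inv (negPf gc) => /negbFE/eqP ->.
  by rewrite mulr1 sub0r mulr0 addr0 oppr_eq0.
by rewrite mulr0 subr0 add0r mulf_eq0 negb_or tau0.
Qed.
End CycleFlow.

(** A nonempty set of half-edges, closed under iota and without leaves, contains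
    a cycle: continue a walk without backtracking until a vertex is repeated for
    the first time. *)
Lemma leafless_cycle (S : pred half) h0 : S h0 -> (forall h, S h -> S (hinv h)) ->
    (forall h, S h -> exists2 g, S g & hv g = hv h /\ g != h) ->
  exists c : seq half, is_cycle c.
Proof.
move=> Sh0 Sinv Sleaf.
have nextP h : exists g, S h -> [/\ S g, hv g = hv (hinv h) & g != hinv h].
  have [Sh|nS] := boolP (S h); last by exists h.
  by have [g Sg [e ne]] := Sleaf _ (Sinv h Sh); exists g.
pose f h := sval (cid (nextP h)).
have fP h : S h -> [/\ S (f h), hv (f h) = hv (hinv h) & f h != hinv h].
  exact: (svalP (cid (nextP h))).
have Sit h n : S h -> S (iter n f h) by move=> Sh; elim: n => //= n /fP[].
have rep_ex : exists n, ~~ uniq [seq hv h | h <- traject f h0 n].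
  exists #|vert G|.+1; apply/negP => /card_uniqP e.
  by have := max_card [in [seq hv h | h <- traject f h0 #|vert G|.+1]];
     rewrite e size_map size_traject ltnn.
(* j is the first index at which the walk returns to a vertex, visited before
   at index i. *)
have [m mP mmin] := ex_minnP rep_ex.
case: m => [//|j] in mP mmin *.
have uj : uniq [seq hv h | h <- traject f h0 j].
  by apply: contraT => /mmin; rewrite ltnn.
have : hv (iter j f h0) \in [seq hv h | h <- traject f h0 j].
  by apply: contraNT mP => nin; rewrite trajectSr map_rcons rcons_uniq nin.
case/mapP => h1 /trajectP[i ij ->] e {h1}.
pose h1 := iter i f h0; pose n := (j - i)%N.
have Sh1 : S h1 by apply: Sit.
have n0 : (0 < n)%N by rewrite subn_gt0.
have back : hv (iter n f h1) = hv h1 by rewrite /n /h1 -iterD subnK // ltnW.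
have un : uniq [seq hv h | h <- traject f h1 n].
  move: uj; rewrite -{1}(subnKC (ltnW ij)) trajectD map_cat cat_uniq.
  by case/and3P.
have hvS l : hv (iter l.+1 f h1) = hv (hinv (iter l f h1)).
  by have [] := fP (iter l f h1) (Sit h1 l Sh1).
exists (traject f h1 n); apply/and4P; split=> //.
- by case: n n0 {back un}.
- have pathf l h : S h -> path step h (traject f (f h) l).
    elim: l h => //= l IHl h Sh; have [Sf e1 _] := fP h Sh.
    by rewrite /step e1 eqxx IHl.
  case: n n0 back {un} => // n _ back; rewrite /= rcons_path pathf //=.
  by rewrite last_traject -hvS back.
- rewrite map_inj_in_uniq.
    by apply: (map_uniq un).
  have iterinj a b : (a < n)%N -> (b < n)%N -> hv (iter a f h1) = hv (iter b f h1) -> a = b.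
    move=> an bn ab; apply/eqP.
    have sz : size [seq hv h | h <- traject f h1 n] = n by rewrite size_map size_traject.
    rewrite -(nth_uniq (hv h1) _ _ un) ?sz //.
    by rewrite !(nth_map h1) ?size_traject // !nth_traject // ab.
  (* Two traversals of the same edge would be successive, against the absence of
     backtracking. *)
  have clash a b : (a < b)%N -> (b < n)%N -> iter b f h1 != hinv (iter a f h1).
    move=> ab bn; apply/eqP => eb.
    have ba : b = a.+1.
      by apply: iterinj => //; [exact: leq_ltn_trans ab bn|rewrite eb hvS].
    have [_ _] := fP (iter a f h1) (Sit h1 a Sh1).
    by rewrite -[f (iter a f h1)]/(iter a.+1 f h1) -ba eb eqxx.
  move=> _ _ /trajectP[a an ->] /trajectP[b bn ->] /eqP; rewrite hedge_eq.
  case/orP => [/eqP //|/eqP ab].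
  case: (ltngtP a b) => [lt|lt|-> //].
    by have := clash a b lt bn; rewrite ab hinvK eqxx.
  by have := clash b a lt an; rewrite ab eqxx.
Qed.

(** By the sum condition at a vertex, the support of a flow has no leaves. *)
Lemma flow_cycle tau x h0 : tau * tau = 1 -> flow tau x -> x h0 != 0 ->
  exists c : seq half, is_cycle c.
Proof.
move=> tau2 [xinv xsum] xh0.
have tau0 : tau != 0 by apply: contra_eq_neq tau2 => ->; rewrite mul0r eq_sym oner_neq0.
apply: (leafless_cycle (S := fun h => x h != 0) xh0) => [h xh|h xh].
  by rewrite xinv mulf_neq0 // oppr_eq0.
case: (pickP [pred g | (hv g == hv h) && (g != h) && (x g != 0)]) => [g /=|none].
  by move=> /andP[/andP[/eqP gh ne] xg]; exists g.
have := xsum (hv h); rewrite (bigD1 h) //= big1 ?addr0 => [/eqP|g /andP[gh ne]].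
  by rewrite (negPf xh).
by apply/eqP; have := none g; rewrite /= gh ne /= => /negbFE.
Qed.

Section IncidenceMatrix.
Variable tau : rat.
Hypothesis tau2 : tau * tau = 1.

(** The incidence numbers of an edge E: unsigned if tau = -1, and oriented by the
    chosen half-edge of E if tau = 1. *)
Definition inc_entry E (v : vert G) : rat :=
  (hv (rep E) == v)%:R - tau * (hv (hinv (rep E)) == v)%:R.

(** The incidence matrix, with rows indexed by the edges; the flows form its left
    kernel. *)
Definition incmx : 'M[rat]_(#|{: edge G}|, #|vert G|) :=
  \matrix_(i, j) inc_entry (enum_val i) (enum_val j).

Lemma sum_half (F : half -> rat) : \sum_h F h = \sum_E (F (rep E) + F (hinv (rep E))).
Proof.
rewrite (partition_big (@hedge G) xpredT) //=; apply: eq_bigr => E _.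
have ne : hinv (rep E) != rep E by exact: hinv_neq.
rewrite (bigD1 (rep E)) ?repE //= (bigD1 (hinv (rep E))) /= ?hedge_inv ?repE ?eqxx //.
rewrite big1 ?addr0 // => h /andP[/andP[/eqP hE h1] h2].
have := hedge_eq h (rep E).
by rewrite repE hE eqxx (negPf h1) (negPf h2).
Qed.

(** The function on half-edges with given values at the chosen half-edges. *)
Definition extend (z : edge G -> rat) h : rat :=
  z (hedge h) * (if h == rep (hedge h) then 1 else - tau).

Lemma extend_rep z E : extend z (rep E) = z E.
Proof. by rewrite /extend repE eqxx mulr1. Qed.

Lemma extend_inv z h : extend z (hinv h) = - tau * extend z h.
Proof.
rewrite /extend hedge_inv mulrCA; congr (_ * _).
have := hedge_eq h (rep (hedge h)); rewrite repE eqxx => /esym.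
case: eqP => [<- _|_ /= /eqP e]; first by rewrite (negPf (hinv_neq h)) mulr1.
by rewrite {1}e hinvK eqxx mulrNN tau2.
Qed.

Lemma extend_sum z v : \sum_(h | hv h == v) extend z h = \sum_E z E * inc_entry E v.
Proof.
rewrite big_mkcond sum_half; apply: eq_bigr => E _.
rewrite extend_inv extend_rep /inc_entry mulrBr.
by case: ifP => _; case: ifP => _; rewrite ?mulr1 ?mulr0 ?subr0 ?addr0 ?add0r ?sub0r //
  ?mulNr 1?mulrC // mulrC.
Qed.

Lemma extend_flow z : (\row_i z (enum_val i)) *m incmx = 0 -> flow tau (extend z).
Proof.
move=> /rowP zA; split=> [h|v]; first exact: extend_inv.
rewrite extend_sum; have := zA (enum_rank v); rewrite !mxE => zv; rewrite -[RHS]zv.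
rewrite [LHS]sum_enum_val.
by apply: eq_bigr => i _; rewrite !mxE enum_rankK.
Qed.

Lemma flow_extend x : flow tau x -> x =1 extend (fun E => x (rep E)).
Proof.
move=> [xinv _] h; rewrite /extend; have := hedge_eq h (rep (hedge h)).
rewrite repE eqxx => /esym; case: eqP => [<- _|_ /= /eqP e]; first by rewrite mulr1.
by rewrite {1}e xinv mulrC.
Qed.

Lemma flow_row x : flow tau x -> (\row_i x (rep (enum_val i))) *m incmx = 0.
Proof.
move=> fx; have xe := flow_extend fx; have [_ xsum] := fx.
apply/rowP => j; rewrite !mxE -[RHS](xsum (enum_val j)).
rewrite (eq_bigr _ (fun h _ => xe h)) extend_sum.
rewrite [RHS]sum_enum_val.
by apply: eq_bigr => i _; rewrite !mxE.
Qed.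

Definition no_flow : Prop := forall x, flow tau x -> forall h, x h = 0.

Lemma row_free_no_flow : row_free incmx <-> no_flow.
Proof.
split=> [rf x fx h|nf].
  have /eqP := flow_row fx; rewrite mulmx_free_eq0 // => /eqP/rowP/(_ (enum_rank (hedge h))).
  by rewrite !mxE enum_rankK => xr; rewrite (flow_extend fx) /extend xr mul0r.
rewrite -kermx_eq0; apply/rowV0P => z /sub_kermxP zA.
pose z' E := z 0 (enum_rank E).
have ez : z = \row_i z' (enum_val i) by apply/rowP => i; rewrite mxE /z' enum_valK.
have /nf z0 : flow tau (extend z') by apply: extend_flow; rewrite -ez.
by apply/rowP => i; rewrite ez !mxE -extend_rep z0.
Qed.

(** A vector of the right kernel of the incidence matrix is a function on the
    vertices which is multiplied by tau along each edge. *)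
Lemma cokernel_potential (y : 'rV[rat]_#|vert G|) : y *m incmx^T = 0 ->
  forall h, y 0 (enum_rank (hv h)) = tau * y 0 (enum_rank (hv (hinv h))).
Proof.
move=> /rowP yA.
have atrep E : y 0 (enum_rank (hv (rep E))) = tau * y 0 (enum_rank (hv (hinv (rep E)))).
  apply/eqP; rewrite -subr_eq0; apply/eqP; have := yA (enum_rank E); rewrite !mxE => <-.
  transitivity (\sum_v y 0 (enum_rank v) * inc_entry E v); last first.
    rewrite [LHS]sum_enum_val; apply: eq_bigr => i _.
    by rewrite !mxE enum_rankK enum_valK.
  under eq_bigr do rewrite /inc_entry mulrBr mulrCA.
  have pick w : \sum_v y 0 (enum_rank v) * (w == v)%:R = y 0 (enum_rank w).
    rewrite (bigD1 w) //= eqxx mulr1 big1 ?addr0 // => v vw.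
    by rewrite eq_sym (negPf vw) mulr0.
  by rewrite sumrB -mulr_sumr !pick.
move=> h; have := hedge_eq h (rep (hedge h)); rewrite repE eqxx => /esym/orP[]/eqP e.
  by rewrite e.
have -> : hinv h = rep (hedge h) by rewrite {1}e hinvK.
by rewrite (atrep (hedge h)) mulrA tau2 mul1r -e.
Qed.

Lemma rank_incmx : (\rank incmx + \rank (kermx incmx^T) = #|vert G|)%N.
Proof. by rewrite mxrank_ker mxrank_tr subnKC // rank_leq_col. Qed.

End IncidenceMatrix.

Section Connected.
Hypothesis conn : connected_graph G.
Let one2 : (1 : rat) * 1 = 1 := mulr1 1.
Let m1m1 : (- 1 : rat) * - 1 = 1 := mulrNN 1 1.

Lemma connected_const (T : Type) (F : vert G -> T) :
  (forall h : half, F (hv h) = F (hv (hinv h))) -> forall v w, F v = F w.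
Proof.
move=> Fh v w; case/connectP: (proj2 conn v w) => q + ->.
elim: q v => //= u q IHq v /andP[/existsP[h /andP[/eqP <- /eqP hu]] /IHq <-].
by rewrite Fh hu.
Qed.

(** The right kernel of the oriented incidence matrix of a connected graph
    consists of the constant functions. *)
Lemma rank_oriented : (\rank (incmx 1)).+1 = #|vert G|.
Proof.
suff k1 : \rank (kermx (incmx 1)^T) = 1%N by have := rank_incmx 1; rewrite k1 addn1.
have [n0 _] := conn; have [v0 _|none] := pickP (mem (vert G)); last first.
  by rewrite (eq_card none) card0 in n0.
apply/eqP; rewrite eqn_leq; apply/andP; split.
  apply: leq_trans (rank_leq_row (const_mx 1 : 'rV[rat]_#|vert G|)).
  apply: mxrankS; apply/row_subP => i; set y := row i _.
  have /(cokernel_potential one2) hy : y *m (incmx 1)^T = 0.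
    by rewrite -row_mul mulmx_ker row0.
  have cy := connected_const (F := fun v => y 0 (enum_rank v)) (fun h => etrans (hy h) (mul1r _)).
  have -> : y = y 0 (enum_rank v0) *: const_mx 1.
    apply/rowP => j; have := cy (enum_val j) v0; rewrite enum_valK => ->.
    by rewrite !mxE mulr1.
  exact: scalemx_sub.
rewrite lt0n mxrank_eq0; apply/rowV0Pn; exists (const_mx 1); last first.
  by apply/eqP => /rowP/(_ (enum_rank v0)); rewrite !mxE => /eqP; rewrite oner_eq0.
apply/sub_kermxP/rowP => i; rewrite !mxE.
have sum1 (w : vert G) : \sum_(j < #|vert G|) (w == enum_val j)%:R = 1 :> rat.
  rewrite (bigD1 (enum_rank w)) //= enum_rankK eqxx big1 ?addr0 // => j jw.
  rewrite (negPf (_ : w != enum_val j)) //.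
  by apply: contraNneq jw => ->; rewrite enum_valK.
under eq_bigr do rewrite !mxE /inc_entry mul1r mul1r.
by rewrite sumrB !sum1 subrr.
Qed.

Lemma edges_ge : (#|vert G| <= #|{: edge G}|.+1)%N.
Proof. by rewrite -rank_oriented ltnS; apply: rank_leq_row. Qed.

Lemma tree_no_flow : #|vert G| = #|{: edge G}|.+1 -> no_flow 1.
Proof.
move=> vE; apply/row_free_no_flow => //; rewrite /row_free.
by apply/eqP/succn_inj; rewrite rank_oriented.
Qed.

(** On a connected graph with as many edges as vertices, the flows form a line. *)
Lemma unicyclic_flow : #|vert G| = #|{: edge G}| ->
  (exists2 x, flow 1 x & exists h, x h != 0) /\
  (forall x y, flow 1 x -> flow 1 y -> (exists h, x h != 0) ->
     exists a, forall h, y h = a * x h).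
Proof.
move=> vE; set K := kermx (incmx 1).
have rK : \rank K = 1%N.
  have e := etrans rank_oriented vE.
  by rewrite /K mxrank_ker -[X in (X - _)%N]e subSnn.
split.
  have /rowV0Pn[z /sub_kermxP zA z0] : K != 0 by rewrite -mxrank_eq0 rK.
  pose z' E := z 0 (enum_rank E).
  have ez : z = \row_i z' (enum_val i) by apply/rowP => i; rewrite mxE /z' enum_valK.
  exists (extend 1 z'); first by apply: extend_flow => //; rewrite -ez.
  have /rV0Pn[i zi] := z0; exists (rep (enum_val i)).
  by rewrite extend_rep /z' enum_valK.
move=> x y fx fy [h xh].
pose u := \row_i x (rep (enum_val i)) : 'rV[rat]_#|{: edge G}|.
pose w := \row_i y (rep (enum_val i)) : 'rV[rat]_#|{: edge G}|.
have uK : (u <= K)%MS by apply/sub_kermxP/flow_row.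
have wK : (w <= K)%MS by apply/sub_kermxP/flow_row.
have u0 : u != 0.
  apply: contraNneq xh => /rowP/(_ (enum_rank (hedge h))); rewrite !mxE enum_rankK => xr.
  by rewrite (flow_extend fx) /extend xr mul0r.
have ru : \rank u = 1%N by rewrite rank_rV u0.
have Ku : (K <= u)%MS by rewrite -(mxrank_leqif_sup uK) ru rK.
have /sub_rVP[a wa] := submx_trans wK Ku.
exists a => g; rewrite (flow_extend fy) (flow_extend fx) /extend mulrA; congr (_ * _).
by have /rowP/(_ (enum_rank (hedge g))) := wa; rewrite !mxE enum_rankK.
Qed.

Lemma no_flow_edges_le : no_flow (- 1) -> (#|{: edge G}| <= #|vert G|)%N.
Proof.
move=> /(row_free_no_flow m1m1)/eqP <-; exact: rank_leq_col.
Qed.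

Lemma cycle_nonzero tau (c : seq half) : tau * tau = 1 -> is_cycle c ->
  exists h, cwt tau c h != 0.
Proof.
case: c => [|g c] // tau2 /and4P[_ _ _ ue]; exists g.
by rewrite cwt_support // in_cons eqxx.
Qed.

(** A function on the vertices which changes sign along each edge vanishes on an
    odd closed walk, hence everywhere; so a square unsigned incidence matrix is
    invertible. *)
Lemma odd_cycle_no_flow (c : seq half) : #|vert G| = #|{: edge G}| ->
  is_cycle c -> odd (size c) -> no_flow (- 1).
Proof.
move=> vE cyc codd; apply/(row_free_no_flow m1m1); rewrite /row_free.
suff k0 : \rank (kermx (incmx (- 1))^T) = 0%N.
  by have := rank_incmx (- 1); rewrite k0 addn0 => r; apply/eqP; apply: etrans r vE.
apply/eqP; rewrite mxrank_eq0; apply/rowV0P => y /sub_kermxP/(cokernel_potential m1m1) hy.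
pose Y v := y 0 (enum_rank v).
have hY h : Y (hv h) = - Y (hv (hinv h)) by rewrite /Y hy mulN1r.
have walk g q : path step g q ->
    Y (hv g) = (- 1) ^+ (size q).+1 * Y (hv (hinv (last g q))).
  elim: q g => [|g' q IHq] g /=; first by rewrite expr1 mulN1r => _; apply: hY.
  by move=> /andP[/eqP e /IHq IH]; rewrite hY e IH [in RHS]exprS mulN1r mulNr.
case: c cyc codd => [|g c] // /and4P[_ + _ _].
rewrite /= rcons_path => /andP[/walk e /eqP lg]; rewrite /= => codd.
have Yg : Y (hv g) = 0.
  have : Y (hv g) = - Y (hv g).
    by rewrite {1}e lg -signr_odd /= codd expr1 mulN1r.
  by move/eqP; rewrite -addr_eq0 -mulr2n mulrn_eq0 => /eqP.
have nY h : (Y (hv h) == 0) = (Y (hv (hinv h)) == 0) by rewrite hY oppr_eq0.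
apply/rowP => j; rewrite mxE -[j]enum_valK; apply/eqP.
have := connected_const (F := fun v => Y v == 0) nY (enum_val j) (hv g).
by rewrite Yg eqxx.
Qed.

Lemma card_edges : #|{: edge G}| = #|edges G|.
Proof. by rewrite card_sig; apply: eq_card. Qed.

Lemma int_flow (v : edge G -> int) : (forall w, incid v w = 0) ->
  flow (- 1) (fun h => (v (hedge h))%:~R).
Proof.
move=> v0; split=> [h|w]; first by rewrite hedge_inv opprK mul1r.
by rewrite -rmorph_sum /=; have := v0 w; rewrite /incid => ->.
Qed.

(** Injectivity over the integers and over the rationals agree, by clearing
    denominators. *)
Lemma incid_injective_flow : incid_injective G <-> no_flow (- 1).
Proof.
split=> [inj x fx|nf v /int_flow/nf h E]; last first.
  by have /eqP := h (rep E); rewrite repE intr_eq0 => /eqP.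
have [xinv xsum] := fx.
pose d : int := \prod_h denq (x h).
have d0 : d != 0 by apply/prodf_neq0 => h _; apply: denq_neq0.
have dx h : exists n : int, d%:~R * x h = n%:~R.
  exists (numq (x h) * \prod_(g | g != h) denq (x g)).
  by rewrite /d (bigD1 h) //= !intrM numqE [LHS]mulrC mulrA.
have /all_sig[n hn] h := cid (dx h).
have ninv h : n (hinv h) = n h.
  by apply: (intr_inj (R := rat)); rewrite -!hn xinv opprK mul1r.
pose v E := n (rep E).
have vn h : v (hedge h) = n h.
  rewrite /v; have := hedge_eq h (rep (hedge h)); rewrite repE eqxx => /esym/orP[]/eqP e.
    by rewrite -e.
  by rewrite {2}e ninv.
have v0 : forall w, incid v w = 0.
  move=> w; apply: (intr_inj (R := rat)); rewrite /incid rmorph_sum /=.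
  under eq_bigr do rewrite vn -hn.
  by rewrite -mulr_sumr xsum mulr0.
move=> h; have := inj v v0 (hedge h); rewrite vn => nh.
by have /eqP := hn h; rewrite nh mulf_eq0 intr_eq0 (negPf d0) => /eqP.
Qed.

Theorem incid_injectiveP :
  incid_injective G <-> is_tree G \/ (is_1cycle G /\ unique_cycle_odd G).
Proof.
apply: iff_trans incid_injective_flow _; split=> [nf|].
  have le := no_flow_edges_le nf; have ge := edges_ge.
  move: le; rewrite leq_eqVlt => /orP[/eqP eE|lt]; last first.
    left; split=> // c; apply/negP => cyc.
    have eV : #|vert G| = #|{: edge G}|.+1 by apply/eqP; rewrite eqn_leq ge lt.
    have [h] := cycle_nonzero one2 cyc.
    by rewrite (tree_no_flow eV (cycle_flow one2 cyc (expr1n _ _))) eqxx.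
  right; split; first by split=> //; rewrite -card_edges eE subrr add0r.
  have [[x fx [h xh]] line] := unicyclic_flow (esym eE).
  have [c cyc] := flow_cycle one2 fx xh.
  exists c; split.
    split=> // c' cyc' E.
    have supp (b : seq half) : is_cycle b ->
        (E \in [seq hedge h | h <- b]) = (cwt 1 b (rep E) != 0).
      by move=> /and4P[_ _ _ ub]; rewrite cwt_support // repE.
    have fc := cycle_flow one2 cyc (expr1n _ _).
    have fc' := cycle_flow one2 cyc' (expr1n _ _).
    have nc := cycle_nonzero one2 cyc; have nc' := cycle_nonzero one2 cyc'.
    have [a ha] := line _ _ fc fc' nc.
    have a0 : a != 0.
      have [g] := nc'; rewrite ha; apply: contraNneq => ->; by rewrite mul0r.
    by rewrite !supp // ha mulf_eq0 negb_or a0.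
  apply: contraT => even.
  have taun : (- 1 : rat) ^+ size c = 1 by rewrite -signr_odd (negPf even) expr0.
  have [g] := cycle_nonzero m1m1 cyc.
  by rewrite (nf _ (cycle_flow m1m1 cyc taun)) eqxx.
case=> [[_ acyc]|[[_ eE] [c [[cyc _] codd]]]].
  move=> x fx h; apply/eqP; apply: contraT => xh.
  have [c cyc] := flow_cycle m1m1 fx xh.
  by have := acyc c; rewrite cyc.
apply: odd_cycle_no_flow cyc codd; rewrite card_edges.
apply/eqP; rewrite -eqz_nat eq_sym -subr_eq0; apply/eqP.
by apply: (addIr 1); rewrite eE add0r.
Qed.
End Connected.
End Graphs.

(** * The criterion *)

Lemma vertex_tree (G : brauer_graph) : connected_graph G -> is_vertex G -> is_tree G.
Proof.
move=> conn /andP[_ /eqP h0]; split=> // -[|h c] //.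
by have /card0_eq/(_ h) := h0.
Qed.

Lemma nonloop_edge_tree (G : brauer_graph) :
  connected_graph G -> is_nonloop_edge G -> is_tree G.
Proof.
move=> conn /and3P[_ /eqP h2 /forallP nl]; split=> // -[|h c] //.
apply/negP => /and4P[_ cyc _ ue].
have all_h g : hedge g = hedge h.
  apply/eqP; rewrite hedge_eq.
  have /setP/(_ g) : [set h; hinv h]%SET = [set: Defs.half G]%SET.
    by apply/eqP; rewrite eqEcard finset.subsetT cardsT h2 cards2 [h == _]eq_sym hinv_neq.
  by rewrite !inE.
case: c cyc ue => [|g c]; first by rewrite /= andbT eq_sym (negPf (nl h)).
by move=> _; rewrite /= inE all_h eqxx.
Qed.

Theorem theorem4p39 (k : closedFieldType) (G : brauer_graph)
    (hconn : connected_graph G) (hmult : trivial_mult G) :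
  euler_form_nonneg (brauer_alg G k) /\
  (euler_form_pos (brauer_alg G k) <-> cartan_nonsingular (brauer_alg G k)) /\
  (cartan_nonsingular (brauer_alg G k) <->
     is_tree G \/ (is_1cycle G /\ unique_cycle_odd G)).
Proof.
have [vG|nvG] := boolP (is_vertex G).
  rewrite /brauer_alg vG; have [nn [pos ns]] := point_euler k; split=> //; split=> //.
  by split=> // _; left; apply: vertex_tree.
have [eG|neG] := boolP (is_nonloop_edge G).
  rewrite /brauer_alg (negPf nvG) eG; have [nn [pos ns]] := loop_euler k.
  by split=> //; split=> //; split=> // _; left; apply: nonloop_edge_tree.
have PE : brauer_alg G k = @BQPres k (brauer_quiver G) (@brauer_rel G k).
  by rewrite /brauer_alg (negPf nvG) (negPf neG).
have [nn [pos ns]] := brauer_presented PE (big_side_or hconn neG).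
by split=> //; split=> //; apply: iff_trans ns (incid_injectiveP hconn).
Qed.
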